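(* (i) If $\psi$ is (sub)critical then, for $0<r\le s$, $$\Psi(r,\theta)\le\Psi(s,\theta)\qquad\text{for all }\theta\ge0.$$ (ii) If $\psi$ is supercritical then, for $0<r\le s$, $$\Psi(r,\theta)\ge\Psi(s,\theta)\quad\text{for all }0\le\theta\le\lambda^*,\qquad \Psi(r,\theta)\le\Psi(s,\theta)\quad\text{for all }\theta\ge\lambda^*.$$
   Context: Branching mechanism. Let $d\ge1$ and $$\psi(\lambda)=-\alpha\lambda+\beta\lambda^2+\int_{(0,\infty)}(e^{-\lambda x}-1+\lambda x)\,\Pi(dx),\quad \lambda\ge0,$$ where $\alpha=-\psi'(0+)\in(-\infty,\infty)$, $\beta\ge0$ and $\Pi$ is a measure concentrated on $(0,\infty)$ with $\int_{(0,\infty)}(x\wedge x^2)\Pi(dx)<\infty$. Assume $\psi(\infty)=\infty$. $\psi$ is (sub)critical if $\psi'(0+)\ge0$ and supercritical if $\psi'(0+)<0$. Put $\lambda^*:=\inf\{\lambda\ge0:\psi(\lambda)>0\}$, which is finite; $\lambda^*=0$ in the (sub)critical case and $\lambda^*>0$ in the supercritical case. Super-Brownian motion and exit measures. $X=(X_t,t\ge0)$ is a super-Brownian motion in $\mathbb{R}^d$ with branching mechanism $\psi$, with law $\mathbf{P}_\mu$ when started from a finite, compactly supported measure $\mu$. $\mathcal{M}_F(D)$ is the set of finite measures supported on $D\subset\mathbb{R}^d$, $\|\mu\|$ is the total mass of $\mu$, and $\langle f,\mu\rangle=\int f\,d\mu$. Let $D_s=\{x\in\mathbb{R}^d:\|x\|<s\}$.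 Dynkin's branching Markov exit measure $X_{D_s}$ is the random measure on $\partial D_s$ obtained by freezing the mass of $X$ when it first hits $\partial D_s$. The family $(X_{D_s},s\ge r)$, for $X$ started from a measure on $D_r$ or on $\partial D_r$ (in the latter case $X_{D_r}=\mu$), is characterised by the branching Markov property: for every positive bounded continuous $f$ on $\partial D_s$, $$\mathbf{E}_\mu[e^{-\langle f,X_{D_s}\rangle}\mid\mathcal{F}_{D_z}]=e^{-\langle v_f(\cdot,s),X_{D_z}\rangle},\quad 0<r\le z\le s,\qquad \mathcal{F}_{D_z}=\sigma(X_{D_{z'}},r\le z'\le z),$$ where $v_f$ is the unique non-negative solution of $v_f(x,s)=\mathbb{E}_x[f(\xi_{T_s})]-\mathbb{E}_x[\int_0^{T_s}\psi(v_f(\xi_z,s))\,dz]$, with $\xi$ a Brownian motion in $\mathbb{R}^d$ started at $x$ and $T_s$ its first exit time from $D_s$. Total mass process. $Z_s:=\|X_{D_s}\|\in[0,\infty]$, $s\ge r$. $P_{a,r}$ (expectation $E_{a,r}$) is the law of $(Z_s,s\ge r)$ when $X$ starts from $\mu\in\mathcal{M}_F(\partial D_r)$ with $\|\mu\|=a>0$; by radial symmetry it depends on $\mu$ only through $a$. $P_r:=P_{1,r}$. Convention: $e^{-\theta Z_s}=0$ on $\{Z_s=\infty\}$, for all $\theta\ge0$. The mechanism $\Psi$. $Z$ is a time-inhomogeneous continuous-state branching process with $E_{a,r}[e^{-\theta Z_s}]=e^{-u(r,s,\theta)a}$ for $0<r\le s$, $\theta\ge0$, and $(\Psi(r,\cdot),r>0)$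 denotes its family of branching mechanisms: $\Psi(s,\theta)=\frac{\partial}{\partial r}u(r,s,\theta)|_{r=s}$ and $u(r,s,\theta)=\theta-\int_r^s\Psi(z,u(z,s,\theta))\,dz$, where each $\Psi(r,\cdot)$ has the form $\Psi(r,\theta)=-q_r+a_r\theta+b_r\theta^2+\int_{(0,\infty)}(e^{-\theta x}-1+\theta x\mathbf{1}_{(x<1)})\Lambda_r(dx)$ with $q_r\ge0$, $a_r\in\mathbb{R}$, $b_r\ge0$ and $\int_{(0,\infty)}(1\wedge x^2)\Lambda_r(dx)<\infty$. *)

(* Defs.v *)
From HB Require Import structures.
From mathcomp Require Export all_boot all_order all_algebra.
From mathcomp Require Export all_classical all_reals all_analysis.
From mathcomp Require Export measurable_realfun.
Export Order.TTheory GRing.Theory Num.Theory.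
Export numFieldNormedType.Exports.

Set Implicit Arguments.
Unset Strict Implicit.
Unset Printing Implicit Defensive.

Local Open Scope classical_set_scope.
Local Open Scope ring_scope.

(* R^d is 'rV[R]_d with the sigma-algebra generated by its open sets. *)
HB.instance Definition _ (R : realType) (d : nat) :=
  @isMeasurable.Build (sigma_display (@open 'rV[R]_d)) 'rV[R]_d
    <<s @open 'rV[R]_d >> (@sigma_algebra0 _ setT _) (@sigma_algebraC _ _)
    (@sigma_algebra_bigcup _ setT _).

(* The norm `|x| of 'rV[R]_d is the sup norm; balls here are Euclidean. *)
Definition enorm (R : realType) (d : nat) (x : 'rV[R]_d) : R :=
  Num.sqrt (\sum_(i < d) x ord0 i ^+ 2).

Definition esphere (R : realType) (d : nat) (s : R) : set 'rV[R]_d :=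
  [set x | enorm x = s].

Definition ecball (R : realType) (d : nat) (s : R) : set 'rV[R]_d :=
  [set x | enorm x <= s].

Arguments esphere {R} d s.
Arguments ecball {R} d s.

Section branching_mechanism.
Context {R : realType}.

Definition branching_mechanism (alpha beta : R) (Pi : {measure set R -> \bar R})
    (l : R) : R :=
  - alpha * l + beta * l ^+ 2 +
  \int[Pi]_(x in `]0, +oo[) (expR (- (l * x)) - 1 + l * x).

Record branching_parameters (alpha beta : R)
    (Pi : {measure set R -> \bar R}) : Prop := BranchingParameters {
  bp_beta_ge0 : 0 <= beta ;
  bp_concentrated : Pi `]-oo, 0]%classic = 0%E ;
  bp_moment :
    (\int[Pi]_(x in `]0%R, +oo[) (Num.min x (x ^+ 2))%:E < +oo)%E ;
  bp_infty : branching_mechanism alpha beta Pi l @[l --> +oo] --> +oo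
}.

Definition deriv_at_0plus (psi : R -> R) : R :=
  lim ((psi h - psi 0) / h @[h --> 0^'+]).

Definition subcritical (psi : R -> R) : Prop := 0 <= deriv_at_0plus psi.

Definition supercritical (psi : R -> R) : Prop := deriv_at_0plus psi < 0.

Definition lambda_star (psi : R -> R) : R :=
  inf [set l | 0 <= l /\ 0 < psi l].

End branching_mechanism.

Section brownian_motion.
Context {R : realType} {disp : measure_display} {Om : measurableType disp}.

(* Standard d-dimensional Brownian motion started at 0.  The product rule says
   at once that increments over disjoint intervals are independent, that the
   coordinates of each increment are independent, and that each coordinate of
   the increment over [t, t'] is N(0, t' - t) (the second argument of
   normal_prob is the standard deviation). *)
Record brownian_motion (d : nat) (P : probability Om R)
    (W : R -> Om -> 'rV[R]_d) : Prop := BrownianMotion {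
  bm_start : forall w, W 0 w = 0 ;
  bm_measurable : forall t, 0 <= t -> measurable_fun setT (W t) ;
  bm_continuous : forall w, {within `[0, +oo[, continuous (W ^~ w)} ;
  bm_increments : forall (n : nat) (t : nat -> R) (A : nat -> 'I_d -> set R),
    0 <= t 0%N -> (forall k, t k < t k.+1) ->
    (forall k i, measurable (A k i)) ->
    P [set w | forall k, (k < n)%N -> forall i,
               A k i (W (t k.+1) w ord0 i - W (t k) w ord0 i)] =
    (\prod_(k < n) \prod_(i < d)
       normal_prob 0%R (Num.sqrt (t k.+1 - t k)%R) (A k i))%E
}.

(* First exit time of a path from D_s; +oo if the path never leaves. *)
Definition exit_time (d : nat) (s : R) (p : R -> 'rV[R]_d) : \bar R :=
  ereal_inf [set t%:E | t in [set t | 0 <= t /\ s <= enorm (p t)]].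

(* v = v_f(., s) on the closed ball, the Brownian motion started at x being
   x + W.  The exit time is almost surely finite, so the value of fine at +oo
   is irrelevant. *)
Definition exit_equation (d : nat) (P : probability Om R)
    (W : R -> Om -> 'rV[R]_d) (psi : R -> R) (f : 'rV[R]_d -> R) (s : R)
    (v : 'rV[R]_d -> R) : Prop :=
  forall x, enorm x <= s ->
    let xi := fun (t : R) (w : Om) => x + W t w in
    let T := fun w => exit_time s (xi ^~ w) in
    ((v x)%:E =
     \int[P]_w (f (xi (fine (T w)) w))%:E -
     \int[P]_w \int[lebesgue_measure]_(z in [set z | (0 <= z)%R /\ (z%:E < T w)%E])
        (psi (v (xi z w)))%:E)%E.

Definition nonneg_exit_solution (d : nat) (P : probability Om R)
    (W : R -> Om -> 'rV[R]_d) (psi : R -> R) (f : 'rV[R]_d -> R) (s : R)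
    (v : 'rV[R]_d -> R) : Prop :=
  [/\ measurable_fun (ecball d s) v,
      (forall x, enorm x <= s -> 0 <= v x) &
      exit_equation P W psi f s v].

Definition unique_nonneg_exit_solution (d : nat) (P : probability Om R)
    (W : R -> Om -> 'rV[R]_d) (psi : R -> R) (f : 'rV[R]_d -> R) (s : R)
    (v : 'rV[R]_d -> R) : Prop :=
  nonneg_exit_solution P W psi f s v /\
  forall v', nonneg_exit_solution P W psi f s v' ->
    forall x, enorm x <= s -> v' x = v x.

End brownian_motion.

Definition pos_bdd_continuous_on (R : realType) (d : nat) (A : set 'rV[R]_d)
    (f : 'rV[R]_d -> R) : Prop :=
  [/\ {within A, continuous f}, (forall x, A x -> 0 < f x) &
      exists M, forall x, A x -> f x <= M].

(* W is a version of the conditional expectation of Y given G. *)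
Definition cond_expectation (R : realType) (disp : measure_display)
    (Om : measurableType disp) (P : probability Om R) (G : set (set Om))
    (Y W : Om -> \bar R) : Prop :=
  [/\ P.-integrable setT Y, P.-integrable setT W,
      (forall B : set (\bar R), measurable B -> G (W @^-1` B)) &
      forall E, G E -> (\int[P]_(w in E) Y w = \int[P]_(w in E) W w)%E].

Section exit_measures.
Context {R : realType} {disp : measure_display} {Om : measurableType disp}
        {d : nat}.

(* X s is the exit measure X_{D_s}: a random measure, i.e. a kernel from Om to
   R^d, whose total mass may be infinite. *)
Implicit Types X : R -> R.-ker Om ~> 'rV[R]_d.

Definition exit_filtration X (r z : R) : set (set Om) :=
  <<s [set E | exists z' A B, [/\ r <= z' <= z, measurable A, measurable B &
                                  E = (X z' ^~ A) @^-1` B]] >>.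

(* PX r mu is the law P_mu for mu a finite measure on the sphere of radius r,
   under which only the X_{D_s} with s >= r are used.  The radius is an
   argument because the zero measure lives on every sphere.  Here
   expeR -oo = 0, so that exp(-<f, X_{D_s}>) vanishes when the mass of X_{D_s}
   is infinite. *)
Record exit_measure_family (v : ('rV[R]_d -> R) -> R -> 'rV[R]_d -> R) X
    (PX : R -> {finite_measure set 'rV[R]_d -> \bar R} -> probability Om R)
    : Prop := ExitMeasureFamily {
  em_support : forall s w, 0 < s -> X s w (~` esphere d s) = 0%E ;
  em_start : forall r (mu : {finite_measure set 'rV[R]_d -> \bar R}),
    0 < r -> mu (~` esphere d r) = 0%E ->
    {ae PX r mu, forall w, forall A, measurable A -> X r w A = mu A} ;
  em_markov : forall r (mu : {finite_measure set 'rV[R]_d -> \bar R}) z s f,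
    0 < r -> mu (~` esphere d r) = 0%E -> r <= z -> z <= s ->
    pos_bdd_continuous_on (esphere d s) f ->
    cond_expectation (PX r mu) (exit_filtration X r z)
      (fun w => expeR (- \int[X s w]_(x in esphere d s) (f x)%:E)%E)
      (fun w => expeR (- \int[X z w]_(x in esphere d z) (v f s x)%:E)%E)
}.

Definition total_mass X (s : R) (w : Om) : \bar R := X s w setT.

(* exp(-theta m), with value 0 at m = +oo even when theta = 0. *)
Definition exp_mass (theta : R) (m : \bar R) : \bar R :=
  if m is m'%:E then (expR (- (theta * m')))%:E else 0%E.

Definition mass_exponent X
    (PX : R -> {finite_measure set 'rV[R]_d -> \bar R} -> probability Om R)
    (u : R -> R -> R -> R) : Prop :=
  forall r s theta a (mu : {finite_measure set 'rV[R]_d -> \bar R}),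
    0 < r -> r <= s -> 0 <= theta -> 0 < a ->
    mu (~` esphere d r) = 0%E -> mu setT = a%:E ->
    (\int[PX r mu]_w exp_mass theta (total_mass X s w) =
     (expR (- (u r s theta * a)))%:E)%E.

End exit_measures.

Section mass_mechanism.
Context {R : realType}.

Definition levy_khintchine (F : R -> R) : Prop :=
  exists (q a b : R) (Lam : {measure set R -> \bar R}),
    [/\ 0 <= q, 0 <= b, Lam `]-oo, 0]%classic = 0%E,
        (\int[Lam]_(x in `]0%R, +oo[) (Num.min 1 (x ^+ 2))%:E < +oo)%E &
        forall theta, 0 <= theta ->
          F theta = - q + a * theta + b * theta ^+ 2 +
            \int[Lam]_(x in `]0, +oo[)
              (expR (- (theta * x)) - 1 + theta * x * \1_[set y | y < 1] x)].

(* u r s theta is meaningful for r <= s only, so its derivative in r at r = s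
   is the left derivative. *)
Record mass_mechanism (u : R -> R -> R -> R) (Psi : R -> R -> R) : Prop :=
  MassMechanism {
  mm_derivative : forall s theta, 0 < s -> 0 <= theta ->
    (u r s theta - u s s theta) / (r - s) @[r --> s^'-] --> Psi s theta ;
  mm_integrable : forall r s theta, 0 < r -> r <= s -> 0 <= theta ->
    lebesgue_measure.-integrable `[r, s] (fun z => (Psi z (u z s theta))%:E) ;
  mm_integral : forall r s theta, 0 < r -> r <= s -> 0 <= theta ->
    u r s theta =
      theta - \int[lebesgue_measure]_(z in `[r, s]) Psi z (u z s theta) ;
  mm_levy_khintchine : forall r, 0 < r -> levy_khintchine (Psi r)
}.

End mass_mechanism.

(* Main.v *)
(** Write U = u(., s, theta).  Applying the branching Markov property to a
    Dirac mass and a constant function identifies U(|x|) with the solution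
    v_theta(x, s) of the exit equation.  For F(y) = exp(- lam |y|^2), the
    occupation measure m of |xi|^2 before the exit from D_s satisfies
    int (LF) dm = e^(- lam s^2) - e^(- lam |x|^2), L being half the Laplacian;
    this is obtained from Gaussian increments by a Riemann sum argument.  These
    integrals, for all lam > 0, determine m: the Laplace transform of the
    defect solves a linear ODE forcing it to vanish, and polynomials in e^(-q)
    are uniformly dense.  Hence, with n = d - 1,
    U(r) = theta - int_r^s 2 y^(-n) (int_0^y z^n psi(U(z)) dz) dy,
    so r^n U'(r) = 2 int_0^r z^n psi(U(z)) dz and Psi(s, theta) = U'(s-).

    To compare the mechanisms at radii r < s, put V = u(., r, theta) and
    w = u(. + s - r, s, theta), which both equal theta at r.  If theta >= lambda*
    and w'(r) < V'(r), then w > V to the left of r and r^n (w - V)' is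
    nondecreasing there, so it stays away from 0 as r -> 0.  If theta <= lambda*
    and w'(r) > V'(r), then w < V and the Wronskian r^n (w'V - V'w) is
    nonincreasing because psi(l) / l is nondecreasing, so it stays positive.
    Both contradict the behaviour at 0 of the integral formula for U'.  The case
    theta = 0 follows by right-continuity of Psi(r, .) at 0. *)

Require Import Defs.
From mathcomp Require Import ring lra.

Set Implicit Arguments.
Unset Strict Implicit.

Local Open Scope classical_set_scope.
Local Open Scope ring_scope.

(** * Independence and Gaussian increments *)

(** But [psi] is bounded below on the nonnegative half-line, so the equation itself yields an upper
    bound for the exponent; the potential is then bounded and the radial formula follows. Gaussian
    test functions are chosen because a Gaussian transition maps one to an explicit multiple of
    another; an elementary one-step estimate thus replaces stochastic calculus. In the comparison,
    the translate by s - r does not solve the same radial equation when d > 1. The discrepancy is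
    the factor (x / (x + s - r))^(d-1), nondecreasing in x, and it is weighted by an integral of
    [psi] along the profile. The sign of that integral, fixed by the position of theta relative to a
    zero [L] of [psi], decides which argument applies. Both regimes are instances of this, with [L]
    equal to 0 in the (sub)critical one. Exit functions are required to be positive, which is why
    theta = 0 needs a limit. *)

Section independence.
Context {R : realType} {d d' d2 : measure_display} {Om : measurableType d}
  {T : measurableType d'} {V : measurableType d2} (P : probability Om R)
  (nu : probability V R).

(** The factorisation makes the law of [(X, Y)] the product of the law of [X] and [nu], and Tonelli
    applies. The case [A = setT] shows that [nu] is the law of [Y]. *)
Lemma independent_integral (X : Om -> T) (Y : Om -> V) (f : T * V -> \bar R) :
  measurable_fun setT X -> measurable_fun setT Y ->
  (forall A C, measurable A -> measurable C ->
     P (X @^-1` A `&` Y @^-1` C) = (P (X @^-1` A) * nu C)%E) ->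
  measurable_fun setT f -> (forall z, 0 <= f z)%E ->
  (\int[P]_w f (X w, Y w) = \int[P]_w \int[nu]_y f (X w, y))%E.
Proof.
move=> mX mY XY mf f0.
have mXY : measurable_fun setT (fun w => (X w, Y w)) by exact: measurable_fun_pair.
pose XYm : {RV P >-> (T * V)%type} := mfun_Sub (mem_set mXY).
pose Xm : {RV P >-> T} := mfun_Sub (mem_set mX).
transitivity (\int[distribution P XYm]_z f z)%E.
  by rewrite ge0_integral_distribution.
transitivity (\int[(distribution P Xm \x nu)%E]_z f z)%E.
  apply: eq_measure_integral => A mA _; apply/esym.
  apply: product_measure_unique => // B C mB mC.
rewrite fubini_tonelli1// ge0_integral_distribution//.
  exact: measurable_fun_fubini_tonelli_F.
by move=> y; apply: integral_ge0.
Qed.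

(** Pi-lambda argument: for fixed [C], the events [E] that factorise are stable under proper
    difference and increasing union. *)
Lemma independent_of_pi_system (Pi : set (set Om)) (Y : Om -> V) :
  setI_closed Pi -> Pi setT -> Pi `<=` measurable -> measurable_fun setT Y ->
  (forall E C, Pi E -> measurable C ->
     P (E `&` Y @^-1` C) = (P E * nu C)%E) ->
  forall E C, <<s Pi >> E -> measurable C ->
     P (E `&` Y @^-1` C) = (P E * nu C)%E.
Proof.
move=> PiI PiTT Pim mY PiY E C sE mC.
have mYC : measurable (Y @^-1` C) by rewrite -[X in measurable X]setTI; exact: mY.
pose H := [set E | measurable E /\ P (E `&` Y @^-1` C) = (P E * nu C)%E].
have nuC : nu C \is a fin_num by exact: fin_num_measure.
have Pf A : measurable A -> P A \is a fin_num by move=> mA; exact: fin_num_measure.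
suff : <<s Pi >> `<=` H by move=> /(_ _ sE) [].
have subm : <<s Pi >> `<=` measurable by apply: smallest_sub => //; exact: sigma_algebra_measurable.
apply: lambda_system_subset => //.
- split => //=.
  + by split => //; rewrite setTI probability_setT mul1e -[Y @^-1` C]setTI PiY// probability_setT mul1e.
  + move=> A B BA [mA PA] [mB PB]; split; first exact: measurableD.
    have mAY := measurableI _ _ mA mYC; have mBY := measurableI _ _ mB mYC.
    have BAY : B `&` Y @^-1` C `<=` A `&` Y @^-1` C by exact: setSI.
    rewrite (_ : _ `&` _ = (A `&` Y @^-1` C) `\` (B `&` Y @^-1` C)); last first.
      by apply/seteqP; split=> w /=; tauto.
    rewrite (measureD mAY mBY) ?ltey_eq ?Pf// (measureD mA mB) ?ltey_eq ?Pf// (setIidr BAY) (setIidr BA).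
    apply: etrans (congr2 (fun x y => x - y)%E PA PB) _.
    by rewrite muleBl// fin_num_adde_defr// Pf.
  + move=> F ndF HF.
    have mF : measurable (\bigcup_i F i).
      by apply: bigcup_measurable => k _; case: (HF k).
    split => //.
    have h1 : (P (F k) * nu C)%E @[k --> \oo] --> (P (\bigcup_i F i) * nu C)%E.
      apply: cvgeZr => //; apply: nondecreasing_cvg_mu => //.
      by move=> i; case: (HF i).
    have h2 : P (F k `&` Y @^-1` C) @[k --> \oo] --> P (\bigcup_i F i `&` Y @^-1` C).
      rewrite setI_bigcupl; apply: nondecreasing_cvg_mu => //.
      - by move=> i; apply: measurableI => //; case: (HF i).
      - by rewrite -setI_bigcupl; exact: measurableI.
      - by move=> i j ij; apply/subsetPset; apply: setSI; apply/subsetPset; exact: ndF.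
    apply: (cvg_unique _ h2) => //.
    rewrite (_ : (fun k => P (F k `&` Y @^-1` C)) = (fun k => P (F k) * nu C)%E)//.
    by apply/funext => k; exact: (HF k).2.
- move=> A PA; split; first exact: Pim.
  exact: PiY.
Qed.
End independence.

Section gaussian.
Context {R : realType}.
Notation mu := (@lebesgue_measure R).

(** The Radon-Nikodym derivative agrees almost everywhere with the density, both having the same
    integral over every measurable set. *)
Lemma integral_normal_prob (m s : R) (f : R -> \bar R) :
  measurable_fun setT f -> (forall x, 0 <= f x)%E ->
  (\int[normal_prob m s]_x f x = \int[mu]_x (f x * (normal_pdf m s x)%:E))%E.
Proof.
move=> mf f0.
have dom := normal_prob_dominates m s.
rewrite -(Radon_Nikodym_SigmaFinite.change_of_variables dom)//.
apply: ae_eq_integral => //.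
- apply: emeasurable_funM => //.
  exact: measurable_int (Radon_Nikodym_SigmaFinite.f_integrable dom).
- apply: emeasurable_funM => //; apply/measurable_EFinP.
  exact: measurable_normal_pdf.
- apply: ae_eqe_mul2l; apply: integral_ae_eq => //.
  + exact: Radon_Nikodym_SigmaFinite.f_integrable.
  + by apply/measurable_EFinP; exact: measurable_normal_pdf.
  + by move=> A _ mA; rewrite -Radon_Nikodym_SigmaFinite.f_integral.
Qed.

Lemma normal_expectation_gauss (lam delta x : R) : 0 < lam -> 0 < delta ->
  let b2 := (1 + 2 * lam * delta)^-1 in
  (\int[normal_prob 0 (Num.sqrt delta)]_y (expR (- (lam * (x + y) ^+ 2)))%:E =
   (Num.sqrt b2 * expR (- (lam * b2 * x ^+ 2)))%:E)%E.
Proof.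
move=> l0 d0 b2.
have D0 : 0 < 1 + 2 * lam * delta by nra.
have b20 : 0 < b2 by rewrite invr_gt0.
have sd0 : Num.sqrt delta != 0 by rewrite gt_eqF// sqrtr_gt0.
have sbd0 : Num.sqrt (b2 * delta) != 0 by rewrite gt_eqF// sqrtr_gt0 mulr_gt0.
rewrite integral_normal_prob; last 2 first.
- apply/measurable_EFinP; apply: measurableT_comp => //.
  by apply: measurableT_comp => //; apply: measurable_funM => //;
     apply: measurable_funX; exact: measurable_funD.
- by move=> y; rewrite lee_fin expR_ge0.
(* Completing the square in [y]: the product of the two exponentials is a multiple of the normal
   density with variance [b2 * delta] and the mean displayed here, which integrates to 1. *)
transitivity (\int[mu]_y ((Num.sqrt b2 * expR (- (lam * b2 * x ^+ 2)))%:E *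
   (normal_pdf (- (2 * lam * delta * b2 * x)) (Num.sqrt (b2 * delta)) y)%:E))%E.
  apply: eq_integral => y _; rewrite -!EFinM !normal_pdfE//; congr EFin.
  rewrite /normal_peak /normal_fun !sqr_sqrtr ?ltW ?mulr_gt0//.
  rewrite mulrCA [RHS]mulrACA -!expRD.
  congr (_ * expR _).
    have p0 : 0 <= delta * pi *+ 2 :> R by rewrite mulrn_wge0// mulr_ge0 ?pi_ge0// ltW.
    rewrite (_ : b2 * delta * pi *+ 2 = b2 * (delta * pi *+ 2)); last by ring.
    by rewrite sqrtrM ?ltW// invfM mulrA divff ?mul1r// gt_eqF// sqrtr_gt0.
  rewrite /b2; field.
  by rewrite !gt_eqF//.
rewrite integralZl//; last exact: integrable_normal_pdf.
by rewrite integral_normal_pdf mule1.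
Qed.
End gaussian.

Section gaussian_peeling.
Context {R : realType} {dd : measure_display} {Om : measurableType dd}
  (P : probability Om R) {I : finType} (Y : I -> Om -> R)
  (nu : I -> probability (measurableTypeR R) R).
Hypothesis mY : forall a, measurable_fun setT (Y a).
Hypothesis prodY : forall A : I -> set R, (forall a, measurable (A a)) ->
  P [set w | forall a, A a (Y a w)] = (\prod_a nu a (A a))%E.

(** [S] is the set of excluded indices: these events generate what is determined by the [Y a] with
    [a] outside [S], that is, the information kept while the variables in [S] are still to be
    integrated out. *)
Definition cylinders (S : pred I) : set (set Om) :=
  [set E | exists A : I -> set R, [/\ forall a, measurable (A a),
     (forall a, S a -> A a = setT) & E = [set w | forall a, A a (Y a w)]]].

Lemma sub_cylinders (S S' : pred I) : {subset S' <= S} ->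
  cylinders S `<=` cylinders S'.
Proof.
by move=> SS' _ [A [mA AT ->]]; exists A; split => // a /SS'; exact: AT.
Qed.

Lemma cylinders_measurable (S : pred I) : cylinders S `<=` measurable.
Proof.
move=> _ [A [mA AT ->]].
rewrite (_ : [set _ | _] = \bigcap_(a in [set: I]) (Y a @^-1` A a)).
  apply: fin_bigcap_measurable => // a _; rewrite -[X in measurable X]setTI; exact: mY.
by apply/seteqP; split => w /= h a; [move=> _; exact: h|exact: (h a)].
Qed.

Lemma cylinders_setI (S : pred I) : setI_closed (cylinders S).
Proof.
move=> _ _ [A [mA AT ->]] [B [mB BT ->]]; exists (fun a => A a `&` B a); split.
- by move=> a; exact: measurableI.
- by move=> a Sa; rewrite AT// BT// setIT.
- by apply/seteqP; split => w /= => [[h1 h2] a|h]; [split|split=> a; case: (h a)].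
Qed.

Lemma cylinders_setT (S : pred I) : cylinders S setT.
Proof. by exists (fun=> setT); split => //; apply/seteqP; split. Qed.

Lemma cylinders_independent b E C : cylinders (pred1 b) E -> measurable C ->
  P (E `&` Y b @^-1` C) = (P E * nu b C)%E.
Proof.
move=> [A [mA Ab ->]] mC.
(* The factor of index [b] is the whole line, so putting [C] in its place describes the intersection
   as a product event again. *)
pose A' a := if a == b then C else A a.
rewrite (_ : _ `&` _ = [set w | forall a, A' a (Y a w)]); last first.
  apply/seteqP; split => w /=.
    by move=> [h1 h2] a; rewrite /A'; case: eqP => [->|].
  move=> h; split; last by have := h b; rewrite /A' eqxx.
  move=> a; have := h a; rewrite /A'; case: eqP => // ->.
  by rewrite Ab//=.
rewrite !prodY//; last by move=> a; rewrite /A'; case: eqP.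
rewrite (bigD1 b)//= [in RHS](bigD1 b)//= Ab//= probability_setT mul1e.
rewrite muleC /A' eqxx; congr (_ * _)%E.
by apply: eq_bigr => a /negbTE ->.
Qed.

Notation G S := (g_sigma_algebraType (cylinders S)).

Lemma measurable_fun_cylinders (S : pred I) d' (T : measurableType d') (X : Om -> T) :
  measurable_fun setT (X : G S -> T) -> measurable_fun setT X.
Proof.
move=> mX _ A mA; rewrite setTI.
have : <<s cylinders S >> (X @^-1` A) by rewrite -[_ @^-1` _]setTI; exact: mX.
apply: smallest_sub => //; first exact: sigma_algebra_measurable.
exact: cylinders_measurable.
Qed.

Lemma measurable_fun_coord (S : pred I) a : ~~ S a ->
  measurable_fun setT (Y a : G S -> R).
Proof.
move=> Sa _ A mA; rewrite setTI; apply: sub_sigma_algebra.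
exists (fun b => if b == a then A else setT); split.
- by move=> b; case: eqP.
- by move=> b Sb; case: eqP => // ba; move: Sa; rewrite -ba Sb.
- apply/seteqP; split => w /= => [h b|/(_ a)]; last by rewrite eqxx.
  by case: eqP => // ->.
Qed.

Lemma sub_measurable_fun_cylinders (S S' : pred I) d' (T : measurableType d') (X : Om -> T) :
  {subset S' <= S} -> measurable_fun setT (X : G S -> T) ->
  measurable_fun setT (X : G S' -> T).
Proof.
move=> SS' mX _ A mA; rewrite setTI.
have : <<s cylinders S >> (X @^-1` A) by rewrite -[_ @^-1` _]setTI; exact: mX.
by apply: sub_sigma_algebra2; exact: sub_cylinders.
Qed.

Variables (lam delta : R).
Hypotheses (l0 : 0 < lam) (d0 : 0 < delta).
Let b2 := (1 + 2 * lam * delta)^-1.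

Lemma measurable_prod_seq (S : pred I) (s : seq I) (h : I -> Om -> R) :
  (forall a, a \in s -> measurable_fun setT (h a : G S -> R)) ->
  measurable_fun setT ((fun w => \prod_(a <- s) h a w) : G S -> R).
Proof.
elim: s => [|b s IH] mh.
  by rewrite (_ : (fun _ => _) = cst 1)//; apply/funext => w; rewrite big_nil.
rewrite (_ : (fun _ => _) = (fun w => h b w * \prod_(a <- s) h a w)); last first.
  by apply/funext => w; rewrite big_cons.
apply: measurable_funM; first by apply: mh; rewrite inE eqxx.
by apply: IH => a sa; apply: mh; rewrite inE sa orbT.
Qed.

Lemma measurable_gauss (S : pred I) (c : R) (x : Om -> R) :
  measurable_fun setT (x : G S -> R) ->
  measurable_fun setT ((fun w => expR (- (c * x w ^+ 2))) : G S -> R).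
Proof.
move=> mx; apply: measurableT_comp => //; apply: measurableT_comp => //.
by apply: measurable_funM => //; exact: measurable_funX.
Qed.

(** Induction on [s]: one variable is integrated out at a time, and the factor that it leaves behind
    is absorbed into the weight [g], which must therefore be arbitrary. *)
Lemma peel_gaussian (s : seq I) (x : I -> Om -> R) (g : Om -> R) :
  uniq s -> (forall a, a \in s -> nu a = normal_prob 0 (Num.sqrt delta) :> (set R -> \bar R)) ->
  (forall w, 0 <= g w) ->
  measurable_fun setT (g : G (mem s) -> R) ->
  (forall a, measurable_fun setT (x a : G (mem s) -> R)) ->
  (\int[P]_w (g w * \prod_(a <- s) expR (- (lam * (x a w + Y a w) ^+ 2)))%:E =
   \int[P]_w (g w * \prod_(a <- s) (Num.sqrt b2 * expR (- (lam * b2 * x a w ^+ 2))))%:E)%E.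
Proof.
elim: s g => [|b s IH] g; first by move=> *; under eq_integral do rewrite big_nil; under [RHS]eq_integral do rewrite big_nil.
move=> /= /andP[bs us] nus g0 mg mx.
have sub1 : {subset pred1 b <= mem (b :: s)} by move=> a /eqP ->; rewrite !inE eqxx.
have sub2 : {subset mem s <= mem (b :: s)} by move=> a; rewrite !inE => ->; rewrite orbT.
(* All factors but the one of index [b]. It is determined by variables other than [Y b], hence
   independent of [Y b]. *)
pose H w := g w * \prod_(a <- s) expR (- (lam * (x a w + Y a w) ^+ 2)).
have mH : measurable_fun setT (H : G (pred1 b) -> R).
  apply: measurable_funM; first exact: sub_measurable_fun_cylinders mg.
  apply: measurable_prod_seq => a sa; apply: measurable_gauss.
  apply: measurable_funD; first exact: sub_measurable_fun_cylinders (mx a).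
  by apply: measurable_fun_coord => /=; apply: contraNN bs => /eqP <-.
have mxb : measurable_fun setT (x b : G (pred1 b) -> R).
  exact: sub_measurable_fun_cylinders (mx b).
have H0 w : 0 <= H w by rewrite mulr_ge0// prodr_ge0// => a _; exact: expR_ge0.
transitivity (\int[P]_w (g w * (Num.sqrt b2 * expR (- (lam * b2 * x b w ^+ 2))) *
   \prod_(a <- s) expR (- (lam * (x a w + Y a w) ^+ 2)))%:E)%E; last first.
  transitivity (\int[P]_w (g w * (Num.sqrt b2 * expR (- (lam * b2 * x b w ^+ 2))) *
    \prod_(a <- s) (Num.sqrt b2 * expR (- (lam * b2 * x a w ^+ 2))))%:E)%E; last first.
    by apply: eq_integral => w _; rewrite big_cons !mulrA.
  apply: (IH (fun w => g w * (Num.sqrt b2 * expR (- (lam * b2 * x b w ^+ 2))))) => //.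
  - by move=> a sa; apply: nus; rewrite inE sa orbT.
  - by move=> w; rewrite !mulr_ge0 ?expR_ge0.
  - apply: measurable_funM; first exact: sub_measurable_fun_cylinders mg.
    apply: measurable_funM => //; apply: measurable_gauss.
    exact: sub_measurable_fun_cylinders (mx b).
  - by move=> a; exact: sub_measurable_fun_cylinders (mx a).
(* The absolute value makes [f'] nonnegative on the whole space, as Tonelli demands; it disappears
   on values of [H]. *)
pose f' (z : (R * R) * R) : \bar R := (`|z.1.1| * expR (- (lam * (z.1.2 + z.2) ^+ 2)))%:E.
have mf' : measurable_fun setT f'.
  apply/measurable_EFinP; apply: measurable_funM.
    apply: measurableT_comp => //; apply: measurableT_comp => //.
  apply: measurableT_comp => //; apply: measurableT_comp => //.
  apply: measurable_funM => //; apply: measurable_funX.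
  by apply: measurable_funD => //; apply: measurableT_comp => //.
have mHx : measurable_fun setT ((fun w => (H w, x b w)) : G (pred1 b) -> (R * R)%type).
  exact: measurable_fun_pair.
have := @independent_integral _ _ _ _ _ _ _ P (nu b) (fun w => (H w, x b w)) (Y b) f'.
move=> /(_ (measurable_fun_cylinders mHx) (mY b)).
rewrite /f'/= => E; rewrite [LHS](_ : _ = \int[P]_w (`|H w| * expR (- (lam * (x b w + Y b w) ^+ 2)))%:E)%E; last first.
  by apply: eq_integral => w _; rewrite big_cons ger0_norm// /H; congr EFin; ring.
rewrite {}E//.
- apply: eq_integral => w _; rewrite ger0_norm//.
  under eq_integral do rewrite EFinM.
  rewrite ge0_integralZl//.
  + rewrite (_ : (\int[nu b]_y _)%E = \int[normal_prob 0 (Num.sqrt delta)]_y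
        (expR (- (lam * (x b w + y) ^+ 2)))%:E)%E; last first.
      apply: eq_measure_integral => A mA _.
      by apply: (congr1 (fun m => m A) (nus b _)); rewrite inE eqxx.
    rewrite normal_expectation_gauss// -EFinM /H; congr EFin; rewrite -/b2; ring.
  + apply/measurable_EFinP; apply: measurableT_comp => //; apply: measurableT_comp => //.
    by apply: measurable_funM => //; apply: measurable_funX; apply: measurable_funD.
  + by rewrite lee_fin.
- move=> A C mA mC; apply: (independent_of_pi_system (Pi := cylinders (pred1 b))) => //.
  + exact: cylinders_setI.
  + exact: cylinders_setT.
  + exact: cylinders_measurable.
  + exact: mY.
  + by move=> E D; exact: cylinders_independent.
  + by rewrite -[X in smallest _ _ X]setTI; exact: mHx.
Qed.
End gaussian_peeling.

Definition sqn (R : realType) (d : nat) (x : 'rV[R]_d) : R :=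
  \sum_(i < d) x ord0 i ^+ 2.

Section sqn_theory.
Context {R : realType} {d : nat}.
Implicit Types x : 'rV[R]_d.

Lemma sqn_ge0 x : 0 <= sqn x.
Proof. by apply: sumr_ge0 => i _; exact: sqr_ge0. Qed.

Lemma enorm_sqr x : enorm x ^+ 2 = sqn x.
Proof. by rewrite sqr_sqrtr// sqn_ge0. Qed.

Lemma enorm_ge0 x : 0 <= enorm x.
Proof. exact: sqrtr_ge0. Qed.

Lemma enorm_ltE x s : 0 <= s -> (enorm x < s) = (sqn x < s ^+ 2).
Proof. by move=> s0; rewrite -enorm_sqr ltr_sqr// nnegrE ?enorm_ge0. Qed.

Lemma measurable_coord (i : 'I_d) :
  measurable_fun setT (fun x : 'rV[R]_d => x ord0 i).
Proof.
suff : preimage_set_system setT (fun x : 'rV[R]_d => x ord0 i) (@RGenOInfty.G R) `<=`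
    @measurable _ 'rV[R]_d.
  exact: (@measurability _ _ 'rV[R]_d R setT _ _ (RGenOInfty.measurableE R)).
move=> _ [_ [a ->] <-]; rewrite setTI; apply: sub_sigma_algebra.
apply: open_comp; last exact: interval_open.
by move=> x _; exact: coord_continuous.
Qed.

Lemma measurable_sqn : measurable_fun setT (@sqn R d).
Proof.
apply: measurable_sum => i.
by apply: measurable_funX; exact: measurable_coord.
Qed.

End sqn_theory.

Section brownian_step.
Context {R : realType} {dd : measure_display} {Om : measurableType dd}
  (P : probability Om R) {d : nat} (W : R -> Om -> 'rV[R]_d).
Hypothesis hW : brownian_motion P W.

Lemma measurable_bm_coord (t : R) (i : 'I_d) : 0 <= t ->
  measurable_fun setT (fun w => W t w ord0 i).
Proof.
move=> t0; apply: (measurableT_comp (@measurable_coord R d i)).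
exact: bm_measurable hW _ t0.
Qed.

Variables (t : nat -> R) (n : nat).
Hypotheses (t0 : t 0%N = 0) (tS : forall k, t k < t k.+1).

Let I : finType := ('I_n.+1 * 'I_d)%type.
Let Y (a : I) (w : Om) := W (t a.1.+1) w ord0 a.2 - W (t a.1) w ord0 a.2.
Let nu (a : I) : probability (measurableTypeR R) R :=
  normal_prob 0 (Num.sqrt (t a.1.+1 - t a.1)).

Let tge0 k : 0 <= t k.
Proof. by elim: k => [|k IH]; rewrite ?t0// (le_trans IH)// ltW. Qed.

Let mY a : measurable_fun setT (Y a).
Proof. by apply: measurable_funB; exact: measurable_bm_coord. Qed.

Let prodY (A : I -> set R) : (forall a, measurable (A a)) ->
  P [set w | forall a, A a (Y a w)] = (\prod_a nu a (A a))%E.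
Proof.
move=> mA.
have := @bm_increments _ _ _ _ _ _ hW n.+1 t (fun k i => A (inord k, i)).
move=> /(_ (tge0 0) tS (fun k i => mA _)) => E.
transitivity (P [set w | forall k, (k < n.+1)%N -> forall i,
    A (inord k, i) (W (t k.+1) w ord0 i - W (t k) w ord0 i)]).
  congr (P _); apply/seteqP; split => w /= h.
    by move=> k kn i; have := h (inord k, i); rewrite /Y /= inordK.
  by move=> [k i]; have := h k (ltn_ord k) i; rewrite inord_val.
rewrite E pair_bigA/=; apply: eq_bigr => -[k i] _ /=.
by rewrite inord_val.
Qed.

(** The coordinates of the last increment, which are to be integrated out. *)
Let s : seq I := [seq (ord_max, i) | i <- enum 'I_d].

Let notin_s (a : I) : (a.1 < n)%N -> ~~ mem s a.
Proof.
move=> an; apply/negP => /mapP[i _ aE]; move: an; rewrite aE/= ltnn.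
by [].
Qed.

Notation G := (g_sigma_algebraType (cylinders Y (mem s))).

Let mW m i : (m <= n)%N -> measurable_fun setT ((fun w => W (t m) w ord0 i) : G -> R).
Proof.
elim: m => [_|m IH mn].
  rewrite (_ : (fun _ => _) = cst 0)//; apply/funext => w /=.
  by rewrite t0 (bm_start hW) mxE.
rewrite (_ : (fun _ => _) = (fun w => W (t m) w ord0 i + Y (inord m, i) w)).
  apply: measurable_funD; first exact: IH (ltnW mn).
  by apply: measurable_fun_coord; apply: notin_s; rewrite /= inordK// ltnW.
apply/funext => w; rewrite /Y/= inordK; last exact: ltnW.
by rewrite [RHS]addrC subrK.
Qed.

Variables (x : 'rV[R]_d) (C : nat -> set R).
Hypothesis mC : forall k, measurable (C k).

Let B := [set w | forall k, (k <= n)%N -> C k (sqn (x + W (t k) w))].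

Let mB : measurable (B : set G).
Proof.
rewrite (_ : B = \bigcap_(k in `I_n.+1)
   ((fun w => sqn (x + W (t k) w)) @^-1` C k)); last first.
  by apply/seteqP; split => w /= h k; exact: h.
apply: fin_bigcap_measurable; first exact: finite_II.
move=> k /= kn; rewrite -[X in measurable X]setTI.
have : measurable_fun setT ((fun w => sqn (x + W (t k) w)) : G -> R).
  apply: measurable_sum => i; apply: measurable_funX.
  rewrite (_ : (fun _ => _) = (fun w => x ord0 i + W (t k) w ord0 i)).
    by apply: measurable_funD => //; exact: mW.
  by apply/funext => w; rewrite mxE.
by apply.
Qed.

(** The Markov property at time [t n], tested on a Gaussian: the event [B] depends on earlier
    increments only, and each of the [d] coordinates of the last increment contributes a factor
    [Num.sqrt b2]. *)
Lemma brownian_step (lam : R) : 0 < lam ->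
  let delta := t n.+1 - t n in let b2 := (1 + 2 * lam * delta)^-1 in
  (\int[P]_w (\1_B w * expR (- (lam * sqn (x + W (t n.+1) w))))%:E =
   \int[P]_w (\1_B w * (Num.sqrt b2 ^+ d *
      expR (- (lam * b2 * sqn (x + W (t n) w)))))%:E)%E.
Proof.
move=> l0 delta b2.
have d0 : 0 < delta by rewrite subr_gt0.
have := @peel_gaussian R dd Om P I Y nu mY prodY lam delta l0 d0 s
   (fun a w => x ord0 a.2 + W (t n) w ord0 a.2) \1_B.
have us : uniq s by rewrite map_inj_uniq ?enum_uniq// => i j [].
have H1 a : a \in s -> nu a = normal_prob 0 (Num.sqrt delta) :> (set R -> \bar R).
  by move=> /mapP[i _ ->].
have H2 w : 0 <= (\1_B w : R) by rewrite indicE.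
have H3 : measurable_fun setT (\1_B : G -> R) by exact: measurable_indic.
have H4 (a : I) : measurable_fun setT ((fun w => x ord0 a.2 + W (t n) w ord0 a.2) : G -> R).
  by apply: measurable_funD => //; exact: mW.
move=> /(_ us H1 H2 H3 (fun a => H4 a)) => E.
have expS (F : 'I_d -> R) : \prod_i expR (F i) = expR (\sum_i F i).
  by rewrite (big_morph expR (@expRD R) (@expR0 R)).
transitivity (\int[P]_w (\1_B w * \prod_(a <- s) expR (- (lam * (x ord0 a.2 + W (t n) w ord0 a.2 + Y a w) ^+ 2)))%:E)%E.
  apply: eq_integral => w _; rewrite big_map/= big_enum/= expS sumrN -mulr_sumr.
  rewrite /sqn; congr ((_ * expR (- (_ * _)))%:E); apply: eq_bigr => i _.
  by rewrite !mxE /Y/=; congr (_ ^+ 2); ring.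
rewrite E; apply: eq_integral => w _; congr ((_ * _)%:E).
rewrite big_map/= big_enum/= big_split/= prodr_const card_ord expS; congr (_ * _).
rewrite sumrN -mulr_sumr /sqn; congr (expR (- (_ * _))); apply: eq_bigr => i _.
by rewrite mxE.
Qed.

End brownian_step.

(** * Step sums, Riemann sums and bounded convergence *)

Section analysis_tools.
Context {R : realType}.

Lemma continuous_unif_itv (f : R -> R) (a b e : R) :
  (forall x, x \in `[a, b] -> {for x, continuous f}) -> 0 < e ->
  exists2 dl, 0 < dl & forall x y, x \in `[a, b] -> y \in `[a, b] ->
    `|x - y| < dl -> `|f x - f y| < e.
Proof.
move=> cf e0.
have cK : compact `[a, b]%classic by exact: segment_compact.
move/compact_near_coveringP : cK => /(_ R (0^'+) (fun dl x => forall y, `|x - y| < dl -> `|f x - f y| < e)).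
case.
  move=> x /= xab.
  have /cvgrPdist_lt/(_ (e / 2)) := cf x xab.
  rewrite divr_gt0// => /(_ isT) [eta /= eta0 H].
  exists (ball x (eta / 2), [set dl | 0 < dl < eta / 2]) => /=.
    split; first by apply: nbhsx_ballx; rewrite divr_gt0.
    near=> dl; apply/andP; split => //.
    by near: dl; apply: nbhs_right_lt; rewrite divr_gt0.
  move=> [x' dl] /= [xx' /andP[dl0 dleta]] y x'y.
  have h1 : `|f x - f x'| < e / 2.
    by apply: H; rewrite /ball_/= (lt_trans xx')// ltr_pdivrMr// ltr_pMr// ltr1n.
  have h2 : `|f x - f y| < e / 2.
    apply: H; rewrite /ball_/= (_ : x - y = (x - x') + (x' - y)); last by ring.
    rewrite (le_lt_trans (ler_normD _ _))// [ltRHS](splitr eta) ltrD//.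
    exact: lt_trans x'y dleta.
  rewrite (_ : f x' - f y = (f x - f y) - (f x - f x')); last by ring.
  by rewrite (le_lt_trans (ler_normB _ _))// [ltRHS](splitr e) addrC ltrD.
move=> dl0 /= dl00 H; exists (dl0 / 2); first by rewrite divr_gt0.
move=> x y xab _ xy; apply: (H (dl0 / 2)) => //=; last by rewrite divr_gt0.
by rewrite /ball_/= sub0r normrN gtr0_norm ?divr_gt0// ltr_pdivrMr// ltr_pMr// ltr1n.
Unshelve. all: by end_near. Qed.

(** The steps that start before [tau] end at the first grid point at or after [tau], so the sum
    telescopes to a value of [f] within one mesh of [tau]. Testing the left end of each step is what
    suits a stopping time. *)
Lemma cvg_step_sum (f : R -> R) (t0 tau : R) : 0 < t0 -> 0 <= tau <= t0 ->
  {for tau, continuous f} ->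
  \sum_(k < n.+1) (if t0 / n.+1%:R * k%:R < tau then
      f (t0 / n.+1%:R * k.+1%:R) - f (t0 / n.+1%:R * k%:R) else 0) @[n --> \oo]
  --> f tau - f 0.
Proof.
move=> t00 /andP[tau0 taut] cf.
have stepE (dl : R) K : 0 < dl -> (forall k, (dl * k%:R < tau) = (k < K)%N) ->
    forall N, (K <= N)%N -> \sum_(k < N) (if dl * k%:R < tau then
      f (dl * k.+1%:R) - f (dl * k%:R) else 0) = f (dl * K%:R) - f 0.
  move=> dl0 HK; elim=> [|N IH].
    by rewrite leqn0 => /eqP ->; rewrite big_ord0 mulr0 subrr.
  rewrite leq_eqVlt => /orP[/eqP KN|].
    transitivity (\sum_(0 <= k < N.+1) (f (dl * k.+1%:R) - f (dl * k%:R))).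
      by rewrite big_mkord; apply: eq_bigr => k _; rewrite HK KN ltn_ord.
    by rewrite (telescope_sumr (fun k => f (dl * k%:R)))// mulr0 KN.
  rewrite ltnS => KN; rewrite big_ord_recr/= IH// HK ltnNge KN/= addr0.
  by [].
have exK (dl : R) : 0 < dl -> exists K : nat,
    (forall k, (dl * k%:R < tau) = (k < K)%N) /\ `|dl * K%:R - tau| <= dl.
  move=> dl0.
  have [n Hn] : exists n, ~~ (dl * n%:R < tau).
    exists (Num.truncn (tau / dl)).+1; rewrite -leNgt -ler_pdivrMl// mulrC.
    by rewrite ltW// truncnS_gt// divr_ge0// ltW.
  (* [K] is the least index of a grid point not before [tau]. *)
  have [K HK minK] := ex_minnP (ex_intro (fun n => ~~ (dl * n%:R < tau)) n Hn).
  exists K; split.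
    move=> k; apply/idP/idP => [h|kK].
      rewrite ltnNge; apply/negP => Kk; move: HK; rewrite (le_lt_trans _ h)//.
      by rewrite ler_pM2l// ler_nat.
    by apply: contraTT kK => /minK; rewrite -leqNgt.
  rewrite -leNgt in HK; rewrite ger0_norm ?subr_ge0//.
  case: K HK minK => [|K] HK minK.
    by move: HK; rewrite mulr0 sub0r => ?; rewrite (le_trans _ (ltW dl0))// oppr_le0.
  have : dl * K%:R < tau.
    by rewrite ltNge; apply/negP => h; have := minK K; rewrite -leNgt => /(_ h); rewrite ltnn.
  by rewrite -natr1 mulrDr mulr1; lra.
apply/cvgrPdist_le => e e0.
have /cvgrPdist_le/(_ e e0)[eta /= eta0 H] := cf.
near=> n.
have dl0 : 0 < t0 / n.+1%:R :> R by rewrite divr_gt0// ltr0n.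
have [K [HK Kt]] := exK _ dl0.
have KN : (K <= n.+1)%N.
  rewrite leqNgt -HK -leNgt mulfVK// ?pnatr_eq0//.
rewrite (stepE _ _ dl0 HK)// opprB addrA subrK H//= distrC.
rewrite (le_lt_trans Kt)//.
rewrite ltr_pdivrMr ?ltr0n// -ltr_pdivrMl// mulrC.
rewrite (lt_trans (y := n%:R))// ?ltr_nat//; near: n; exact: nbhs_infty_gtr.
Unshelve. all: by end_near. Qed.

(** By the mean value theorem each term differs from the increment of the primitive [I] by the mesh
    times the oscillation of [h] over one step, which is uniformly small; [cvg_step_sum] handles the
    increments. *)
Lemma cvg_riemann_sum (h I : R -> R) (t0 tau : R) : 0 < t0 -> 0 <= tau <= t0 ->
  continuous h -> (forall t : R, 0 <= t -> is_derive t 1 I (h t)) ->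
  \sum_(k < n.+1) (if t0 / n.+1%:R * k%:R < tau then
      t0 / n.+1%:R * h (t0 / n.+1%:R * k%:R) else 0) @[n --> \oo]
  --> I tau - I 0.
Proof.
move=> t00 /andP[tau0 taut] ch dI.
have cI t : 0 <= t -> {for t, continuous I}.
  by move=> /dI ?; apply/differentiable_continuous/derivable1_diffP.
have := @cvg_step_sum I t0 tau t00; rewrite tau0 taut => /(_ isT (cI _ tau0)) H.
apply: cvg_sub0 H; apply/cvgrPdist_le => e e0.
have et0 : 0 < e / t0 by rewrite divr_gt0.
have [dl dl0 Hdl] := @continuous_unif_itv h 0 t0 _ (fun x _ => ch x) et0.
near=> n; rewrite sub0r normrN !fctE /= -sumrB.
have dn0 : 0 < t0 / n.+1%:R :> R by rewrite divr_gt0// ltr0n.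
rewrite (le_trans (ler_norm_sum _ _ _))//.
rewrite (_ : e = \sum_(k < n.+1) (e / t0) * (t0 / n.+1%:R)); last first.
  by rewrite sumr_const card_ord -[RHS]mulr_natr -mulrA divfK ?pnatr_eq0// divfK// gt_eqF.
apply: ler_sum => k _; case: ifPn => _; last first.
  by rewrite subr0 normr0 mulr_ge0// ltW.
have kt : t0 / n.+1%:R * k%:R < t0 / n.+1%:R * k.+1%:R by rewrite ltr_pM2l// ltr_nat.
have k0 : 0 <= t0 / n.+1%:R * k%:R by rewrite mulr_ge0// ltW.
have kt0 : t0 / n.+1%:R * k.+1%:R <= t0.
  by rewrite mulrAC ler_pdivrMr ?ltr0n// ler_pM2l// ler_nat.
have [||c] := @MVT _ I h _ _ kt.
- move=> x; rewrite in_itv/= => /andP[x1 _]; apply: dI; exact: le_trans k0 (ltW x1).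
- apply: continuous_in_subspaceT => x; rewrite inE/= in_itv/= => /andP[x1 _].
  apply: cI; exact: le_trans k0 x1.
rewrite in_itv/= => /andP[c1 c2] ->.
have dE : t0 / n.+1%:R * k.+1%:R - t0 / n.+1%:R * k%:R = t0 / n.+1%:R.
  by rewrite -natr1; ring.
rewrite dE [h c * _]mulrC -mulrBr normrM gtr0_norm// mulrC ler_pM2r//.
apply/ltW/Hdl.
- by rewrite in_itv/= k0 (le_trans (ltW kt)).
- by rewrite in_itv/= (le_trans k0 (ltW c1)) (le_trans (ltW c2)).
rewrite distrC gtr0_norm ?subr_gt0// (lt_trans (y := t0 / n.+1%:R))//.
  by rewrite -[ltRHS]dE ltrD2r.
rewrite ltr_pdivrMr ?ltr0n// -ltr_pdivrMl// mulrC.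
rewrite (lt_trans (y := n%:R))// ?ltr_nat//; near: n; exact: nbhs_infty_gtr.
Unshelve. all: by end_near. Qed.

End analysis_tools.

Section bounded_integrals.
Context {R : realType} {dd : measure_display} {T : measurableType dd}
  (mu : {measure set T -> \bar R}).
Variables (D : set T) (mD : measurable D).
Hypothesis muD : (mu D < +oo)%E.

Lemma bounded_integrable (f : T -> R) C : measurable_fun D f ->
  (forall x, D x -> `|f x| <= C) -> mu.-integrable D (EFin \o f).
Proof.
move=> mf fC; apply: measurable_bounded_integrable => //.
exists C; split; first exact: num_real.
by move=> y Cy x /= Dx; rewrite (le_trans (fC _ Dx))// ltW.
Qed.

Lemma cvg_bounded_Rintegral (f_ : nat -> T -> R) (f : T -> R) C :
  (forall n, measurable_fun D (f_ n)) ->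
  (forall n x, D x -> `|f_ n x| <= C) ->
  (forall x, D x -> f_ n x @[n --> \oo] --> f x) ->
  \int[mu]_(x in D) f_ n x @[n --> \oo] --> \int[mu]_(x in D) f x.
Proof.
move=> mf_ fC cf.
have mf : measurable_fun D f by exact: measurable_fun_cvg mf_ cf.
have fb x : D x -> `|f x| <= C.
  move=> Dx; have : `|f_ n x| @[n --> \oo] --> `|f x| by apply: cvg_norm; exact: cf.
  by move=> /(cvgr_to_le); apply; near=> n; exact: fC.
have iC : mu.-integrable D (EFin \o cst C) by apply: (@bounded_integrable _ `|C|).
have := @dominated_cvg _ _ _ mu D mD (fun n => EFin \o f_ n) (EFin \o f) (EFin \o cst C).
move=> H; apply: fine_cvg; rewrite fineK; last first.
  by apply: integrable_fin_num => //; exact: bounded_integrable fb.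
apply: H => //.
- by move=> n; apply/measurable_EFinP.
- by move=> x Dx; apply: cvg_EFin; [near=> n|exact: cf].
Unshelve. all: by end_near. Qed.

End bounded_integrals.

(** * The exit time of a ball and Dynkin's formula for Gaussian test functions *)

Section exit.
Context {R : realType} {dd : measure_display} {Om : measurableType dd}
  (P : probability Om R) {d : nat} (W : R -> Om -> 'rV[R]_d).
Hypothesis hW : brownian_motion P W.
Variables (x : 'rV[R]_d) (s : R).
Hypothesis s0 : 0 < s.

(** Paths are continuous on nonnegative times only; freezing time at 0 on the left gives a process
    continuous on the whole line. *)
Definition sqdist (w : Om) (t : R) : R := sqn (x + W (Num.max t 0) w).
Local Notation q := sqdist.
Definition bm_exit (w : Om) : \bar R := exit_time s (fun t => x + W t w).
Local Notation T := bm_exit.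

Lemma sqdistE w t : 0 <= t -> q w t = sqn (x + W t w).
Proof. by move=> t0; rewrite /q; have /max_idPl -> := t0. Qed.

Lemma sqdist_ge0 w t : 0 <= q w t.
Proof. exact: sqn_ge0. Qed.

Lemma continuous_sqdist w : continuous (q w).
Proof.
move=> t; rewrite /q /sqn; apply: cvg_big; first exact: add_continuous.
move=> i _; rewrite expr2.
have H : x ord0 i + W (Num.max u 0) w ord0 i @[u --> t] --> x ord0 i + W (Num.max t 0) w ord0 i.
  apply: cvgD; first exact: cvg_cst.
  have A0 : `[0, +oo[%classic (Num.max t 0) by rewrite /= in_itv/= le_max lexx orbT.
  have /subspace_continuousP/(_ _ A0) cW := @bm_continuous _ _ _ _ _ _ hW w.
  have cc := @coord_continuous R 1 d ord0 i (W (Num.max t 0) w).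
  have h : W (Num.max u 0) w @[u --> t] --> W (Num.max t 0) w.
    apply: cvg_trans cW => Q /= nQ.
    have cm : Num.max u 0 @[u --> t] --> Num.max t 0.
      by apply: continuous_max; [exact: cvg_id|exact: cvg_cst].
    have := cm _ nQ; rewrite /= !nbhs_simpl /=; apply: filterS => u; apply.
    by rewrite /= in_itv/= le_max lexx orbT.
  exact: (cvg_comp _ _ h cc).
under eq_fun do rewrite mxE expr2.
by rewrite mxE; apply: cvgM.
Qed.

Lemma measurable_sqdist t : measurable_fun setT (q ^~ t).
Proof.
apply: measurable_sum => i; apply: measurable_funX.
rewrite (_ : (fun _ => _) = (fun w => x ord0 i + W (Num.max t 0) w ord0 i)).
  apply: measurable_funD => //; apply: (measurable_bm_coord hW).
  by rewrite le_max lexx orbT.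
by apply/funext => w; rewrite mxE.
Qed.

Lemma bm_exit_gtP w z : 0 <= z ->
  (z%:E < T w)%E <-> (forall r, 0 <= r <= z -> q w r < s ^+ 2).
Proof.
move=> z0; split.
  move=> zT r /andP[r0 rz]; rewrite ltNge; apply/negP => sq.
  move: zT; rewrite ltNge => /negP; apply.
  apply: (@le_trans _ _ r%:E); last by rewrite lee_fin.
  apply: ereal_inf_lbound; exists r => //=; split => //.
  by rewrite leNgt enorm_ltE ?ltW// -sqdistE// -leNgt.
move=> H.
have Hz : q w z < s ^+ 2 by apply: H; rewrite z0 lexx.
(* Being strictly inside at time [z], the path stays inside for a further time [eta], so the exit
   time is at least [z + eta]. *)
have /cvgrPdist_lt/(_ (s ^+ 2 - q w z)) := @continuous_sqdist w z.
rewrite subr_gt0 Hz => /(_ isT)[eta /= eta0 Heta].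
apply: (@lt_le_trans _ _ (z + eta)%:E); first by rewrite lte_fin ltrDl.
apply: le_ereal_inf_tmp => _ [r [r0 sr] <-]; rewrite lee_fin leNgt; apply/negP => rz.
move: sr; rewrite leNgt enorm_ltE ?ltW// -sqdistE// => /negP; apply.
have [rz'|zr] := leP r z; first by apply: H; rewrite r0.
have := Heta r; rewrite /ball_/= ltr0_norm ?subr_lt0// opprB ltrBlDl => /(_ rz).
by rewrite distrC => /ltr_normlW; lra.
Qed.

Let A (z : R) := [set w | (z%:E < T w)%E].
(** The product rule for increments sees finitely many times only, so the event [A z] is reached by
    two limits: [B z j m], on a grid of mesh [z / m.+1], tends to [Aj z j] as [m] grows, and
    [Aj z j] tends to [A z] as [j] grows. The closed levels [c j < s ^+ 2] are there because strict
    inequalities on a grid are not preserved in the limit. *)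
Let c (j : nat) : R := s ^+ 2 - j.+1%:R^-1.

(** Equal steps up to [z], reached at index [m.+1], then one step [dl] that matters; the remaining
    ones only keep the sequence increasing. *)
Let grid (z dl : R) (m k : nat) : R :=
  if (k <= m.+1)%N then z * k%:R / m.+1%:R else z + dl * (k - m.+1)%:R.

Let B (z : R) (j m : nat) := [set w | forall k, (k <= m.+1)%N ->
  q w (z * k%:R / m.+1%:R) <= c j].

Let Aj (z : R) (j : nat) := [set w | forall r, 0 <= r <= z -> q w r <= c j].

Let cvgB z j w : 0 < z -> (\1_(B z j m) w : R) @[m --> \oo] --> (\1_(Aj z j) w : R).
Proof.
move=> z0; have [wA|wA] := pselect (Aj z j w).
  rewrite indicE mem_set//; apply: cvg_near_cst; near=> m.
  rewrite indicE mem_set// => k km; apply: wA.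
  apply/andP; split; first by rewrite divr_ge0// mulr_ge0// ltW.
  by rewrite ler_pdivrMr ?ltr0n// ler_pM2l// ler_nat.
rewrite indicE memNset//.
have [r [r0z qr]] : exists r, 0 <= r <= z /\ c j < q w r.
  apply: contrapT => h; apply: wA => r rz; rewrite leNgt; apply/negP => cq.
  by apply: h; exists r.
have /cvgrPdist_lt/(_ (q w r - c j)) := @continuous_sqdist w r.
rewrite subr_gt0 qr => /(_ isT)[eta /= eta0 Heta].
apply: cvg_near_cst; near=> m.
rewrite indicE memNset// => Bm.
(* The index of the last grid point not beyond [r], a time at which the level [c j] is exceeded. *)
pose k := Num.truncn (r * m.+1%:R / z).
have m0 : 0 < m.+1%:R :> R by rewrite ltr0n.
have /andP[r0 rz] := r0z.
have rm0 : 0 <= r * m.+1%:R / z by rewrite divr_ge0 ?mulr_ge0// ltW.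
have /andP[k1 k2] := truncn_itv rm0; rewrite -/k in k1 k2.
have km : (k <= m.+1)%N.
  rewrite -(ler_nat R) (le_trans k1)// ler_pdivrMr// mulrC.
  by rewrite ler_pM2l.
have := Heta (z * k%:R / m.+1%:R).
have e1 : z * k%:R / m.+1%:R <= r by rewrite ler_pdivrMr// mulrC -ler_pdivlMr.
have e2 : r < z * k%:R / m.+1%:R + z / m.+1%:R.
  rewrite -mulrDl ltr_pdivlMr//; move: k2; rewrite ltr_pdivrMr// -natr1.
  by rewrite -[k.+1%:R]natr1; nra.
have e3 : z / m.+1%:R < eta.
  rewrite ltr_pdivrMr// -ltr_pdivrMl// mulrC.
  rewrite (lt_trans (y := m%:R))// ?ltr_nat//; near: m; exact: nbhs_infty_gtr.
rewrite /ball_/= ger0_norm ?subr_ge0// => H3.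
have H4 : r - z * k%:R / m.+1%:R < eta by rewrite ltrBlDl (lt_trans e2)// ltrD2l.
by have := Bm _ km; move/ltr_normlW : (H3 H4); lra.
Unshelve. all: by end_near. Qed.

Let cvgAj z w : 0 <= z -> (\1_(Aj z j) w : R) @[j --> \oo] --> (\1_(A z) w : R).
Proof.
move=> z0; have [wA|wA] := pselect (A z w); last first.
  rewrite [X in _ --> X]indicE memNset//; apply: cvg_near_cst; near=> j.
  rewrite indicE memNset// => H; apply: wA; apply/bm_exit_gtP => // r rz.
  by rewrite (le_lt_trans (H _ rz))// /c ltrBlDr ltrDl invr_gt0 ltr0n.
rewrite [X in _ --> X]indicE mem_set//.
(* The path attains its maximum over [[0, z]], which is below [s ^+ 2] and so below [c j] for large
   [j]. *)
have [|r rz Hr] := @EVT_max _ (q w) 0 z z0.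
  by apply: continuous_subspaceT; exact: continuous_sqdist.
have qr : q w r < s ^+ 2 by move/bm_exit_gtP : wA; apply.
apply: cvg_near_cst; near=> j; rewrite indicE mem_set// => u uz.
rewrite (le_trans (Hr _ uz))// /c lerBrDr -lerBrDl.
rewrite -[leRHS]invrK lef_pV2 ?posrE ?ltr0n ?invr_gt0 ?subr_gt0//.
rewrite (le_trans (y := j%:R))// ?ler_nat//; near: j; exact: nbhs_infty_ger.
Unshelve. all: by end_near. Qed.

Let mB z j m : 0 < z -> measurable (B z j m).
Proof.
move=> z0; rewrite (_ : B z j m = \bigcap_(k in `I_m.+2)
   ((q ^~ (z * k%:R / m.+1%:R)) @^-1` [set` `]-oo, c j]])); last first.
  apply/seteqP; split => w /= h k km; first by rewrite /= in_itv/=; exact: h.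
  by have := h k km; rewrite /= in_itv.
apply: fin_bigcap_measurable; first exact: finite_II.
move=> k _; rewrite -[X in measurable X]setTI; apply: measurable_sqdist => //.
Qed.

Let P1 : (P setT < +oo)%E.
Proof. by rewrite probability_setT ltry. Qed.

Let indic_le1 (E : set Om) w : `|\1_E w : R| <= 1.
Proof. by rewrite indicE; case: (_ \in _); rewrite ?normr1 ?normr0. Qed.

Lemma measurable_bm_exit_gt z : 0 <= z -> measurable (A z).
Proof.
rewrite le_eqVlt => /predU1P[<-|z0].
  rewrite (_ : A 0 = (q ^~ 0) @^-1` [set` `]-oo, s ^+ 2[]).
    by rewrite -[X in measurable X]setTI; exact: measurable_sqdist.
  apply/seteqP; split => w /=; rewrite in_itv/=.
    by move/bm_exit_gtP => /(_ (lexx _)); apply; rewrite lexx.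
  by move=> h; apply/bm_exit_gtP => // r; rewrite -eq_le => /eqP <-.
have mAj j : measurable_fun setT (\1_(Aj z j) : Om -> R).
  apply: (measurable_fun_cvg (h := fun m => \1_(B z j m))).
    by move=> m; apply: measurable_indic; exact: mB.
  by move=> w _; exact: cvgB.
have : measurable_fun setT (\1_(A z) : Om -> R).
  by apply: measurable_fun_cvg mAj _ => w _; apply: cvgAj; exact: ltW.
by move/measurable_indicP.
Qed.

Let expectation_lim (f g : Om -> R) C z : 0 < z ->
  measurable_fun setT f -> measurable_fun setT g ->
  (forall w, `|f w| <= C) -> (forall w, `|g w| <= C) ->
  (forall j m, \int[P]_w (\1_(B z j m) w * f w) = \int[P]_w (\1_(B z j m) w * g w)) ->
  \int[P]_w (\1_(A z) w * f w) = \int[P]_w (\1_(A z) w * g w).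
Proof.
move=> z0 mf mg fC gC E.
have mAj j : measurable_fun setT (\1_(Aj z j) : Om -> R).
  apply: (measurable_fun_cvg (h := fun m => \1_(B z j m))).
    by move=> m; apply: measurable_indic; exact: mB.
  by move=> w _; exact: cvgB.
have bd (f' : Om -> R) (E' : set Om) w : (forall w, `|f' w| <= C) -> `|\1_E' w * f' w| <= C.
  move=> h; rewrite normrM (le_trans _ (h w))// ler_piMl//; exact: indic_le1.
have limB (f' : Om -> R) j : measurable_fun setT f' -> (forall w, `|f' w| <= C) ->
   \int[P]_w (\1_(B z j m) w * f' w) @[m --> \oo] --> \int[P]_w (\1_(Aj z j) w * f' w).
  move=> mf' f'C; apply: (cvg_bounded_Rintegral measurableT P1 (C := C)).
  - by move=> m; apply: measurable_funM => //; apply: measurable_indic; exact: mB.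
  - by move=> m w _; exact: bd.
  - by move=> w _; apply: cvgM; [exact: cvgB|exact: cvg_cst].
have limA (f' : Om -> R) : measurable_fun setT f' -> (forall w, `|f' w| <= C) ->
   \int[P]_w (\1_(Aj z j) w * f' w) @[j --> \oo] --> \int[P]_w (\1_(A z) w * f' w).
  move=> mf' f'C; apply: (cvg_bounded_Rintegral measurableT P1 (C := C)).
  - by move=> m; apply: measurable_funM.
  - by move=> m w _; exact: bd.
  - by move=> w _; apply: cvgM; [apply: cvgAj; exact: ltW|exact: cvg_cst].
apply: (cvg_unique _ (limA f mf fC)) => //.
rewrite (_ : (fun j => _) = (fun j => \int[P]_w (\1_(Aj z j) w * g w))).
  exact: limA.
apply/funext => j; apply: (cvg_unique _ (limB f j mf fC)) => //.
rewrite (_ : (fun m => _) = (fun m => \int[P]_w (\1_(B z j m) w * g w))).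
  exact: limB.
by apply/funext => m; exact: E.
Qed.

(** [brownian_step] holds on each grid event [B z j m], and all quantities are bounded by 1, so it
    passes to the limit event. *)
Lemma stopped_step (lam z dl : R) : 0 < lam -> 0 <= z -> 0 < dl ->
  let b2 := (1 + 2 * lam * dl)^-1 in
  \int[P]_w (\1_(A z) w * expR (- (lam * q w (z + dl)))) =
  \int[P]_w (\1_(A z) w * (Num.sqrt b2 ^+ d * expR (- (lam * b2 * q w z)))).
Proof.
move=> l0 z0 dl0 b2.
have b20 : 0 < b2 by rewrite invr_gt0; nra.
have b21 : b2 <= 1 by rewrite invf_le1; nra.
have exple1 (a : R) : 0 <= a -> expR (- a) <= 1.
  by move=> a0; rewrite -expR0 ler_expR oppr_le0.
have mexp a r : measurable_fun setT (fun w => expR (- (a * q w r))).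
  apply: measurableT_comp => //; apply: measurableT_comp => //.
  by apply: measurable_funM => //; exact: measurable_sqdist.
have toq (t : R) (w : Om) : 0 <= t -> sqn (x + W t w) = q w t by move=> ?; rewrite sqdistE.
move: z0; rewrite le_eqVlt => /predU1P[<-|z0].
  have := @brownian_step _ _ _ P d W hW (fun k => dl * k%:R) 0 (mulr0 _) _ x
    (fun=> [set` `]-oo, s ^+ 2[]) (fun=> measurable_itv _) lam l0.
  rewrite mulr0 mulr1 subr0 -/b2 => /(_ (fun k => _))/(congr1 fine) E.
  have {}E := E _.
  set B0 := [set w | _] in E.
  have -> : A 0 = B0.
    apply/seteqP; split => w /=.
      move/bm_exit_gtP => /(_ (lexx _)) h k; rewrite leqn0 => /eqP ->.
      by rewrite mulr0 toq//= in_itv/=; apply: h; rewrite lexx.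
    move=> /(_ 0%N (leqnn _)); rewrite mulr0 toq//= in_itv/= => h.
    by apply/bm_exit_gtP => // r; rewrite -eq_le => /eqP <-.
  rewrite add0r; apply: (etrans _ (etrans (E _) _)).
  - by apply: eq_Rintegral => w _; rewrite toq ?ltW.
  - by move=> k; rewrite ltr_pM2l// ltr_nat.
  - by apply: eq_Rintegral => w _; rewrite toq.
apply: (@expectation_lim _ _ 1) => //.
- by apply: measurable_funM.
- by move=> w; rewrite ger0_norm ?expR_ge0// exple1// mulr_ge0 ?sqdist_ge0// ltW.
- move=> w; rewrite ger0_norm ?mulr_ge0 ?exprn_ge0 ?sqrtr_ge0 ?expR_ge0//.
  rewrite mulr_ile1 ?exprn_ge0 ?sqrtr_ge0 ?expR_ge0//.
    by rewrite exprn_ile1 ?sqrtr_ge0// -sqrtr1 ler_sqrt.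
  by rewrite exple1// !mulr_ge0 ?sqdist_ge0// ltW.
move=> j m.
have gridS k : grid z dl m k < grid z dl m k.+1.
  rewrite /grid; have [km|] := leqP k.+1 m.+1.
    by rewrite (ltnW km) ltr_pM2r ?invr_gt0 ?ltr0n// ltr_pM2l// ltr_nat.
  rewrite ltnS leq_eqVlt => /predU1P[<-|mk].
    by rewrite leqnn subSnn mulr1 mulfK ?pnatr_eq0// ltrDl.
  by rewrite leqNgt mk/= ltrD2l ltr_pM2l// ltr_nat ltn_sub2r// ltnS ltnW.
have grid0 : grid z dl m 0 = 0 by rewrite /grid mulr0 mul0r.
have gridm : grid z dl m m.+1 = z by rewrite /grid leqnn mulfK ?pnatr_eq0.
have gridm1 : grid z dl m m.+2 = z + dl by rewrite /grid ltnn subSnn mulr1.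
have := @brownian_step _ _ _ P d W hW (grid z dl m) m.+1 grid0 gridS x
    (fun=> [set` `]-oo, c j]]) (fun=> measurable_itv _) lam l0.
rewrite gridm gridm1 addrAC subrr add0r -/b2 => /(congr1 fine) E.
set B0 := [set w | _] in E.
have qk k w : (k <= m.+1)%N -> sqn (x + W (grid z dl m k) w) = q w (z * k%:R / m.+1%:R).
  by move=> km; rewrite /grid km toq// divr_ge0// mulr_ge0// ltW.
have -> : B z j m = B0.
  apply/seteqP; split => w /= h k km; first by rewrite qk//= in_itv/=; exact: h.
  by have := h k km; rewrite qk//= in_itv.
apply: (etrans _ (etrans E _)).
- by apply: eq_Rintegral => w _; rewrite toq// addr_ge0// ltW.
- by apply: eq_Rintegral => w _; rewrite toq// ltW.
Qed.

End exit.

Section gauss_generator.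
Context {R : realType}.

(** Everything follows from [1 + t <= expR t] at [t = k] and [t = - k]. *)
Lemma expR_sub1_bound (k : R) : `|expR k - 1 - k| <= k ^+ 2 * expR `|k|.
Proof.
have h1 := expR_ge1Dx k.
have h2 := expR_ge1Dx (- k).
have e0 := expR_gt0 k.
have h3 : expR k - 1 <= k * expR k.
  have : expR k * (1 + - k) <= expR k * expR (- k) by rewrite ler_pM2l.
  rewrite -expRD subrr expR0; nra.
rewrite ger0_norm; last by lra.
have [k0|k0] := leP 0 k; first by rewrite ger0_norm//; nra.
rewrite ltr0_norm//.
have : 1 <= expR (- k) by rewrite -expR0 ler_expR; lra.
by move=> h4; nra.
Qed.

Lemma ln1D_bounds (y : R) : 0 <= y -> y - y ^+ 2 <= ln (1 + y) <= y.
Proof.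
move=> y0; have y1 : 0 < 1 + y by lra.
have e1 : expR (ln (1 + y)) = 1 + y by rewrite lnK// posrE.
apply/andP; split; last by have := expR_ge1Dx (ln (1 + y)); rewrite e1; lra.
have := expR_ge1Dx (- ln (1 + y)); rewrite expRN e1 => h.
have : (1 + y) * (1 - ln (1 + y)) <= 1.
  by rewrite mulrC -ler_pdivlMr// mul1r.
move=> h'.
have : y / (1 + y) <= ln (1 + y) by rewrite ler_pdivrMr//; nra.
apply: le_trans; rewrite ler_pdivlMr//; nra.
Qed.

(** Half the Laplacian of exp(- lam |y|^2) in dimension [d], as a function of q = |y|^2. *)
Definition gauss_gen (d : nat) (lam q : R) : R :=
  (2 * lam ^+ 2 * q - lam * d%:R) * expR (- (lam * q)).

(** The exact effect of a Gaussian step of variance [dl] on the test function agrees with its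
    first-order expansion up to an error quadratic in [dl], uniformly for [q] in [[0, S]]. *)
Lemma gauss_step_bound (d : nat) (lam S : R) : 0 < lam -> 0 <= S ->
  exists2 C, 0 <= C & forall dl q b2, 0 < dl <= 1 -> 0 <= q <= S ->
    b2 = (1 + 2 * lam * dl)^-1 ->
    `|Num.sqrt b2 ^+ d * expR (- (lam * b2 * q)) - expR (- (lam * q)) -
      dl * gauss_gen d lam q| <= C * dl ^+ 2.
Proof.
move=> l0 S0.
(* [D] bounds the logarithm [kp] of the ratio of the two Gaussians relative to [y = 2 * lam * dl]:
   the first summand comes from the normalising factor, the second from the exponent. *)
pose D : R := d%:R / 2 + lam * S.
have D0 : 0 <= D by rewrite addr_ge0// ?divr_ge0// mulr_ge0// ltW.
exists ((D ^+ 2 * expR (D * (2 * lam)) + D) * (2 * lam) ^+ 2).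
  by rewrite mulr_ge0 ?sqr_ge0// addr_ge0// mulr_ge0 ?sqr_ge0// expR_ge0.
move=> dl q b2 /andP[dl0 dl1] /andP[q0 qS] b2def.
pose y := 2 * lam * dl.
have y0 : 0 < y by rewrite /y; nra.
have y1 : 0 < 1 + y by lra.
pose l := ln (1 + y).
have /andP[l1 l2] := ln1D_bounds (ltW y0); rewrite -/l in l1 l2.
have lp : 0 <= l by rewrite ln_ge0//; lra.
have b2E : b2 = expR (- l) by rewrite b2def expRN lnK ?posrE.
have sb2 : Num.sqrt b2 = expR (- (l / 2)).
  rewrite b2E (_ : - l = - (l / 2) + - (l / 2)); last by field.
  by rewrite expRD -expr2 sqrtr_sqr ger0_norm// expR_ge0.
pose kp := - (d%:R / 2 * l) + lam * q * (1 - b2).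
have -> : Num.sqrt b2 ^+ d * expR (- (lam * b2 * q)) = expR (- (lam * q)) * expR kp.
  rewrite sb2 -expRM_natl -!expRD; congr expR; by rewrite /kp; field.
(* The linear part of [kp]; multiplied by the test function it is [dl * gauss_gen d lam q]. *)
pose k0 := (lam * q - d%:R / 2) * y.
rewrite (_ : _ - _ - _ = expR (- (lam * q)) * (expR kp - 1 - k0)); last first.
  by rewrite /gauss_gen /k0 /y; field.
rewrite normrM ger0_norm ?expR_ge0//.
have e1 : expR (- (lam * q)) <= 1.
  by rewrite -expR0 ler_expR oppr_le0 mulr_ge0// ltW.
apply: (@le_trans _ _ `|expR kp - 1 - k0|); first by rewrite ler_piMl.
have b2y : 1 - b2 = y * b2.
  have : b2 * (1 + y) = 1 by rewrite b2def mulVf// gt_eqF.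
  by move=> h; lra.
have b20 : 0 < b2 by rewrite b2def invr_gt0.
have b21 : b2 <= 1 by nra.
have yb : y - y ^+ 2 <= 1 - b2 <= y.
  rewrite b2y; apply/andP; split; last by nra.
  have : 1 - b2 <= y by rewrite b2y; nra.
  nra.
have d0 : 0 <= d%:R / 2 :> R by rewrite divr_ge0.
have lq0 : 0 <= lam * q by rewrite mulr_ge0// ltW.
have lqS : lam * q <= lam * S by rewrite ler_pM2l.
move: yb => /andP[yb1 yb2].
have kpD : `|kp| <= D * y.
  rewrite ler_norml; apply/andP; split.
    have : d%:R / 2 * l <= d%:R / 2 * y by rewrite ler_wpM2l.
    have : 0 <= lam * q * (1 - b2) by rewrite mulr_ge0//; lra.
    have : 0 <= lam * S * y by rewrite !mulr_ge0// ltW.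
    by rewrite /kp /D mulrDl; lra.
  have : 0 <= d%:R / 2 * l by rewrite mulr_ge0.
  have : lam * q * (1 - b2) <= lam * S * y by rewrite ler_pM//; lra.
  have : 0 <= d%:R / 2 * y by rewrite mulr_ge0// ltW.
  by rewrite /kp /D mulrDl; lra.
have kk0 : `|kp - k0| <= D * y ^+ 2.
  have -> : kp - k0 = d%:R / 2 * (y - l) - lam * q * (y - (1 - b2)).
    by rewrite /kp /k0; ring.
  rewrite (le_trans (ler_normB _ _))// /D mulrDl lerD//.
    rewrite normrM ger0_norm// ler_wpM2l// ler_norml; apply/andP; split; nra.
  rewrite normrM ger0_norm// ler_pM// ler_norml; apply/andP; split; nra.
have yl : y <= 2 * lam by rewrite /y; nra.
have y2 : y ^+ 2 = (2 * lam) ^+ 2 * dl ^+ 2 by rewrite -exprMn.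
rewrite (_ : expR kp - 1 - k0 = (expR kp - 1 - kp) + (kp - k0)); last by ring.
rewrite (le_trans (ler_normD _ _))//.
rewrite -mulrA -y2 mulrDl lerD//.
rewrite (le_trans (expR_sub1_bound _))//.
have : kp ^+ 2 <= D ^+ 2 * y ^+ 2.
  by rewrite -exprMn -[kp ^+ 2]real_normK ?num_real// lerXn2r ?nnegrE// mulr_ge0// ltW.
have : expR `|kp| <= expR (D * (2 * lam)).
  by rewrite ler_expR (le_trans kpD)// ler_wpM2l.
move=> h1 h2; rewrite [leRHS]mulrAC.
by apply: ler_pM => //; rewrite ?sqr_ge0 ?expR_ge0.
Qed.

Lemma gauss_gen_bound (d : nat) (lam S : R) : 0 < lam -> 0 <= S ->
  forall q, 0 <= q <= S -> `|gauss_gen d lam q| <= 2 * lam ^+ 2 * S + lam * d%:R.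
Proof.
move=> l0 S0 q /andP[q0 qS].
have e1 : expR (- (lam * q)) <= 1.
  by rewrite -expR0 ler_expR oppr_le0 mulr_ge0// ltW.
rewrite /gauss_gen normrM [`|expR _|]ger0_norm ?expR_ge0//.
rewrite (@le_trans _ _ `|2 * lam ^+ 2 * q - lam * d%:R|)//.
  by rewrite ler_piMr.
rewrite (le_trans (ler_normB _ _))// lerD//.
  have a0 : 0 <= 2 * lam ^+ 2 by rewrite mulr_ge0// sqr_ge0.
  by rewrite ger0_norm ?(mulr_ge0 a0)// ler_wpM2l.
by rewrite ger0_norm// mulr_ge0// ltW.
Qed.

(** Serves as domination: whatever [tau] and the number of steps, the sum is a single difference of
    values of [f]. *)
Lemma step_sum_telescope (f : R -> R) (dl tau : R) : 0 < dl -> forall N, exists K : nat,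
  \sum_(k < N) (if dl * k%:R < tau then f (dl * k.+1%:R) - f (dl * k%:R) else 0) =
  f (dl * K%:R) - f 0.
Proof.
move=> dl0 N.
suff [K [_ -> _]] : exists K : nat, [/\ (K <= N)%N,
  \sum_(k < N) (if dl * k%:R < tau then f (dl * k.+1%:R) - f (dl * k%:R) else 0) =
  f (dl * K%:R) - f 0 & K = N \/ tau <= dl * K%:R] by exists K.
elim: N => [|N [K [KN IH H]]].
  by exists 0%N; split => //; [rewrite big_ord0 mulr0 subrr|left].
have [Ntau|tauN] := ltP (dl * N%:R) tau.
  have KN' : K = N.
    case: H => // tK; move: Ntau; rewrite ltNge (le_trans tK)//.
    by rewrite ler_pM2l// ler_nat.
  exists N.+1; split => //; last by left.
  by rewrite big_ord_recr/= IH Ntau KN'; ring.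
exists K; split; first exact: leqW.
  by rewrite big_ord_recr/= IH ltNge tauN addr0.
by right; case: H => // ->.
Qed.

End gauss_generator.

Lemma normr_Rintegral_le (R : realType) (dd : measure_display)
    (T : measurableType dd) (mu : {measure set T -> \bar R}) (D : set T)
    (f : T -> R) (M : R) : measurable D -> (mu D < +oo)%E ->
  measurable_fun D f -> (forall x, D x -> `|f x| <= M) ->
  `|\int[mu]_(x in D) f x| <= M * fine (mu D).
Proof.
move=> mD muD mf fM; have fi := bounded_integrable mD muD mf fM.
rewrite (le_trans (le_normr_Rintegral _ _))// -Rintegral_cst//.
apply: le_Rintegral => //; first exact: integrable_norm.
by apply: (@bounded_integrable _ _ _ _ _ _ _ _ `|M|).
Qed.

Section dynkin.
Context {R : realType} {dd : measure_display} {Om : measurableType dd}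
  (P : probability Om R) {d : nat} (W : R -> Om -> 'rV[R]_d).
Hypothesis hW : brownian_motion P W.
Variables (x : 'rV[R]_d) (s : R).
Hypothesis s0 : 0 < s.
Notation q := (sqdist W x).
Notation T := (bm_exit W x s).
Notation leb := (@lebesgue_measure R).

Let P1 : (P setT < +oo)%E.
Proof. by rewrite probability_setT ltry. Qed.

Definition exit_cap (t0 : R) (w : Om) : R := fine (Order.min (T w) t0%:E).

Lemma bm_exit_ge0 w : (0%:E <= T w)%E.
Proof. by apply: le_ereal_inf_tmp => _ [r [r0 _] <-]; rewrite lee_fin. Qed.

Lemma exit_cap_bounds t0 w : 0 <= t0 -> 0 <= exit_cap t0 w <= t0.
Proof.
move=> t00; rewrite /exit_cap; have := bm_exit_ge0 w.
case: (T w) => [r| |] //=; last by move=> _; rewrite /Order.min/= t00 lexx.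
rewrite lee_fin => r0; rewrite -EFin_min /= le_min r0 t00/= ge_min lexx orbT.
by [].
Qed.

Lemma lt_exit_cap t0 w z : 0 <= t0 -> z < t0 -> (z < exit_cap t0 w) = (z%:E < T w)%E.
Proof.
move=> t00 zt; rewrite /exit_cap; have := bm_exit_ge0 w.
case: (T w) => [r| |] //=; last by move=> _; rewrite /Order.min/= zt ltry.
by rewrite -EFin_min /= lt_min zt andbT lte_fin.
Qed.

Variable lam : R.
Hypothesis l0 : 0 < lam.

Let F w t := expR (- (lam * q w t)).

Lemma continuous_expR_sqdist w : continuous (F w).
Proof.
move=> t; apply: continuous_comp; last exact: continuous_expR.
apply: cvgN; apply: cvgM; first exact: cvg_cst.
exact: (continuous_sqdist hW).
Qed.

Lemma F01 w t : 0 <= F w t <= 1.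
Proof.
rewrite /F expR_ge0/= -expR0 ler_expR oppr_le0 mulr_ge0 ?sqdist_ge0//.
exact: ltW.
Qed.

Let H w t := gauss_gen d lam (q w t).

Lemma continuous_gauss_gen : continuous (gauss_gen d lam : R -> R).
Proof.
move=> u; rewrite /gauss_gen; apply: cvgM.
  by apply: cvgB; [apply: cvgM; [exact: cvg_cst|exact: cvg_id]|exact: cvg_cst].
apply: continuous_comp; last exact: continuous_expR.
by apply: cvgN; apply: cvgM; [exact: cvg_cst|exact: cvg_id].
Qed.

Let cH w : continuous (H w).
Proof.
rewrite (_ : H w = gauss_gen d lam \o q w)// => t.
apply: continuous_comp; first exact: (@continuous_sqdist _ _ _ P d W hW x w t).
exact: continuous_gauss_gen.
Qed.

Lemma integral_primitive (h : R -> R) (t : R) : continuous h -> 0 <= t ->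
  exists I : R -> R, [/\ (forall u : R, 0 <= u -> is_derive u 1 I (h u)) &
    I t - I 0 = \int[leb]_(z in `]0, t]) h z].
Proof.
move=> ch t00.
have ih a b : leb.-integrable `[a, b] (EFin \o h).
  apply: continuous_compact_integrable; first exact: segment_compact.
  by apply: continuous_subspaceT.
(* The base point -1 makes 0 interior, so that the derivative at [u = 0] is two-sided. *)
exists (fun t => \int[leb]_(z in `[-1, t]) h z); split.
  move=> u u0.
  have [||] := @continuous_FTC1_closed R h (-1) u (u + 1) _ (ih _ _) _ (ch u).
  - by rewrite ltrDl.
  - by rewrite (lt_le_trans _ u0).
  - by move=> d1 d2; rewrite -d2 derive1E; exact/derivableP.
by rewrite Rintegral_itvB// bnd_simp// ?ltW//; lra.
Qed.

Lemma dynkin t0 : 0 < t0 ->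
  \int[P]_w F w (exit_cap t0 w) - expR (- (lam * sqn x)) =
  \int[P]_w \int[leb]_(z in `]0, exit_cap t0 w]) H w z.
Proof.
move=> t00.
have S0 : 0 <= s ^+ 2 by exact: sqr_ge0.
have [C C0 HC] := @gauss_step_bound R d lam (s ^+ 2) l0 S0.
have HB := @gauss_gen_bound R d lam (s ^+ 2) l0 S0.
set CH := 2 * lam ^+ 2 * s ^+ 2 + lam * d%:R in HB.
have tau_t w : 0 <= exit_cap t0 w <= t0 by apply: exit_cap_bounds; exact: ltW.
pose dl n : R := t0 / n.+1%:R.
have dl0 n : 0 < dl n by rewrite divr_gt0// ltr0n.
have dlk n k : (k < n.+1)%N -> dl n * k%:R < t0.
  by move=> kn; rewrite /dl mulrAC ltr_pdivrMr ?ltr0n// ltr_pM2l// ltr_nat.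
have dlk0 n k : 0 <= dl n * k%:R by rewrite mulr_ge0// ltW.
pose A n k := [set w | ((dl n * k%:R)%:E < T w)%E].
have mA n k : measurable (A n k) by exact: (measurable_bm_exit_gt hW).
have AE n k w (X : R) : (k < n.+1)%N -> (if dl n * k%:R < exit_cap t0 w then X else 0) = \1_(A n k) w * X.
  move=> kn; rewrite lt_exit_cap ?dlk// ?ltW// indicE.
  have [h|h] := boolP ((dl n * k%:R)%:E < T w)%E; first by rewrite mem_set// mul1r.
  by rewrite memNset ?mul0r//; exact/negP.
(* [Sn] telescopes along each path and [Rn] is the Riemann sum of the generator. Both involve only
   the events that the exit has not happened at the left end of a step, to which [stopped_step]
   applies. *)
pose Sn n w := \sum_(k < n.+1) (if dl n * k%:R < exit_cap t0 w then
   F w (dl n * k.+1%:R) - F w (dl n * k%:R) else 0).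
pose Rn n w := \sum_(k < n.+1) (if dl n * k%:R < exit_cap t0 w then
   dl n * H w (dl n * k%:R) else 0).
have mF t : measurable_fun setT (F ^~ t).
  apply: measurableT_comp => //; apply: measurableT_comp => //.
  by apply: measurable_funM => //; exact: (measurable_sqdist hW).
have mH t : measurable_fun setT (H ^~ t).
  rewrite (_ : H ^~ t = gauss_gen d lam \o q ^~ t)//.
  apply: measurableT_comp; last exact: (measurable_sqdist hW).
  by apply: continuous_measurable_fun; exact: continuous_gauss_gen.
have mSn n : measurable_fun setT (Sn n).
  rewrite (_ : Sn n = fun w => \sum_(k < n.+1) \1_(A n k) w * (F w (dl n * k.+1%:R) - F w (dl n * k%:R))).
    by apply: measurable_sum => k; apply: measurable_funM; [exact: measurable_indic|exact: measurable_funB].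
  by apply/funext => w; apply: eq_bigr => k _; rewrite AE.
have mRn n : measurable_fun setT (Rn n).
  rewrite (_ : Rn n = fun w => \sum_(k < n.+1) \1_(A n k) w * (dl n * H w (dl n * k%:R))).
    by apply: measurable_sum => k; apply: measurable_funM; [exact: measurable_indic|exact: measurable_funM].
  by apply/funext => w; apply: eq_bigr => k _; rewrite AE.
have SnB n w : `|Sn n w| <= 1.
  rewrite /Sn; have [K ->] := step_sum_telescope (F w) (exit_cap t0 w) (dl0 n) n.+1.
  have := F01 w (dl n * K%:R); have := F01 w 0 => /andP[? ?] /andP[? ?].
  rewrite ler_norml; apply/andP; split; lra.
have HA n k w : A n k w -> `|H w (dl n * k%:R)| <= CH.
  move=> /(bm_exit_gtP hW x s0 _ (dlk0 n k)) h; apply: HB; rewrite sqdist_ge0/= ltW// h//.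
  by rewrite dlk0 lexx.
have RnB n w : `|Rn n w| <= t0 * CH.
  rewrite (le_trans (ler_norm_sum _ _ _))//.
  rewrite (_ : t0 * CH = \sum_(k < n.+1) (dl n * CH)); last first.
    by rewrite sumr_const card_ord -[RHS]mulr_natr mulrAC divfK ?pnatr_eq0.
  apply: ler_sum => k _; case: ifPn => h; last first.
    by rewrite normr0 mulr_ge0 ?(ltW (dl0 _))// addr_ge0 ?mulr_ge0 ?sqr_ge0// ltW.
  rewrite normrM ger0_norm ?ler_wpM2l ?(ltW (dl0 _))//.
  by apply: HA; rewrite /A/= -(lt_exit_cap w (ltW t00) (dlk n k (ltn_ord k))).
have cS : \int[P]_w Sn n w @[n --> \oo] --> \int[P]_w (F w (exit_cap t0 w) - F w 0).
  apply: (cvg_bounded_Rintegral measurableT P1 (C := 1)) => //.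
  move=> w _; apply: cvg_step_sum => //; exact: continuous_expR_sqdist.
have cR : \int[P]_w Rn n w @[n --> \oo] --> \int[P]_w \int[leb]_(z in `]0, exit_cap t0 w]) H w z.
  apply: (cvg_bounded_Rintegral measurableT P1 (C := t0 * CH)) => //.
  move=> w _.
  have [I [dI <-]] := integral_primitive (@cH w) (proj1 (andP (tau_t w))).
  exact: cvg_riemann_sum.
have iA n k (f : Om -> R) M : measurable_fun setT f -> (forall w, A n k w -> `|f w| <= M) ->
    P.-integrable setT (EFin \o (fun w => \1_(A n k) w * f w)).
  move=> mf fM; apply: (bounded_integrable measurableT P1 (C := `|M|)).
    by apply: measurable_funM => //; exact: measurable_indic.
  move=> w _; have [wA|wA] := pselect (A n k w).
    by rewrite indicE mem_set// mul1r (le_trans (fM _ wA))// ler_norm.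
  by rewrite indicE memNset// mul0r normr0.
have sumE n (f : nat -> Om -> R) M : (forall k, measurable_fun setT (f k)) ->
    (forall k w, A n k w -> `|f k w| <= M) -> forall N,
    P.-integrable setT (EFin \o (fun w => \sum_(k < N) \1_(A n k) w * f k w)) /\
    \int[P]_w (\sum_(k < N) \1_(A n k) w * f k w) = \sum_(k < N) \int[P]_w (\1_(A n k) w * f k w).
  move=> mf fM; elim=> [|N [IH1 IH2]].
    rewrite big_ord0 (_ : (fun w => _) = cst 0).
      split; first by apply: (bounded_integrable measurableT P1 (C := 0)) => // w _; rewrite normr0.
      by rewrite Rintegral_cst// mul0r.
    by apply/funext => w; rewrite big_ord0.
  rewrite big_ord_recr/= -IH2 -RintegralD//; last exact: iA (fM N).
  rewrite (_ : (fun w => \sum_(k < N.+1) _) =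
     (fun w => \sum_(k < N) \1_(A n k) w * f k w + \1_(A n N) w * f N w)).
    split => //.
    have := integrableD measurableT IH1 (iA n N _ _ (mf N) (fM N)).
    by apply: eq_integrable => // w _; rewrite /= EFinD.
  by apply/funext => w; rewrite big_ord_recr.
have IS n : \int[P]_w Sn n w = \sum_(k < n.+1) \int[P]_w (\1_(A n k) w * (F w (dl n * k.+1%:R) - F w (dl n * k%:R))).
  have := (sumE n (fun k w => F w (dl n * k.+1%:R) - F w (dl n * k%:R)) 1 _ _ n.+1).2.
  move=> <-//.
  - by apply: eq_Rintegral => w _; apply: eq_bigr => k _; rewrite AE.
  - by move=> k; exact: measurable_funB.
  - move=> k w _; have := F01 w (dl n * k%:R); have := F01 w (dl n * k.+1%:R) => /andP[? ?] /andP[? ?].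
    by rewrite ler_norml; apply/andP; split; lra.
have IR n : \int[P]_w Rn n w = \sum_(k < n.+1) \int[P]_w (\1_(A n k) w * (dl n * H w (dl n * k%:R))).
  have := (sumE n (fun k w => dl n * H w (dl n * k%:R)) (dl n * CH) _ _ n.+1).2.
  move=> <-//.
  - by apply: eq_Rintegral => w _; apply: eq_bigr => k _; rewrite AE.
  - by move=> k; exact: measurable_funM.
  - by move=> k w wA; rewrite normrM ger0_norm ?(ltW (dl0 _))// ler_wpM2l ?(ltW (dl0 _))// HA.
(* On [A n k], [stopped_step] replaces the next value of the test function by [G], whose expansion
   has error [C * dl n ^+ 2]. There are [n.+1] steps, so the total is of order 1 / n. *)
have dif n : dl n <= 1 -> `|\int[P]_w Rn n w - \int[P]_w Sn n w| <= n.+1%:R * (C * dl n ^+ 2).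
  move=> dl1; rewrite IS IR -sumrB (le_trans (ler_norm_sum _ _ _))//.
  rewrite (_ : n.+1%:R * _ = \sum_(k < n.+1) C * dl n ^+ 2); last first.
    by rewrite sumr_const card_ord -[RHS]mulr_natl.
  apply: ler_sum => k _.
  pose b2 := (1 + 2 * lam * dl n)^-1.
  pose G w := Num.sqrt b2 ^+ d * expR (- (lam * b2 * q w (dl n * k%:R))).
  have mG : measurable_fun setT G.
    apply: measurable_funM => //; apply: measurableT_comp => //; apply: measurableT_comp => //.
    by apply: measurable_funM => //; exact: (measurable_sqdist hW).
  have GC w : A n k w -> `|G w - F w (dl n * k%:R) - dl n * H w (dl n * k%:R)| <= C * dl n ^+ 2.
    move=> /(bm_exit_gtP hW x s0 _ (dlk0 n k)) h.
    apply: HC; rewrite ?dl0 ?dl1//; rewrite sqdist_ge0/= ltW// h//.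
    by rewrite dlk0 lexx.
  have GB w : A n k w -> `|G w| <= C * dl n ^+ 2 + 1 + dl n * CH.
    move=> wA; rewrite (_ : G w = (G w - F w (dl n * k%:R) - dl n * H w (dl n * k%:R)) + F w (dl n * k%:R) + dl n * H w (dl n * k%:R)); last by ring.
    rewrite (le_trans (ler_normD _ _))// lerD//.
      rewrite (le_trans (ler_normD _ _))// lerD ?GC//.
      by have /andP[? ?] := F01 w (dl n * k%:R); rewrite ger0_norm.
    by rewrite normrM ger0_norm ?(ltW (dl0 _))// ler_wpM2l ?(ltW (dl0 _))// HA.
  have FB j w : A n k w -> `|F w (dl n * j)| <= 1.
    by move=> _; have /andP[? ?] := F01 w (dl n * j); rewrite ger0_norm.
  have HB' w : A n k w -> `|dl n * H w (dl n * k%:R)| <= dl n * CH.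
    by move=> wA; rewrite normrM ger0_norm ?(ltW (dl0 _))// ler_wpM2l ?(ltW (dl0 _))// HA.
  have mB (f g : Om -> R) : (fun w => \1_(A n k) w * (f w - g w)) = (fun w => \1_(A n k) w * f w - \1_(A n k) w * g w).
    by apply/funext => w; rewrite mulrBr.
  have e1 : \int[P]_w (\1_(A n k) w * (F w (dl n * k.+1%:R) - F w (dl n * k%:R))) =
      \int[P]_w (\1_(A n k) w * (G w - F w (dl n * k%:R))).
    rewrite !mB !RintegralB//; try (by apply: iA (FB _)); last exact: iA GB.
    congr (_ - _); rewrite -(stopped_step hW x s0 l0 (dlk0 n k) (dl0 n)).
    by apply: eq_Rintegral => w _; rewrite /F -natr1 mulrDr mulr1.
  rewrite e1 distrC -RintegralB//; last 2 first.
  - by apply: (iA n k _ (C * dl n ^+ 2 + 1 + dl n * CH + 1)); [exact: measurable_funB|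
      move=> w wA; rewrite (le_trans (ler_normB _ _))// lerD ?GB ?FB].
  - by apply: iA HB'; exact: measurable_funM.
  rewrite (_ : C * dl n ^+ 2 = C * dl n ^+ 2 * fine (P setT)); last first.
    by rewrite probability_setT mulr1.
  apply: normr_Rintegral_le => //.
    by apply: measurable_funB; apply: measurable_funM;
      [exact: measurable_indic|exact: measurable_funB|exact: measurable_indic|exact: measurable_funM].
  move=> w _; rewrite -mulrBr; have [wA|wA] := pselect (A n k w).
    by rewrite indicE mem_set// mul1r GC.
  by rewrite indicE memNset// mul0r normr0 mulr_ge0// sqr_ge0.
have E : \int[P]_w (F w (exit_cap t0 w) - F w 0) = \int[P]_w \int[leb]_(z in `]0, exit_cap t0 w]) H w z.
  apply/esym; apply: (cvg_unique _ cR) => //; apply: cvg_sub0 cS.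
  apply/cvgrPdist_le => e e0; near=> n; rewrite sub0r normrN fctE.
  have n1 : t0 <= n.+1%:R.
    rewrite (le_trans (y := n%:R))// ?ler_nat//; near: n; exact: nbhs_infty_ger.
  have n2 : C * t0 ^+ 2 / e <= n.+1%:R.
    rewrite (le_trans (y := n%:R))// ?ler_nat//; near: n; exact: nbhs_infty_ger.
  rewrite (le_trans (dif _ _))//; first by rewrite ler_pdivrMr ?ltr0n// mul1r.
  rewrite ler_pdivrMr// in n2.
  rewrite (_ : n.+1%:R * _ = C * t0 ^+ 2 / n.+1%:R); last first.
    have N0 : n.+1%:R != 0 :> R by rewrite pnatr_eq0.
    by rewrite /dl; move: (n.+1%:R : R) N0 => N N0; field.
  by rewrite ler_pdivrMr ?ltr0n// [e * _]mulrC.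
have mFt : measurable_fun setT (fun w => F w (exit_cap t0 w)).
  rewrite (_ : (fun w => _) = (fun w => F w (exit_cap t0 w) - F w 0 + F w 0)); last first.
    by apply/funext => w; rewrite subrK.
  apply: measurable_funD => //.
  apply: (measurable_fun_cvg (h := Sn)) => // w _.
  by apply: cvg_step_sum => //; exact: continuous_expR_sqdist.
rewrite -E RintegralB//.
- congr (_ - _); rewrite (_ : (fun w => F w 0) = (fun=> expR (- (lam * sqn x)))) ?Rintegral_cst//.
    by have := probability_setT P => /(congr1 fine)/= ->; rewrite mulr1.
  by apply/funext => w; rewrite /F sqdistE// (bm_start hW) addr0.
- apply: (bounded_integrable measurableT P1 (C := 1)) => // w _.
  by have /andP[? ?] := F01 w (exit_cap t0 w); rewrite ger0_norm.
- apply: (bounded_integrable measurableT P1 (C := 1)) => // w _.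
  by have /andP[? ?] := F01 w 0; rewrite ger0_norm.
Unshelve. all: by end_near. Qed.

End dynkin.

(** * Iterated integrals over sections, and the occupation measure of the ball *)

Section fubini_sections.
Context {R : realType} {d1 d2 : measure_display} {T1 : measurableType d1}
  {T2 : measurableType d2} (m1 : {sigma_finite_measure set T1 -> \bar R})
  (m2 : {sigma_finite_measure set T2 -> \bar R}).
Variables (E : set (T1 * T2)) (mE : measurable E).

Let sectionE (f : T1 * T2 -> \bar R) w :
  fubini_F m2 (f \_ E) w = (\int[m2]_(z in xsection E w) f (w, z))%E.
Proof.
rewrite /fubini_F [RHS]integral_mkcond; apply: eq_integral => z _.
by rewrite !patchE mem_xsection.
Qed.

(** The exit equation integrates over a time set that depends on the path. That set is a section of
    one measurable set of pairs, which turns the iterated integral into an integral for the product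
    measure. *)
Lemma integral_xsection (f : T1 * T2 -> \bar R) :
  (m1 \x m2)%E.-integrable E f ->
  (\int[m1]_w \int[m2]_(z in xsection E w) f (w, z) =
   \int[(m1 \x m2)%E]_(u in E) f u)%E.
Proof.
move=> fi; rewrite [RHS]integral_mkcond -integral12_prod_meas1; last first.
  by apply/(integrable_mkcond f mE).
by apply: eq_integral => w _; rewrite sectionE.
Qed.

Lemma ge0_integral_xsection (f : T1 * T2 -> \bar R) :
  measurable_fun E f -> (forall u, E u -> 0 <= f u)%E ->
  (\int[m1]_w \int[m2]_(z in xsection E w) f (w, z) =
   \int[(m1 \x m2)%E]_(u in E) f u)%E.
Proof.
move=> mf f0; rewrite [RHS]integral_mkcond fubini_tonelli1; last 2 first.
- exact/(measurable_restrictT f mE).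
- by move=> u; rewrite patchE; case: ifPn => // /set_mem/f0.
by apply: eq_integral => w _; rewrite sectionE.
Qed.

Lemma measurable_ge0_integral_xsection (f : T1 * T2 -> \bar R) :
  measurable_fun E f -> (forall u, E u -> 0 <= f u)%E ->
  measurable_fun setT (fun w => \int[m2]_(z in xsection E w) f (w, z))%E.
Proof.
move=> mf f0; have := @measurable_fun_fubini_tonelli_F _ _ _ _ R m2 (f \_ E).
rewrite (_ : fubini_F m2 (f \_ E) = (fun w => \int[m2]_(z in xsection E w) f (w, z))%E).
  apply; first exact/(measurable_restrictT f mE).
  by move=> u; rewrite patchE; case: ifPn => // /set_mem/f0.
by apply/funext => w; rewrite sectionE.
Qed.

End fubini_sections.

Section occupation.
Context {R : realType} {dd : measure_display} {Om : measurableType dd}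
  (P : probability Om R) {d : nat} (W : R -> Om -> 'rV[R]_d).
Hypothesis hW : brownian_motion P W.
Variables (x : 'rV[R]_d) (s : R).
Hypothesis s0 : 0 < s.
Notation q := (sqdist W x).
Notation T := (bm_exit W x s).
Notation leb := (@lebesgue_measure R).
Notation PL := (P \x leb)%E.

Let T2 := (Om * measurableTypeR R)%type.

Lemma measurable_bm_exit : measurable_fun setT T.
Proof.
move=> _; suff : preimage_set_system setT T (@ErealGenOInfty.G R) `<=` @measurable _ Om.
  by move=> H; apply: (measurability _ (ErealGenOInfty.measurableE R)).
move=> _ [_ [r ->] <-]; rewrite setTI.
have [r0|r0] := leP 0 r.
  rewrite (_ : _ @^-1` _ = [set w | (r%:E < T w)%E]); first exact: (measurable_bm_exit_gt hW).
  by apply/seteqP; split => w /=; rewrite in_itv/= andbT.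
rewrite (_ : _ @^-1` _ = setT)//; apply/seteqP; split => w //= _.
by rewrite in_itv/= andbT (lt_le_trans _ (bm_exit_ge0 W x s w))// lte_fin.
Qed.

(** Joint measurability from path continuity: rounding time down to multiples of 1 / n.+1 gives
    functions that are measurable piece by piece and converge pointwise. *)
Lemma measurable_sqdist2 : measurable_fun setT (fun u : T2 => q u.1 u.2).
Proof.
pose X n (u : T2) := q u.1 ((Num.floor (n.+1%:R * u.2 : R))%:~R / n.+1%:R).
apply: (measurable_fun_cvg (h := X)); last first.
  move=> [w z] _ /=.
  have := @continuous_sqdist _ _ _ P d W hW x w z.
  apply: cvg_comp; apply/cvgrPdist_le => e e0; near=> n.
  have n0 : 0 < n.+1%:R :> R by rewrite ltr0n.
  have /andP[h1 h2] := floor_itv (n.+1%:R * z : R).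
  have h3 : (Num.floor (n.+1%:R * z : R))%:~R / n.+1%:R <= z.
    by rewrite ler_pdivrMr// [leRHS]mulrC.
  rewrite /= ger0_norm ?subr_ge0//.
  have h4 : z < (Num.floor (n.+1%:R * z : R))%:~R / n.+1%:R + n.+1%:R^-1.
    by move: h2; rewrite mulrC intrD -ltr_pdivlMr// mulrDl mul1r.
  rewrite lerBlDl (le_trans (ltW h4))// lerD2l.
  rewrite -[leRHS]invrK lef_pV2 ?posrE ?invr_gt0//.
  rewrite (le_trans (y := n%:R))// ?ler_nat//; near: n; exact: nbhs_infty_ger.
move=> n _ A mA; rewrite setTI.
have n0 : 0 < n.+1%:R :> R by rewrite ltr0n.
rewrite (_ : X n @^-1` A = \bigcup_(k in [set: int])
   (((q ^~ (k%:~R / n.+1%:R)) @^-1` A) `*`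
   [set` `[k%:~R / n.+1%:R, (k + 1)%:~R / n.+1%:R[])).
  apply: countable_bigcupT_measurable => // k; apply: measurableX.
    by rewrite -[X in measurable X]setTI; exact: (measurable_sqdist hW).
  exact: measurable_itv.
apply/seteqP; split => -[w z]; rewrite /X/=.
  move=> AX; exists (Num.floor (n.+1%:R * z : R)) => //; split => //=.
  by rewrite in_itv/= ler_pdivrMr// ltr_pdivlMr// ![z * _]mulrC floor_itv.
move=> [k _ [/= Aq]]; rewrite in_itv/= ler_pdivrMr// ltr_pdivlMr// ![z * _]mulrC.
by move=> /floor_def ->.
Unshelve. all: by end_near. Qed.

Definition occ_set : set T2 := [set u | (0 <= u.2 :> R) /\ ((u.2 : R)%:E < T u.1)%E].

Lemma measurable_occ_set : measurable occ_set.
Proof.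
rewrite (_ : occ_set = (setT `*` `[0, +oo[%classic) `&`
  (setT `&` [set u : T2 | (((u.2 : R)%:E) < T u.1)%E])); last first.
  apply/seteqP; split => -[w z] /=; first by move=> [h1 h2]; rewrite in_itv/= andbT h1.
  by move=> [[_]]; rewrite in_itv/= andbT => ? [].
apply: measurableI; first by apply: measurableX => //; exact: measurable_itv.
apply: measurable_lte => //.
- apply/measurable_EFinP; exact: measurable_snd.
- apply: measurableT_comp; [exact: measurable_bm_exit|exact: measurable_fst].
Qed.

Definition occ_cap (t : R) : set T2 := occ_set `&` (setT `*` `]-oo, t]%classic).

Lemma measurable_occ_cap t : measurable (occ_cap t).
Proof.
apply: measurableI; first exact: measurable_occ_set.
by apply: measurableX => //; exact: measurable_itv.
Qed.

Lemma occ_set_sqdist u : occ_set u -> 0 <= q u.1 u.2 < s ^+ 2.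
Proof.
move=> [u0 uT]; rewrite sqdist_ge0/=.
by move/(bm_exit_gtP hW x s0 _ u0) : uT; apply; rewrite u0 lexx.
Qed.

Lemma xsection_occ_set w : xsection occ_set w = [set z | (0 <= z)%R /\ (z%:E < T w)%E].
Proof. by apply/seteqP; split => z; rewrite /xsection/= in_setE. Qed.

(** The section is a closed interval or, when the exit comes first, a half-open one; the end points
    that differ are negligible. *)
Lemma integral_occ_cap t w (f : R -> \bar R) : 0 <= t -> measurable_fun setT f ->
  (\int[leb]_(z in xsection (occ_cap t) w) f z =
   \int[leb]_(z in `]0%R, exit_cap W x s t w]) f z)%E.
Proof.
move=> t0 mf.
have fS (A : set R) : measurable_fun A f by exact: measurable_funTS.
rewrite integral_itv_obnd_cbnd//.
have [tT|Tt] := ltP t%:E (T w).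
  have -> : exit_cap W x s t w = t.
    by rewrite /exit_cap; move/ltW/min_idPr : tT => ->.
  congr (integral _ _ _); apply/seteqP; split => z; rewrite /xsection/= in_setE/= in_itv/=.
    by move=> [[/= z0 zT] [_ /=]]; rewrite in_itv/= => ->; rewrite z0.
  move=> /andP[z0 zt]; split; last by split => //=; rewrite in_itv.
  by split => //=; rewrite (le_lt_trans _ tT)// lee_fin.
have -> : exit_cap W x s t w = fine (T w).
  by rewrite /exit_cap; move/min_idPl : (Tt) => ->.
have TE : (fine (T w))%:E = T w.
  rewrite fineK// ge0_fin_numE ?(bm_exit_ge0)//.
  by rewrite (le_lt_trans Tt)// ltry.
rewrite -integral_itv_bndo_bndc//.
congr (integral _ _ _); apply/seteqP; split => z; rewrite /xsection/= in_setE/= in_itv/=.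
  by move=> [[/= z0 zT] _]; rewrite z0/= -lte_fin TE.
move=> /andP[z0]; rewrite -lte_fin TE => zT; split; first by split.
by split => //=; rewrite in_itv/= -lee_fin (le_trans (ltW zT)).
Qed.


Lemma PL_occ_cap t : 0 <= t ->
  PL (occ_cap t) = (\int[P]_w (exit_cap W x s t w)%:E)%E.
Proof.
move=> t0; rewrite -[LHS]mul1e -integral_cst; last exact: measurable_occ_cap.
rewrite -ge0_integral_xsection//; last exact: measurable_occ_cap.
apply: eq_integral => w _; rewrite (integral_occ_cap w t0 (f := cst 1%E))//.
transitivity (leb `]0%R, exit_cap W x s t w]%classic).
  by rewrite integral_cst// mul1e.
apply: etrans (lebesgue_measure_itv _) _; rewrite /= lte_fin.
have /andP[c0 _] := exit_cap_bounds W x s w t0.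
by move: c0; rewrite le_eqVlt => /predU1P[<-|->]; rewrite ?ltxx//= oppr0 adde0.
Qed.

Lemma measurable_exit_cap t : measurable_fun setT (exit_cap W x s t).
Proof.
apply: measurableT_comp => //.
by apply: measurable_mine => //; exact: measurable_bm_exit.
Qed.

Lemma measurable_sqdist_cap t : measurable_fun setT (fun w => q w (exit_cap W x s t w)).
Proof.
pose pr (w : Om) : T2 := (w, exit_cap W x s t w).
have mpr : measurable_fun setT pr.
  by apply: measurable_fun_pair => //; exact: measurable_exit_cap.
exact: (measurableT_comp (f := fun u : T2 => q u.1 u.2) (g := pr) measurable_sqdist2 mpr).
Qed.

Lemma PL_occ_cap_lty t : 0 <= t -> (PL (occ_cap t) < +oo)%E.
Proof.
move=> t0; rewrite PL_occ_cap//.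
have : P.-integrable setT (EFin \o exit_cap W x s t).
  have P1 : (P setT < +oo)%E by rewrite probability_setT ltry.
  apply: (bounded_integrable measurableT P1 (C := t)) => //.
  - exact: measurable_exit_cap.
  - by move=> w _; have /andP[c0 ct] := exit_cap_bounds W x s w t0; rewrite ger0_norm.
move=> /integrableP[_]; apply: le_lt_trans; rewrite le_eqVlt; apply/orP; left.
apply/eqP; apply: eq_integral => w _ /=.
by have /andP[c0 ct] := exit_cap_bounds W x s w t0; rewrite ger0_norm.
Qed.

Lemma measurable_gauss_gen_sqdist (lam : R) (E : set T2) :
  measurable_fun E (fun u : T2 => gauss_gen d lam (q u.1 u.2)).
Proof.
apply: (@measurable_funTS _ _ T2 R).
apply: measurableT_comp; last exact: measurable_sqdist2.
by apply: continuous_measurable_fun; exact: continuous_gauss_gen.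
Qed.

Lemma dynkin_occ_cap (lam t : R) : 0 < lam -> 0 < t ->
  \int[PL]_(u in occ_cap t) gauss_gen d lam (q u.1 u.2) =
  \int[P]_w expR (- (lam * q w (exit_cap W x s t w))) - expR (- (lam * sqn x)).
Proof.
move=> l0 t0; rewrite (dynkin hW x s0 l0 t0).
have B := @gauss_gen_bound R d lam (s ^+ 2) l0 (sqr_ge0 _).
rewrite /Rintegral -integral_xsection; last 2 first.
- exact: measurable_occ_cap.
- apply: (bounded_integrable _ _ (C := 2 * lam ^+ 2 * s ^+ 2 + lam * d%:R)).
  + exact: measurable_occ_cap.
  + exact: PL_occ_cap_lty (ltW t0).
  + exact: measurable_gauss_gen_sqdist.
  + by move=> u [/occ_set_sqdist /andP[h1 h2] _]; apply: B; rewrite h1 ltW.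
congr fine; apply: eq_integral => w _ /=.
have mh : measurable_fun setT (fun z => (gauss_gen d lam (q w z))%:E).
  apply/measurable_EFinP; apply: measurableT_comp.
    by apply: continuous_measurable_fun; exact: continuous_gauss_gen.
  apply: continuous_measurable_fun; exact: (continuous_sqdist hW).
rewrite (integral_occ_cap w (ltW t0) mh) fineK//.
apply: integrable_fin_num => //.
have ch : continuous (fun z => gauss_gen d lam (q w z)).
  move=> z; apply: (@continuous_comp R R R (q w) (gauss_gen d lam)).
    exact: (continuous_sqdist hW).
  exact: continuous_gauss_gen.
have H : leb.-integrable `[0, exit_cap W x s t w] (EFin \o (fun z => gauss_gen d lam (q w z))).
  apply: continuous_compact_integrable; first exact: segment_compact.
  exact: continuous_subspaceT.
by apply: integrableS H => //; apply: subset_itvr; rewrite bnd_simp.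
Qed.

Hypothesis d0 : (0 < d)%N.

(** A bound on the expected exit time capped at [t], uniform in [t]: some Gaussian has a generator
    bounded away from 0 on the whole ball. *)
Lemma occ_cap_bound : exists2 M : R, 0 < M & forall t, 0 < t -> (PL (occ_cap t) <= M%:E)%E.
Proof.
have dR : 0 < d%:R :> R by rewrite ltr0n.
have s2 : 0 < s ^+ 2 by rewrite exprn_gt0.
(* With this [lam], [2 * lam * q] is at most [d / 2] on the ball, so that [- gauss_gen] is at least
   [c] there and Dynkin's formula bounds [c] times the mass by 1. *)
pose lam := d%:R / (4 * s ^+ 2).
have l0 : 0 < lam by rewrite divr_gt0// mulr_gt0.
pose c := lam * d%:R / 2 * expR (- (lam * s ^+ 2)).
have c0 : 0 < c by rewrite mulr_gt0 ?expR_gt0// divr_gt0// mulr_gt0.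
exists c^-1 => [|t t0]; first by rewrite invr_gt0.
have ft := PL_occ_cap_lty (ltW t0).
have mt := measurable_occ_cap t.
have Hc u : occ_cap t u -> c <= - gauss_gen d lam (q u.1 u.2).
  move=> [/occ_set_sqdist /andP[h1 h2] _]; rewrite /gauss_gen -mulNr /c.
  have e1 : 2 * lam * q u.1 u.2 <= d%:R / 2.
    have -> : d%:R / 2 = 2 * lam * s ^+ 2 by rewrite /lam; field; rewrite gt_eqF.
    by rewrite ler_wpM2l ?(ltW h2)// mulr_ge0// ltW.
  have e2 : lam * d%:R / 2 <= - (2 * lam ^+ 2 * q u.1 u.2 - lam * d%:R) by nra.
  have e3 : expR (- (lam * s ^+ 2)) <= expR (- (lam * q u.1 u.2)).
    by rewrite ler_expR lerN2 ler_wpM2l ?ltW.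
  by apply: ler_pM => //; rewrite ?expR_ge0// divr_ge0// mulr_ge0// ltW.
have := dynkin_occ_cap l0 t0.
have B := @gauss_gen_bound R d lam (s ^+ 2) l0 (ltW s2).
have gi : PL.-integrable (occ_cap t) (EFin \o (fun u : T2 => gauss_gen d lam (q u.1 u.2))).
  apply: (bounded_integrable mt ft (C := 2 * lam ^+ 2 * s ^+ 2 + lam * d%:R)).
    exact: measurable_gauss_gen_sqdist.
  by move=> u [/occ_set_sqdist /andP[h1 h2] _]; apply: B; rewrite h1 ltW.
have ci : PL.-integrable (occ_cap t) (EFin \o (fun=> c)).
  by apply: (bounded_integrable mt ft (C := `|c|)).
have h1 : c * fine (PL (occ_cap t)) <= - \int[PL]_(u in occ_cap t) gauss_gen d lam (q u.1 u.2).
  rewrite -Rintegral_cst// -mulN1r -RintegralZl//.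
  apply: le_Rintegral => //.
    rewrite (_ : EFin \o _ = (fun u => (-1)%:E * (gauss_gen d lam (q u.1 u.2))%:E)%E).
      exact: integrableZl.
    by apply/funext => u /=; rewrite -EFinM.
  by move=> u /Hc; rewrite mulN1r.
have h2 : 0 <= \int[P]_w expR (- (lam * q w (exit_cap W x s t w))).
  by apply: Rintegral_ge0 => w _; exact: expR_ge0.
have h3 : expR (- (lam * sqn x)) <= 1.
  by rewrite -expR0 ler_expR oppr_le0 mulr_ge0 ?sqn_ge0// ltW.
move=> E; rewrite E in h1.
have : c * fine (PL (occ_cap t)) <= 1 by lra.
rewrite -ler_pdivlMl// mulr1 -lee_fin fineK// ge0_fin_numE//.
Qed.

Lemma PL_occ_set_lty : (PL occ_set < +oo)%E.
Proof.
have [M M0 HM] := occ_cap_bound.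
apply: (@le_lt_trans _ _ M%:E); last by rewrite ltry.
have U : occ_set = \bigcup_n occ_cap n.+1%:R.
  apply/seteqP; split => [u uo|u [n _ []]//].
  exists (Num.truncn (u.2 : R)) => //; split => //; split => //=.
  by rewrite in_itv/= ltW// truncnS_gt.
have nd : {homo (fun n => occ_cap n.+1%:R) : n m / (n <= m)%N >-> (n <= m)%O}.
  move=> n m nm; apply/subsetPset => u [uo [_ /=]]; rewrite in_itv/= => un.
  by split => //; split => //=; rewrite in_itv/= (le_trans un)// ler_nat.
have := @nondecreasing_cvg_mu _ _ _ PL (fun n => occ_cap n.+1%:R) _ _ nd.
rewrite -U => /(_ _ measurable_occ_set) H.
apply: (@cvge_to_le _ _ _ _ _ _ _ (H _)).
- by move=> n; exact: measurable_occ_cap.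
- by near=> n; apply: HM; rewrite ltr0n.
Unshelve. all: by end_near. Qed.


Let N := [set w | T w = +oo%E].

Let mN : measurable N.
Proof.
have H := measurable_bm_exit.
have : measurable (setT `&` T @^-1` [set +oo%E]) by exact: H.
by rewrite setTI.
Qed.

(** On this event the exit time capped at [n] equals [n], so [n] times its probability stays below
    the bound of [occ_cap_bound]. *)
Lemma bm_exit_finite : P [set w | T w = +oo%E] = 0%E.
Proof.
have [M M0 HM] := occ_cap_bound.
have H n : (0 < n)%N -> (n%:R%:E * P N <= M%:E)%E.
  move=> n0; have nR : 0 < n%:R :> R by rewrite ltr0n.
  apply: le_trans (HM _ nR); rewrite PL_occ_cap ?(ltW nR)// -integral_cst//.
  rewrite [X in (X <= _)%E]integral_mkcond; apply: ge0_le_integral => //=.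
  - by move=> w _; rewrite patchE; case: ifPn => //; rewrite lee_fin ltW.
  - by apply/(measurable_restrictT _ mN).
  - by apply/measurable_EFinP; exact: measurable_exit_cap.
  - move=> w _; rewrite patchE; case: ifPn => [/set_mem wN|_].
      by rewrite /exit_cap wN /Order.min/=.
    by rewrite lee_fin; have /andP[] := exit_cap_bounds W x s w (ltW nR).
have Pf : P N \is a fin_num by exact: fin_num_measure.
apply/eqP; rewrite eq_le measure_ge0 andbT leNgt; apply/negP => p0.
have p0' : 0 < fine (P N) by rewrite fine_gt0// p0 -ge0_fin_numE.
have [n Hn] : exists n : nat, M / fine (P N) < n.+1%:R.
  by exists (Num.truncn (M / fine (P N))); exact: truncnS_gt.
have := H n.+1 (ltn0Sn _); rewrite -(fineK Pf) -EFinM lee_fin leNgt => /negP; apply.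
by rewrite -ltr_pdivrMr.
Qed.

Hypothesis xs : sqn x < s ^+ 2.

Lemma sqdist_bm_exit w : ~ N w -> q w (fine (T w)) = s ^+ 2.
Proof.
move=> wN; have T0 := bm_exit_ge0 W x s w.
have Tf : T w \is a fin_num.
  by rewrite ge0_fin_numE// ltey; apply/eqP.
have TE : (fine (T w))%:E = T w by rewrite fineK.
have t0 : 0 <= fine (T w) by rewrite fine_ge0.
have below r : 0 <= r -> r < fine (T w) -> q w r < s ^+ 2.
  move=> r0; rewrite -lte_fin TE => /(bm_exit_gtP hW x s0 w r0); apply.
  by rewrite r0 lexx.
apply/eqP; rewrite eq_le; apply/andP; split; last first.
  rewrite leNgt; apply/negP => h.
  (* If the path were still strictly inside at the exit time, the exit time would exceed itself by
     [bm_exit_gtP]. *)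
  have : ((fine (T w))%:E < T w)%E.
    apply/(bm_exit_gtP hW x s0 w t0) => r /andP[r0].
    by rewrite le_eqVlt => /predU1P[->//|]; exact: below.
  by rewrite TE ltxx.
have [t00|tn0] := eqVneq (fine (T w)) 0.
  by rewrite t00 sqdistE// (bm_start hW) addr0 ltW.
have {tn0}t00 : 0 < fine (T w) by rewrite lt_neqAle eq_sym tn0.
have cq := @continuous_sqdist _ _ _ P d W hW x w (fine (T w)).
have : q w r @[r --> (fine (T w))^'-] --> q w (fine (T w)).
  exact: cvg_at_left_filter.
move=> /cvgr_to_le; apply.
near=> r; apply/ltW/below.
  by near: r; apply: nbhs_left_ge.
by near: r; exact: nbhs_left_lt.
Unshelve. all: by end_near. Qed.

Lemma exit_capE w t : (T w <= t%:E)%E -> exit_cap W x s t w = fine (T w).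
Proof. by rewrite /exit_cap => /min_idPl ->. Qed.

(** Dynkin's formula as the cap tends to infinity: the occupation measure is finite, and almost
    surely the capped exit time is eventually the exit time, where the squared distance is
    [s ^+ 2]. *)
Lemma occupation_gauss (lam : R) : 0 < lam ->
  \int[PL]_(u in occ_set) gauss_gen d lam (q u.1 u.2) =
  expR (- (lam * s ^+ 2)) - expR (- (lam * sqn x)).
Proof.
move=> l0; have mD := measurable_occ_set.
have B := @gauss_gen_bound R d lam (s ^+ 2) l0 (sqr_ge0 _).
set C := 2 * lam ^+ 2 * s ^+ 2 + lam * d%:R in B.
pose E n : set T2 := (setT `*` `]-oo, n.+1%:R]%classic).
have mE n : measurable (E n) by apply: measurableX => //; exact: measurable_itv.
have gB u : occ_set u -> `|gauss_gen d lam (q u.1 u.2)| <= C.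
  by move=> /occ_set_sqdist /andP[h1 h2]; apply: B; rewrite h1 ltW.
have C0 : 0 <= C by rewrite addr_ge0// !mulr_ge0// ?sqr_ge0// ltW.
have c1 : \int[PL]_(u in occ_cap n.+1%:R) gauss_gen d lam (q u.1 u.2) @[n --> \oo] -->
    \int[PL]_(u in occ_set) gauss_gen d lam (q u.1 u.2).
  under eq_fun do rewrite Rintegral_mkcondr.
  apply: (cvg_bounded_Rintegral mD PL_occ_set_lty (C := C)).
  - move=> n; apply: measurable_funTS; apply/(measurable_restrictT _ (mE n)).
    exact: measurable_gauss_gen_sqdist.
  - move=> n u Du; rewrite patchE; case: ifPn => _; first exact: gB.
    by rewrite normr0.
  - move=> u Du; apply: cvg_near_cst; near=> n.
    rewrite patchE mem_set//; split => //=; rewrite in_itv/=.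
    rewrite (le_trans (y := n%:R))// ?ler_nat//; near: n; exact: nbhs_infty_ger.
have c2 : \int[P]_(w in ~` N) expR (- (lam * q w (exit_cap W x s n.+1%:R w))) @[n --> \oo] -->
    \int[P]_(w in ~` N) expR (- (lam * s ^+ 2)).
  apply: (cvg_bounded_Rintegral _ _ (C := 1)).
  - exact: measurableC.
  - by rewrite (le_lt_trans (probability_le1 _ _)) ?ltry//; exact: measurableC.
  - move=> n; apply: measurable_funTS; apply: measurableT_comp => //; apply: measurableT_comp => //.
    by apply: measurable_funM => //; exact: measurable_sqdist_cap.
  - move=> n w _; rewrite ger0_norm ?expR_ge0// -expR0 ler_expR oppr_le0.
    by rewrite mulr_ge0 ?sqdist_ge0// ltW.
  - move=> w wN; apply: cvg_near_cst; near=> n.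
    rewrite exit_capE ?sqdist_bm_exit//.
    have Tf : T w \is a fin_num.
      by rewrite ge0_fin_numE ?bm_exit_ge0// ltey; apply/eqP.
    rewrite -(fineK Tf) lee_fin (le_trans (y := n%:R))// ?ler_nat//; near: n; exact: nbhs_infty_ger.
have PN : P (~` N) = 1%E by rewrite probability_setC// bm_exit_finite sube0.
rewrite Rintegral_cst in c2; last exact: measurableC.
rewrite [fine _](_ : _ = 1) ?mulr1 in c2; last exact: (congr1 fine PN).
have eN n : \int[P]_(w in ~` N) expR (- (lam * q w (exit_cap W x s n.+1%:R w))) =
   \int[P]_w expR (- (lam * q w (exit_cap W x s n.+1%:R w))).
  rewrite /Rintegral -setTD -negligible_integral//; last exact: bm_exit_finite.
  have P1 : (P setT < +oo)%E by rewrite probability_setT ltry.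
  apply: (bounded_integrable measurableT P1 (C := 1)).
    apply: measurableT_comp => //; apply: measurableT_comp => //.
    by apply: measurable_funM => //; exact: measurable_sqdist_cap.
  move=> w _; rewrite ger0_norm ?expR_ge0// -expR0 ler_expR oppr_le0.
  by rewrite mulr_ge0 ?sqdist_ge0// ltW.
apply: (cvg_unique _ c1) => //.
rewrite (_ : (fun n => _) = (fun n => \int[P]_(w in ~` N)
    expR (- (lam * q w (exit_cap W x s n.+1%:R w))) - expR (- (lam * sqn x)))).
  by apply: cvgB; [exact: c2|exact: cvg_cst].
by apply/funext => n; rewrite eN -dynkin_occ_cap// ltr0n.
Unshelve. all: by end_near. Qed.

End occupation.

(** * Determinacy by Gaussian test functions *)

Section weierstrass.
Context {R : realType}.

(** The absorption identity for binomial coefficients; it reduces each moment of the binomial law to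
    a lower one. *)
Lemma bernstein_shift (n : nat) (g : nat -> R) :
  \sum_(k < n.+2) k%:R * 'C(n.+1, k)%:R * g k =
  n.+1%:R * \sum_(k < n.+1) 'C(n, k)%:R * g k.+1.
Proof.
rewrite big_ord_recl/= !mul0r add0r mulr_sumr; apply: eq_bigr => k _.
rewrite /bump/= add1n mulrA; congr (_ * _).
by rewrite -!natrM -mul_bin_diag.
Qed.

Lemma bernstein_sum (n : nat) (y : R) :
  \sum_(k < n.+1) 'C(n, k)%:R * (y ^+ k * (1 - y) ^+ (n - k)) = 1.
Proof.
transitivity ((1 - y + y) ^+ n); last by rewrite subrK expr1n.
rewrite exprDn; apply: eq_bigr => k _; rewrite -[RHS]mulr_natl; congr (_ * _).
exact: mulrC.
Qed.

Lemma bernstein_mean (n : nat) (y : R) :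
  \sum_(k < n.+2) k%:R * 'C(n.+1, k)%:R * (y ^+ k * (1 - y) ^+ (n.+1 - k)) = n.+1%:R * y.
Proof.
rewrite (bernstein_shift n (fun k => y ^+ k * (1 - y) ^+ (n.+1 - k))).
congr (_ * _).
transitivity ((\sum_(k < n.+1) 'C(n, k)%:R * (y ^+ k * (1 - y) ^+ (n - k))) * y); last first.
  by rewrite bernstein_sum mul1r.
rewrite mulr_suml; by apply: eq_bigr => k _; rewrite subSS exprS; ring.
Qed.

Lemma bernstein_variance (n : nat) (y : R) :
  \sum_(k < n.+2) 'C(n.+1, k)%:R * (y ^+ k * (1 - y) ^+ (n.+1 - k)) *
    (k%:R - n.+1%:R * y) ^+ 2 = n.+1%:R * y * (1 - y).
Proof.
have m2 : \sum_(k < n.+2) k%:R * 'C(n.+1, k)%:R * (k%:R * (y ^+ k * (1 - y) ^+ (n.+1 - k)))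
    = n.+1%:R * y * (1 + n%:R * y).
  rewrite (bernstein_shift n (fun k => k%:R * (y ^+ k * (1 - y) ^+ (n.+1 - k)))).
  rewrite -mulrA; congr (_ * _).
  have e k : 'C(n, k)%:R * (k.+1%:R * (y ^+ k.+1 * (1 - y) ^+ (n.+1 - k.+1))) =
    y * ('C(n, k)%:R * (y ^+ k * (1 - y) ^+ (n - k))) +
    y * (k%:R * 'C(n, k)%:R * (y ^+ k * (1 - y) ^+ (n - k))).
    by rewrite subSS exprS -natr1; ring.
  rewrite (eq_bigr _ (fun (k : 'I_n.+1) _ => e k)) big_split/= -!mulr_sumr bernstein_sum -mulrDr.
  congr (_ * (_ + _)); case: n {e} => [|n]; last exact: bernstein_mean.
  by rewrite big_ord1 !mul0r.
have e k : 'C(n.+1, k)%:R * (y ^+ k * (1 - y) ^+ (n.+1 - k)) * (k%:R - n.+1%:R * y) ^+ 2 =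
  k%:R * 'C(n.+1, k)%:R * (k%:R * (y ^+ k * (1 - y) ^+ (n.+1 - k))) +
  ((- 2 * n.+1%:R * y) * (k%:R * 'C(n.+1, k)%:R * (y ^+ k * (1 - y) ^+ (n.+1 - k))) +
  (n.+1%:R * y) ^+ 2 * ('C(n.+1, k)%:R * (y ^+ k * (1 - y) ^+ (n.+1 - k)))) by ring.
rewrite (eq_bigr _ (fun (k : 'I_n.+2) _ => e k)) !big_split/= -!mulr_sumr m2.
by rewrite bernstein_mean bernstein_sum -!natr1; ring.
Qed.

Lemma weierstrass (f : R -> R) (e : R) : continuous f -> 0 < e ->
  exists p : {poly R}, forall y, 0 <= y <= 1 -> `|p.[y] - f y| <= e.
Proof.
move=> cf e0.
have [M M0 HM] : exists2 M, 0 < M & forall y, 0 <= y <= 1 -> `|f y| <= M.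
  have [|c _ Hc] := @EVT_max R (fun y => `|f y|) 0 1 ler01.
    by apply: continuous_subspaceT => y; apply: cvg_norm; exact: cf.
  by exists (`|f c| + 1) => [|y y01]; [rewrite ltr_wpDl|rewrite (le_trans (Hc y _))// lerDl].
have e20 : 0 < e / 2 by rewrite divr_gt0.
have [dl dl0 Hdl] := @continuous_unif_itv R f 0 1 (e / 2) (fun x _ => cf x) e20.
(* Makes [2 * M / (dl ^+ 2 * n.+1)] at most [e / 2], which is what the variance contributes
   below. *)
pose n := Num.truncn (4 * M / (e * dl ^+ 2)).
pose w k y : R := 'C(n.+1, k)%:R * (y ^+ k * (1 - y) ^+ (n.+1 - k)).
exists (\sum_(k < n.+2) (f (k%:R / n.+1%:R) * 'C(n.+1, k)%:R) *: ('X^k * (1 - 'X) ^+ (n.+1 - k))).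
move=> y /andP[y0 y1].
have n0 : 0 < n.+1%:R :> R by rewrite ltr0n.
have w0 k : 0 <= w k y by rewrite mulr_ge0// mulr_ge0// exprn_ge0// subr_ge0.
have -> : (\sum_(k < n.+2) (f (k%:R / n.+1%:R) * 'C(n.+1, k)%:R) *: ('X^k * (1 - 'X) ^+ (n.+1 - k))).[y] =
    \sum_(k < n.+2) w k y * f (k%:R / n.+1%:R).
  rewrite horner_sum; apply: eq_bigr => k _.
  rewrite hornerZ hornerM hornerXn horner_exp (_ : (1 - 'X).[y] = 1 - y); last by rewrite !hornerE.
  by rewrite /w; ring.
have -> : f y = \sum_(k < n.+2) w k y * f y.
  by rewrite -mulr_suml bernstein_sum mul1r.
rewrite -sumrB.
rewrite (le_trans (ler_norm_sum _ _ _))//.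
(* Chebyshev's argument: either [k / n.+1] is within [dl] of [y], where [f] varies by less than
   [e / 2], or the squared deviation over [dl ^+ 2] is at least 1 and multiplies the crude bound
   [2 * M]. *)
have H (k : 'I_n.+2) : `|w k y * f (k%:R / n.+1%:R) - w k y * f y| <=
    w k y * (e / 2) + (2 * M / (dl ^+ 2 * n.+1%:R ^+ 2)) * (w k y * (k%:R - n.+1%:R * y) ^+ 2).
  rewrite -mulrBr normrM ger0_norm// [leRHS](_ : _ = w k y * (e / 2 +
    2 * M / (dl ^+ 2 * n.+1%:R ^+ 2) * (k%:R - n.+1%:R * y) ^+ 2)); last by ring.
  rewrite ler_wpM2l//.
  have kn : 0 <= (k%:R / n.+1%:R : R) <= 1.
    by rewrite divr_ge0//= ler_pdivrMr// mul1r ler_nat -ltnS.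
  have c0 : 0 <= 2 * M / (dl ^+ 2 * n.+1%:R ^+ 2).
    by rewrite divr_ge0 ?mulr_ge0 ?sqr_ge0// ltW.
  have [h|h] := ltP `|k%:R / n.+1%:R - y| dl.
    rewrite (le_trans (ltW (Hdl _ _ _ _ h))) ?in_itv/= ?kn ?y0//.
    by rewrite lerDl mulr_ge0// sqr_ge0.
  apply: (@le_trans _ _ (2 * M)).
    rewrite (le_trans (ler_normB _ _))// mulrDl mul1r lerD// HM ?kn ?y0//.
  rewrite -[leLHS]add0r lerD ?(ltW e20)//.
  rewrite -mulrA ler_peMr ?mulr_ge0 ?(ltW M0)//.
  rewrite mulrC ler_pdivlMr ?mulr_gt0 ?exprn_gt0// mul1r -exprMn.
  have -> : (k%:R - n.+1%:R * y) ^+ 2 = (`|k%:R / n.+1%:R - y| * n.+1%:R) ^+ 2.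
    rewrite !exprMn real_normK ?num_real// -exprMn; congr (_ ^+ 2).
    by rewrite mulrBl divfK ?gt_eqF// mulrC [y * _]mulrC mulrC.
  rewrite lerXn2r ?nnegrE ?mulr_ge0// ?(ltW dl0)//.
  by rewrite ler_wpM2r.
rewrite (le_trans (ler_sum _ (fun k _ => H k)))//.
rewrite big_split/= -mulr_suml -mulr_sumr bernstein_sum bernstein_variance mul1r.
rewrite [leRHS](splitr e) lerD//.
have hn : 4 * M / (e * dl ^+ 2) <= n.+1%:R by rewrite ltW// truncnS_gt.
have yy : y * (1 - y) <= 1 by nra.
have -> : 2 * M / (dl ^+ 2 * n.+1%:R ^+ 2) * (n.+1%:R * y * (1 - y)) =
   2 * M / (dl ^+ 2 * n.+1%:R) * (y * (1 - y)).
  have dn0 : dl != 0 by rewrite gt_eqF.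
  move: (n.+1%:R : R) (lt0r_neq0 n0) => N N0; field.
  by rewrite N0.
rewrite (@le_trans _ _ (2 * M / (dl ^+ 2 * n.+1%:R)))//.
  by rewrite ler_piMr// divr_ge0 ?mulr_ge0 ?sqr_ge0// ltW.
rewrite ler_pdivrMr ?mulr_gt0 ?exprn_gt0//.
move: hn; rewrite ler_pdivrMr ?mulr_gt0 ?exprn_gt0//; nra.
Qed.

End weierstrass.

Section exponential_determinacy.
Context {R : realType} (d : nat) (S C : R) (Delta : (R -> R) -> R).
Hypotheses (d0 : (0 < d)%N) (S0 : 0 <= S) (C0 : 0 <= C).
Hypothesis Delta_lin : forall (a b : R) (f g : R -> R), continuous f -> continuous g ->
  Delta (fun q => a * f q + b * g q) = a * Delta f + b * Delta g.
Hypothesis Delta_bound : forall (f : R -> R) (M : R), continuous f ->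
  (forall q, 0 <= q <= S -> `|f q| <= M) -> `|Delta f| <= C * M.
Hypothesis Delta_gauss_gen : forall lam, 0 < lam -> Delta (gauss_gen d lam) = 0.

Let e (lam q : R) : R := expR (- (lam * q)).

Let ce lam : continuous (e lam).
Proof.
move=> q; apply: continuous_comp; last exact: continuous_expR.
by apply: cvgN; apply: cvgM; [exact: cvg_cst|exact: cvg_id].
Qed.

Let cqe lam : continuous (fun q : R => q * e lam q : R).
Proof. by move=> q; apply: cvgM; [exact: cvg_id|exact: ce]. Qed.

Let a lam := Delta (e lam).
Let b lam := Delta (fun q => q * e lam q).

Let ab lam : 0 < lam -> 2 * lam * b lam = d%:R * a lam.
Proof.
move=> l0; have := Delta_gauss_gen l0.
have -> : gauss_gen d lam = (fun q => (2 * lam ^+ 2) * (q * e lam q) + (- (lam * d%:R)) * e lam q).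
  by apply/funext => q; rewrite /gauss_gen /e; ring.
rewrite (Delta_lin _ _ (@cqe lam) (@ce lam)) -/(a lam) -/(b lam) => h.
have l00 : lam != 0 by rewrite gt_eqF.
by apply: (mulfI l00); apply/eqP; rewrite -subr_eq0 -h; apply/eqP; ring.
Qed.

Let e_le1 lam q : 0 <= lam -> 0 <= q -> e lam q <= 1.
Proof. by move=> ? ?; rewrite /e -expR0 ler_expR oppr_le0 mulr_ge0. Qed.

Let a_bound lam : 0 <= lam -> `|a lam| <= C.
Proof.
move=> l0; rewrite -[leRHS]mulr1; apply: Delta_bound; first exact: ce.
by move=> q /andP[q0 _]; rewrite ger0_norm ?expR_ge0// e_le1.
Qed.

(** The remainder of the expansion of exp(- h q) is quadratic in [h] uniformly on [[0, S]]; hence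
    [Delta], bounded for the uniform norm there, can be differentiated under its argument. *)
Let a_diff lam h : 0 < lam -> `|h| <= 1 ->
  `|a (lam + h) - a lam + h * b lam| <= C * (S ^+ 2 * expR S) * h ^+ 2.
Proof.
move=> l0 h1.
have c1 : continuous (fun q : R => (-1) * e lam q + h * (q * e lam q) : R).
  by move=> q; apply: cvgD; apply: cvgM; [exact: cvg_cst|exact: ce|exact: cvg_cst|exact: cqe].
have -> : a (lam + h) - a lam + h * b lam =
    Delta (fun q => 1 * e (lam + h) q + 1 * ((-1) * e lam q + h * (q * e lam q))).
  rewrite (Delta_lin _ _ (@ce _) c1) (Delta_lin _ _ (@ce _) (@cqe _)).
  by rewrite /a /b; ring.
rewrite -mulrA; apply: Delta_bound.
  by move=> q; apply: cvgD; apply: cvgM; [exact: cvg_cst|exact: ce|exact: cvg_cst|exact: c1].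
move=> q /andP[q0 qS].
have -> : 1 * e (lam + h) q + 1 * (-1 * e lam q + h * (q * e lam q)) =
    e lam q * (expR (- (h * q)) - 1 - (- (h * q))).
  by rewrite /e mulrDl opprD expRD; ring.
rewrite normrM ger0_norm ?expR_ge0//.
rewrite (@le_trans _ _ `|expR (- (h * q)) - 1 - - (h * q)|)//.
  by rewrite ler_piMl// e_le1// ltW.
rewrite (le_trans (expR_sub1_bound _))// sqrrN normrN exprMn.
rewrite (_ : S ^+ 2 * expR S * h ^+ 2 = h ^+ 2 * S ^+ 2 * expR S); last by ring.
have hq0 : 0 <= h ^+ 2 * q ^+ 2 by rewrite mulr_ge0 ?sqr_ge0.
apply: ler_pM; rewrite ?expR_ge0//.
  by rewrite ler_wpM2l ?sqr_ge0// lerXn2r ?nnegrE.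
by rewrite ler_expR normrM [`|q|]ger0_norm// -[S]mul1r ler_pM.
Qed.

Let a_derive (lam : R) : 0 < lam -> is_derive lam 1 a (- b lam).
Proof.
move=> l0.
have H : h^-1 *: (a (h *: 1 + lam) - a lam) @[h --> 0^'] --> - b lam.
  apply/cvgrPdist_le => eps eps0; near=> h.
  have h0 : h != 0 by near: h; exact: nbhs_dnbhs_neq.
  have h1 : `|h| <= 1 by near: h; apply: dnbhs0_le.
  have h2 : `|h| <= eps / (C * (S ^+ 2 * expR S) + 1).
    by near: h; apply: dnbhs0_le; rewrite divr_gt0// ltr_wpDl// !mulr_ge0 ?sqr_ge0 ?expR_ge0.
  have := a_diff l0 h1.
  rewrite -normrN (_ : - (- b lam - _) = h^-1 * (a (lam + h) - a lam + h * b lam)); last first.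
    by rewrite /GRing.scale/= mulr1 [h + lam]addrC; field.
  rewrite normrM normfV ler_pdivrMl ?normr_gt0// => /le_trans; apply.
  move: h2; rewrite ler_pdivlMr ?ltr_wpDl ?mulr_ge0 ?sqr_ge0 ?expR_ge0// => h2.
  rewrite -[h ^+ 2]real_normK ?num_real//.
  have := normr_ge0 h; nra.
apply: DeriveDef; last exact: (cvg_lim _ H).
by apply/cvg_ex; exists (- b lam).
Unshelve. all: by end_near. Qed.

Let a0 (lam : R) : 0 < lam -> a lam = 0.
Proof.
(* The equation [2 * lam * a' = - d * a] makes [lam ^ (d / 2) * a] constant; its square avoids the
   half-integer power. As [a] is bounded, [G] vanishes at 0, hence everywhere. *)
move=> l0; pose G l := l ^+ d * a l ^+ 2.
have dG (l : R) : 0 < l -> is_derive l 1 G 0.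
  move=> l1; have da := a_derive l1.
  have h1 : is_derive l 1 (@id R ^+ d) (d%:R * l ^+ d.-1).
    have := @is_deriveX R _ id d l 1 1 (is_derive_id l 1).
    by rewrite /GRing.scale/= mulr1.
  have h2 := @is_deriveX R _ a 1 l 1 _ da.
  have h3 := is_deriveM h1 h2.
  have -> : G = (@id R ^+ d) * (a ^+ 2) by apply/funext => y; rewrite /G/= !fctE.
  apply: is_derive_eq; rewrite /GRing.scale/= !fctE.
  have := ab l1; case: d d0 => // n _ /= h; rewrite exprS.
  suff : a l * l ^+ n * (n.+1%:R * a l - 2 * l * b l) = 0 by move=> <-; ring.
  by rewrite h subrr mulr0.
have Gc l1 : 0 < l1 -> l1 < lam -> G l1 = G lam.
  move=> l10 l1l; have [||c _] := @MVT _ G (fun=> 0) _ _ l1l.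
  - by move=> y; rewrite in_itv/= => /andP[y1 _]; apply: dG; exact: lt_trans y1.
  - apply: continuous_in_subspaceT => y; rewrite inE/= in_itv/= => /andP[y1 _].
    have ? := dG y (lt_le_trans l10 y1).
    by apply/differentiable_continuous/derivable1_diffP.
  - by rewrite mul0r => /eqP; rewrite subr_eq0 => /eqP ->.
suff : G lam = 0.
  by move=> /eqP; rewrite mulf_eq0 expf_eq0 gt_eqF// andbF/= sqrf_eq0 => /eqP.
apply/eqP; rewrite -normr_le0; apply/ler_addgt0Pl => eps eps0; rewrite addr0.
pose l1 := Num.min (lam / 2) (Num.min 1 (eps / (C ^+ 2 + 1))).
have C1 : 0 < C ^+ 2 + 1 by rewrite ltr_wpDl// sqr_ge0.
have l10 : 0 < l1 by rewrite !lt_min !divr_gt0 ?ltr01.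
have l1l : l1 < lam.
  by rewrite (@le_lt_trans _ _ (lam / 2))// ?ge_min ?lexx// ltr_pdivrMr// ltr_pMr// ltr1n.
rewrite -(Gc l1)// /G normrM !normrX ger0_norm ?(ltW l10)//.
have l11 : l1 <= 1 by rewrite !ge_min lexx !orbT.
have l1e : l1 <= eps / (C ^+ 2 + 1) by rewrite !ge_min lexx !orbT.
rewrite (@le_trans _ _ (l1 * C ^+ 2))//.
  apply: ler_pM; rewrite ?exprn_ge0 ?(ltW l10)//.
    by rewrite -[leRHS]expr1 ler_wiXn2l ?(ltW l10).
  by rewrite lerXn2r ?nnegrE// a_bound// ltW.
move: l1e; rewrite ler_pdivlMr//; nra.
Qed.

(** The differential equation says nothing at [lam = 0], yet this value is needed for the constant
    terms of polynomials; it is the limit of [a l] as [l] decreases to 0. *)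
Let a00 : a 0 = 0.
Proof.
apply/eqP; rewrite -normr_le0; apply/ler_addgt0Pl => eps eps0; rewrite addr0.
have CS : 0 < C * S + 1 by rewrite ltr_wpDl// mulr_ge0.
pose l := eps / (C * S + 1).
have l0 : 0 < l by rewrite divr_gt0.
have -> : a 0 = Delta (fun q => 1 * e 0 q + (-1) * e l q).
  by rewrite (Delta_lin _ _ (@ce _) (@ce _)) -/(a l) (a0 l0) -/(a 0); ring.
apply: (@le_trans _ _ (C * (l * S))).
  apply: Delta_bound.
    by move=> q; apply: cvgD; apply: cvgM; [exact: cvg_cst|exact: ce|exact: cvg_cst|exact: ce].
  move=> q /andP[q0 qS]; rewrite {1}/e mul0r oppr0 expR0 mulN1r mul1r.
  rewrite ger0_norm ?subr_ge0 ?e_le1 ?(ltW l0)//.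
  have := expR_ge1Dx (- (l * q)); rewrite -/(e l q).
  have : l * q <= l * S by rewrite ler_wpM2l// ltW.
  lra.
have : l * (C * S + 1) = eps by rewrite /l divfK// gt_eqF.
nra.
Qed.

Lemma exponential_determinacy (f : R -> R) : continuous f -> Delta f = 0.
Proof.
move=> cf.
have aN n : a n%:R = 0 by case: n => [|n]; [exact: a00|apply: a0; rewrite ltr0n].
have cp (p : {poly R}) : continuous (fun q : R => p.[e 1 q] : R).
  move=> q; apply: (@continuous_comp R R R (e 1) (fun y => p.[y])); first exact: ce.
  exact: continuous_horner.
have Dp (p : {poly R}) : Delta (fun q => p.[e 1 q]) = 0.
  suff H : forall n, Delta (fun q => e n%:R q * p.[e 1 q]) = 0.
    by rewrite -(H 0%N); congr (Delta _); apply/funext => q; rewrite /e mulr0n mul0r oppr0 expR0 !mul1r.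
  elim/poly_ind: p => [|p c IH] n.
    have -> : (fun q => e n%:R q * (0 : {poly R}).[e 1 q]) = (fun q => 0 * e 0 q + 0 * e 0 q).
      by apply/funext => q; rewrite horner0 mulr0 mul0r addr0.
    by rewrite (Delta_lin _ _ (@ce _) (@ce _)) !mul0r addr0.
  have -> : (fun q => e n%:R q * (p * 'X + c%:P).[e 1 q]) =
      (fun q => 1 * (e n.+1%:R q * p.[e 1 q]) + c * e n%:R q).
    apply/funext => q; rewrite !hornerE /e -natr1 [in RHS]mulrDl opprD expRD mul1r; ring.
  have c1 : continuous (fun q : R => e n.+1%:R q * p.[e 1 q] : R).
    by move=> q; apply: cvgM; [exact: ce|exact: cp].
  by rewrite (Delta_lin _ _ c1 (@ce _)) IH -/(a n%:R) aN; ring.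
(* [f] in the variable y = exp(- q), frozen below exp(- S) so as to be continuous on the whole
   line. *)
pose g y := f (- ln (Num.max y (expR (- S)))).
have cg : continuous g.
  move=> y; apply: (@continuous_comp R R R (fun y => - ln (Num.max y (expR (- S)))) f);
    last exact: cf.
  apply: cvgN; apply: (@continuous_comp R R R (fun y => Num.max y (expR (- S))) (@ln R)).
    by apply: continuous_max; [exact: cvg_id|exact: cvg_cst].
  by apply: continuous_ln; rewrite lt_max expR_gt0 orbT.
apply/eqP; rewrite -normr_le0; apply/ler_addgt0Pl => eps eps0; rewrite addr0.
have C1 : 0 < C + 1 by rewrite ltr_wpDl.
have [p Hp] := weierstrass cg (divr_gt0 eps0 C1).
have -> : Delta f = Delta (fun q => 1 * f q + (-1) * p.[e 1 q]).
  by rewrite (Delta_lin _ _ cf (cp p)) Dp mulr0 addr0 mul1r.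
apply: (@le_trans _ _ (C * (eps / (C + 1)))).
  apply: Delta_bound.
    by move=> q; apply: cvgD; apply: cvgM; [exact: cvg_cst|exact: cf|exact: cvg_cst|exact: cp].
  move=> q /andP[q0 qS]; have := Hp (e 1 q).
  rewrite expR_ge0 e_le1// => /(_ isT); rewrite distrC /g.
  have -> : Num.max (e 1 q) (expR (- S)) = e 1 q.
    by apply/max_idPl; rewrite /e ler_expR mul1r lerN2.
  by rewrite {1}/e expRK opprK mul1r mul1r mulN1r.
rewrite mulrA ler_pdivrMr//; nra.
Qed.

End exponential_determinacy.

(** * The radial potential *)

Lemma Rintegral_derive (R : realType) (F f : R -> R) (a b : R) : a <= b ->
  (forall x, a <= x <= b -> is_derive x 1 F (f x)) ->
  {within `[a, b], continuous f} ->
  \int[lebesgue_measure]_(x in `[a, b]) f x = F b - F a.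
Proof.
rewrite le_eqVlt => /predU1P[-> _ _|ab dF cf].
  by rewrite set_itv1 Rintegral_set1 subrr.
have cF x : a <= x <= b -> {for x, continuous F}.
  by move=> /dF ?; apply/differentiable_continuous/derivable1_diffP.
rewrite /Rintegral (@continuous_FTC2 _ f F)//.
- split.
  + by move=> x; rewrite in_itv/= => /andP[x1 x2]; have := dF x; rewrite !ltW//; case.
  + by apply: cvg_at_right_filter; apply: cF; rewrite lexx ltW.
  + by apply: cvg_at_left_filter; apply: cF; rewrite lexx ltW.
- move=> x; rewrite in_itv/= => /andP[x1 x2]; rewrite derive1E.
  by have := dF x; rewrite !ltW// => /(_ isT) ?; rewrite derive_val.
Qed.

Section radial_potential.
Context {R : realType} (d : nat).
Hypothesis d0 : (0 < d)%N.
Notation leb := (@lebesgue_measure R).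

(** Continuity at 0 is left out on purpose: the exponent is known for positive radii only, and
    nothing yet relates the value of the exit solution at the centre to nearby ones. *)
Definition radial_class (h : R -> R) :=
  (forall q, 0 < q -> {for q, continuous h}) /\
  (forall y, exists M, forall q, 0 <= q <= y -> `|h q| <= M).

Lemma continuous_radial_class h : continuous h -> radial_class h.
Proof.
move=> ch; split; first by move=> q _; exact: ch.
move=> y; have [y0|y0] := leP 0 y; last first.
  by exists 0 => q /andP[q0 qy]; have := le_lt_trans (le_trans q0 qy) y0; rewrite ltxx.
have [|c _ Hc] := @EVT_max R (fun y => `|h y|) 0 y y0.
  by apply: continuous_subspaceT => z; apply: cvg_norm; exact: ch.
by exists `|h c| => q qy; apply: Hc; rewrite in_itv.
Qed.

(** A convex combination of [h 0] and [h q] whose weight removes the possible jump at 0: it is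
    continuous, obeys the bounds of [h], and tends to [h] pointwise on nonnegative [q]. *)
Definition radial_approx (h : R -> R) (k : nat) (q : R) :=
  h 0 + (h q - h 0) * (1 - expR (- (k%:R * Num.max q 0))).

Lemma radial_approx_weight (k : nat) (q : R) :
  0 <= 1 - expR (- (k%:R * Num.max q 0)) <= 1.
Proof.
rewrite subr_ge0 -expR0 ler_expR oppr_le0 mulr_ge0 ?le_max ?lexx ?orbT//= expR0.
by rewrite gerBl expR_ge0.
Qed.

Lemma radial_approx_le h k q M : `|h 0| <= M -> `|h q| <= M ->
  `|radial_approx h k q| <= M.
Proof.
move=> h0 hq; have /andP[] := radial_approx_weight k q.
rewrite /radial_approx; move: (1 - _) => t t0 t1.
have -> : h 0 + (h q - h 0) * t = (1 - t) * h 0 + t * h q by ring.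
have t1' : 0 <= 1 - t by rewrite subr_ge0.
rewrite (le_trans (ler_normD _ _))// !normrM (ger0_norm t0) (ger0_norm t1').
nra.
Qed.

Lemma continuous_radial_approx h k : radial_class h -> continuous (radial_approx h k).
Proof.
move=> [hc hb] q.
have cE : {for q, continuous (fun q : R => 1 - expR (- (k%:R * Num.max q 0)) : R)}.
  apply: cvgB; first exact: cvg_cst.
  apply: (@continuous_comp R R R (fun q => - (k%:R * Num.max q 0)) (@expR R));
    last exact: continuous_expR.
  apply: cvgN; apply: cvgM; first exact: cvg_cst.
  by apply: continuous_max; [exact: cvg_id|exact: cvg_cst].
have [q0|q0|q0] := ltgtP q 0; last first.
- rewrite q0 in cE *.
  have [M HM] := hb 1.
  have M0 : 0 <= M by rewrite (le_trans _ (HM 0 _))// lexx ler01.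
  rewrite /continuous_at /radial_approx subrr mul0r addr0.
  apply/cvgrPdist_le => e e0.
  move/cvgrPdist_le : (cE) => /(_ (e / (2 * M + 1))).
  rewrite maxxx mulr0 oppr0 expR0 subrr divr_gt0// ?ltr_wpDl ?mulr_ge0// => /(_ isT) cE'.
  near=> y; rewrite opprD addNKr normrN normrM.
  have : `|0 - (1 - expR (- (k%:R * Num.max y 0)))| <= e / (2 * M + 1) by near: y.
  rewrite sub0r normrN ler_pdivlMr ?ltr_wpDl ?mulr_ge0// => H.
  move: H; have y1 : y <= 1 by apply: ltW; near: y; apply: lt_nbhsl; exact: ltr01.
  have [y0|y0] := leP 0 y => H; last first.
    by rewrite mulr0 oppr0 expR0 subrr normr0 mulr0 ltW.
  have : `|h y - h 0| <= M + M.
    by rewrite (le_trans (ler_normB _ _))// lerD// HM ?lexx ?ler01// y0 y1.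
  move: H; have := normr_ge0 (1 - expR (- (k%:R * y))); nra.
- apply: cvgD; first exact: cvg_cst.
  apply: cvgM; last exact: cE.
  by apply: cvgB; [exact: hc|exact: cvg_cst].
- have : \forall y \near q, radial_approx h k y = h 0.
    near=> y; have y0 : y <= 0 by apply: ltW; near: y; exact: lt_nbhsl.
    by rewrite /radial_approx max_r// mulr0 oppr0 expR0 subrr mulr0 addr0.
  move=> H; rewrite /continuous_at (nbhs_singleton H).
  by apply: cvg_near_cst; apply: filterS H => y ->.
Unshelve. all: by end_near. Qed.

Lemma cvg_radial_approx h q : 0 <= q -> radial_approx h k q @[k --> \oo] --> h q.
Proof.
rewrite le_eqVlt => /predU1P[<-|q0].
  by rewrite /radial_approx subrr; under eq_fun do rewrite mul0r addr0; exact: cvg_cst.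
rewrite -[X in _ --> X](_ : h 0 + (h q - h 0) * (1 - 0) = _); last by ring.
apply: cvgD; first exact: cvg_cst.
apply: cvgM; first exact: cvg_cst.
apply: cvgB; first exact: cvg_cst.
rewrite max_l ?(ltW q0)//.
under eq_fun do rewrite -mulrN expRM_natl.
by apply: cvg_expr; rewrite ger0_norm ?expR_ge0// -expR0 ltr_expR oppr_lt0.
Qed.


Definition radial_mass (h : R -> R) (y : R) : R :=
  \int[leb]_(z in `[0, y]) (z ^+ d.-1 * h (z ^+ 2)).

Definition radial_flux (h : R -> R) (y : R) : R := 2 * y ^- d.-1 * radial_mass h y.

(** The increment from radius [rho] to radius [s] of a radial function, regular at the centre, whose
    half Laplacian is [h (|y| ^+ 2)]. *)
Definition radial_potential (rho s : R) (h : R -> R) : R :=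
  \int[leb]_(y in `[rho, s]) radial_flux h y.

Lemma itv_measure (a b : R) : a <= b -> leb `[a, b] = (b - a)%:E.
Proof. by move=> ab; rewrite lebesgue_measure_itv/= lte_fin; case: ltgtP ab => // -> _; rewrite subrr. Qed.

Lemma itv_measure_lty (a b : R) : (leb `[a, b] < +oo)%E.
Proof. by rewrite lebesgue_measure_itv/=; case: ifP => // _; rewrite ltry. Qed.

Lemma measurable_radial_integrand h (y : R) : radial_class h ->
  measurable_fun `[0, y] (fun z => z ^+ d.-1 * h (z ^+ 2)).
Proof.
move=> [hc hb]; apply: measurable_funM; first exact: measurable_funX.
apply: (measurable_fun_cvg (h := fun (k : nat) (z : measurableTypeR R) => radial_approx h k (z ^+ 2) : measurableTypeR R)).
  move=> k; apply: measurable_funTS; apply: measurableT_comp; last exact: measurable_funX.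
  by apply: continuous_measurable_fun; exact: continuous_radial_approx.
by move=> z _; apply: cvg_radial_approx; exact: sqr_ge0.
Qed.

Lemma radial_integrand_le h (y M : R) : (forall q, 0 <= q <= y ^+ 2 -> `|h q| <= M) ->
  forall z, z \in `[0, y] -> `|z ^+ d.-1 * h (z ^+ 2)| <= y ^+ d.-1 * M.
Proof.
move=> hM z; rewrite in_itv/= => /andP[z0 zy].
rewrite normrM normrX ger0_norm//.
have y0 := le_trans z0 zy.
apply: ler_pM; rewrite ?exprn_ge0//; first by rewrite lerXn2r ?nnegrE.
by apply: hM; rewrite sqr_ge0 lerXn2r ?nnegrE.
Qed.

Lemma radial_integrable h (y : R) : radial_class h ->
  leb.-integrable `[0, y] (fun z => (z ^+ d.-1 * h (z ^+ 2))%:E).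
Proof.
move=> hh; have [M HM] := hh.2 (y ^+ 2).
apply: (bounded_integrable _ (itv_measure_lty 0 y) (C := y ^+ d.-1 * M)) => //.
- exact: measurable_radial_integrand.
- by move=> z zy; exact: (radial_integrand_le HM).
Qed.

Lemma radial_mass_le h (y M : R) : radial_class h -> 0 <= y ->
  (forall q, 0 <= q <= y ^+ 2 -> `|h q| <= M) -> `|radial_mass h y| <= M * y ^+ d.
Proof.
move=> hh y0 HM.
rewrite (_ : M * _ = (y ^+ d.-1 * M) * fine (leb `[0, y])).
  apply: normr_Rintegral_le => //; first exact: itv_measure_lty.
  - exact: measurable_radial_integrand.
  - by move=> z zy; exact: (radial_integrand_le HM).
by rewrite itv_measure// subr0/= mulrC mulrAC -exprSr prednK.
Qed.

(** The mass is of order y^d and is divided by y^(d-1), so the flux is bounded near the centre and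
    tends to 0 there. *)
Lemma radial_flux_le h (y M : R) : radial_class h -> 0 < y ->
  (forall q, 0 <= q <= y ^+ 2 -> `|h q| <= M) -> `|radial_flux h y| <= 2 * M * y.
Proof.
move=> hh y0 HM; rewrite /radial_flux normrM ger0_norm; last first.
  by rewrite mulr_ge0// invr_ge0 exprn_ge0// ltW.
rewrite -!mulrA ler_wpM2l// ler_pdivrMl ?exprn_gt0//.
rewrite (le_trans (radial_mass_le hh (ltW y0) HM))// -[in leLHS](prednK d0) exprS.
by rewrite le_eqVlt; apply/orP; left; apply/eqP; ring.
Qed.

Lemma is_derive_radial_mass h (y : R) : radial_class h -> 0 < y ->
  is_derive y 1 (radial_mass h) (y ^+ d.-1 * h (y ^+ 2)).
Proof.
move=> hh y0.
have [||||d1 d2] := @continuous_FTC1_closed R (fun z => z ^+ d.-1 * h (z ^+ 2)) 0 y (y + 1).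
- by rewrite ltrDl.
- exact: radial_integrable.
- by [].
- apply: cvgM; first exact: exprn_continuous.
  apply: (@continuous_comp R R R (fun z => z ^+ 2) h); first exact: exprn_continuous.
  by apply: hh.1; rewrite exprn_gt0.
- by rewrite -d2 derive1E; exact/derivableP.
Qed.

Lemma continuous_radial_flux h (y : R) : radial_class h -> 0 < y ->
  {for y, continuous (radial_flux h)}.
Proof.
move=> hh y0; have ? := is_derive_radial_mass hh y0.
apply: cvgM; last by apply/differentiable_continuous/derivable1_diffP.
apply: cvgM; first exact: cvg_cst.
by apply: cvgV; [rewrite expf_eq0 gt_eqF// andbF|exact: exprn_continuous].
Qed.

Lemma within_radial_flux h (rho s : R) : radial_class h -> 0 < rho ->
  {within `[rho, s], continuous (radial_flux h)}.
Proof.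
move=> hh r0; apply: continuous_in_subspaceT => y; rewrite inE/= in_itv/= => /andP[ry _].
by apply: continuous_radial_flux => //; exact: lt_le_trans ry.
Qed.

Lemma integrable_radial_flux h (rho s : R) : radial_class h -> 0 < rho ->
  leb.-integrable `[rho, s] (EFin \o radial_flux h).
Proof.
move=> hh r0; apply: continuous_compact_integrable; first exact: segment_compact.
exact: within_radial_flux.
Qed.

Lemma radial_classD a b f g : radial_class f -> radial_class g ->
  radial_class (fun q => a * f q + b * g q).
Proof.
move=> [fc fb] [gc gb]; split.
  by move=> q q0; apply: cvgD; apply: cvgM; [exact: cvg_cst|exact: fc|exact: cvg_cst|exact: gc].
move=> y; have [M HM] := fb y; have [N HN] := gb y.
exists (`|a| * M + `|b| * N) => q qy; rewrite (le_trans (ler_normD _ _))// !normrM.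
by rewrite lerD// ler_wpM2l// ?HM// HN.
Qed.

Lemma radial_massD a b f g y : radial_class f -> radial_class g ->
  radial_mass (fun q => a * f q + b * g q) y = a * radial_mass f y + b * radial_mass g y.
Proof.
move=> hf hg; have If := radial_integrable y hf; have Ig := radial_integrable y hg.
rewrite /radial_mass -!RintegralZl// -RintegralD//.
- by apply: eq_Rintegral => z _; ring.
- exact: (integrableZl _ a If).
- exact: (integrableZl _ b Ig).
Qed.

Lemma radial_potentialD a b f g rho s : radial_class f -> radial_class g -> 0 < rho ->
  radial_potential rho s (fun q => a * f q + b * g q) =
  a * radial_potential rho s f + b * radial_potential rho s g.
Proof.
move=> hf hg r0.
have If := integrable_radial_flux s hf r0; have Ig := integrable_radial_flux s hg r0.
rewrite /radial_potential -!RintegralZl// -RintegralD//.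
- by apply: eq_Rintegral => z _; rewrite /radial_flux radial_massD//; ring.
- exact: (integrableZl _ a If).
- exact: (integrableZl _ b Ig).
Qed.

Lemma radial_potential_le h (rho s M : R) : radial_class h -> 0 < rho -> rho <= s ->
  (forall q, 0 <= q <= s ^+ 2 -> `|h q| <= M) -> `|radial_potential rho s h| <= 2 * s ^+ 2 * M.
Proof.
move=> hh r0 rs HM.
have s0 : 0 < s := lt_le_trans r0 rs.
have M0 : 0 <= M by rewrite (le_trans _ (HM 0 _))// lexx sqr_ge0.
have H y : y \in `[rho, s] -> `|radial_flux h y| <= 2 * M * s.
  rewrite in_itv/= => /andP[ry ys]; have y0 := lt_le_trans r0 ry.
  rewrite (le_trans (radial_flux_le (M := M) hh y0 _))//.
    move=> q /andP[q0 qy]; apply: HM; rewrite q0 (le_trans qy)//.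
    by rewrite lerXn2r ?nnegrE ?(ltW y0) ?(ltW s0).
  by rewrite ler_wpM2l ?mulr_ge0.
apply: (@le_trans _ _ (2 * M * s * fine (leb `[rho, s]))).
  apply: normr_Rintegral_le => //; first exact: itv_measure_lty.
  by apply: subspace_continuous_measurable_fun => //; exact: within_radial_flux.
rewrite itv_measure//=.
have : s - rho <= s by rewrite gerBl ltW.
have : 0 <= 2 * M * s by rewrite !mulr_ge0// ltW.
have -> : 2 * s ^+ 2 * M = 2 * M * s * s by ring.
move: (2 * M * s) (s - rho) => a b a0 bs; exact: ler_wpM2l.
Qed.

Lemma is_derive_gauss (lam z : R) : is_derive z 1 (fun z : R => expR (- (lam * z ^+ 2)) : R)
  (- (2 * lam * z) * expR (- (lam * z ^+ 2))).
Proof.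
have h1 := @is_deriveX R _ id 2 z 1 1 (is_derive_id z 1).
have h2 := is_deriveZ (- lam) h1.
have -> : (fun z : R => expR (- (lam * z ^+ 2)) : R) = expR \o ((- lam) *: (@id R ^+ 2)).
  by apply/funext => y; rewrite /= !fctE /GRing.scale/= mulNr.
apply: (is_derive_eq (is_derive1_comp (is_derive_expR ((- lam *: (@id R ^+ 2)) z)) h2)).
rewrite /= !fctE /GRing.scale/= expr1 mulr1 mulNr; ring.
Qed.

(** The integrand is the exact derivative of the right-hand side, which vanishes at 0 because
    [d > 0]. *)
Lemma radial_mass_gauss_gen (lam y : R) : 0 <= y ->
  radial_mass (gauss_gen d lam) y = - lam * y ^+ d * expR (- (lam * y ^+ 2)).
Proof.
move=> y0.
pose F (z : R) : R := - lam * z ^+ d * expR (- (lam * z ^+ 2)).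
pose f (z : R) : R := z ^+ d.-1 * gauss_gen d lam (z ^+ 2).
have dF z : 0 <= z <= y -> is_derive z 1 F (f z).
  move=> _; have h1 := @is_deriveX R _ id d z 1 1 (is_derive_id z 1).
  have h2 := is_deriveZ (- lam) h1.
  have h3 := is_deriveM h2 (is_derive_gauss lam z).
  have -> : F = ((- lam) *: (@id R ^+ d)) * (fun z : R => expR (- (lam * z ^+ 2)) : R).
    by apply/funext => t; rewrite /F !fctE.
  apply: is_derive_eq; rewrite /f !fctE /GRing.scale/= /gauss_gen mulr1.
  have -> : z ^+ d = z ^+ d.-1 * z by rewrite -exprSr prednK.
  by rewrite /GRing.scale/=; ring.
have cf : {within `[0, y], continuous f}.
  apply: continuous_subspaceT => z; apply: cvgM; first exact: exprn_continuous.
  apply: (@continuous_comp R R R (fun z => z ^+ 2) (gauss_gen d lam)).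
    exact: exprn_continuous.
  exact: continuous_gauss_gen.
rewrite /radial_mass (Rintegral_derive y0 dF cf).
by rewrite /F expr0n gtn_eqF// mulr0 mul0r subr0.
Qed.

(** The same value as in [occupation_gauss] with [rho] the norm of the starting point: the defect
    between occupation measure and radial potential kills every [gauss_gen]. *)
Lemma radial_potential_gauss_gen (lam rho s : R) : 0 < rho -> rho <= s ->
  radial_potential rho s (gauss_gen d lam) = expR (- (lam * s ^+ 2)) - expR (- (lam * rho ^+ 2)).
Proof.
move=> r0 rs; rewrite /radial_potential.
pose F (z : R) : R := expR (- (lam * z ^+ 2)).
have cf : {within `[rho, s], continuous (radial_flux (gauss_gen d lam))}.
  by apply: within_radial_flux => //; apply: continuous_radial_class; exact: continuous_gauss_gen.
have dF y : rho <= y <= s -> is_derive y 1 F (radial_flux (gauss_gen d lam) y).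
  move=> /andP[ry _]; have y0 := lt_le_trans r0 ry.
  apply: (is_derive_eq (is_derive_gauss lam y)).
  rewrite /radial_flux radial_mass_gauss_gen ?ltW//.
  have -> : y ^+ d = y ^+ d.-1 * y by rewrite -exprSr prednK.
  have : y ^+ d.-1 != 0 by rewrite expf_eq0 gt_eqF// andbF.
  by move: (y ^+ d.-1) => a a0; field.
exact: (Rintegral_derive rs dF cf).
Qed.

Lemma cvg_radial_potential h_ h (rho s M : R) : (forall k, radial_class (h_ k)) -> radial_class h ->
  0 < rho -> rho <= s -> (forall k q, 0 <= q <= s ^+ 2 -> `|h_ k q| <= M) ->
  (forall q, 0 <= q -> h_ k q @[k --> \oo] --> h q) ->
  radial_potential rho s (h_ k) @[k --> \oo] --> radial_potential rho s h.
Proof.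
move=> hk hh r0 rs HM ck.
have s0 : 0 < s := lt_le_trans r0 rs.
have M0 : 0 <= M by rewrite (le_trans _ (HM 0%N 0 _))// lexx sqr_ge0.
have HMy k y : 0 < y -> y <= s -> forall q, 0 <= q <= y ^+ 2 -> `|h_ k q| <= M.
  by move=> y0 ys q /andP[q0 qy]; apply: HM; rewrite q0 (le_trans qy)// lerXn2r ?nnegrE ?(ltW y0) ?(ltW s0).
apply: (cvg_bounded_Rintegral _ (itv_measure_lty rho s) (C := 2 * M * s)) => //.
- by move=> k; apply: subspace_continuous_measurable_fun => //; exact: within_radial_flux.
- move=> k y; rewrite /= in_itv/= => /andP[ry ys]; have y0 := lt_le_trans r0 ry.
  rewrite (le_trans (radial_flux_le (M := M) (hk k) y0 _))//; first exact: HMy.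
  by rewrite ler_wpM2l ?mulr_ge0.
- move=> y; rewrite /= in_itv/= => /andP[ry ys]; have y0 := lt_le_trans r0 ry.
  apply: cvgM; first exact: cvg_cst.
  apply: (cvg_bounded_Rintegral _ (itv_measure_lty 0 y) (C := y ^+ d.-1 * M)) => //.
  + by move=> k; exact: measurable_radial_integrand.
  + by move=> k z zy; apply: (radial_integrand_le (HMy k y y0 ys)).
  + by move=> z _; apply: cvgM; [exact: cvg_cst|apply: ck; exact: sqr_ge0].
Qed.

End radial_potential.

Section occupation_potential.
Context {R : realType} {disp : measure_display} {Om : measurableType disp}.
Context (P : probability Om R) (d : nat) (W : R -> Om -> 'rV[R]_d).
Hypothesis hW : brownian_motion P W.
Variables (x : 'rV[R]_d) (s : R).
Hypotheses (s0 : 0 < s) (d0 : (0 < d)%N) (x0 : 0 < enorm x) (xs : enorm x < s).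
Notation leb := (@lebesgue_measure R).
Notation PL := (P \x leb)%E.
Notation q := (sqdist W x).

Let mE := measurable_occ_set hW x s0.
Let Efin := PL_occ_set_lty hW x s0 d0.

Let qs u : occ_set W x s u -> 0 <= q u.1 u.2 <= s ^+ 2.
Proof. by move=> /(occ_set_sqdist hW s0)/andP[-> /ltW]. Qed.

Lemma measurable_sqdist_comp (h : R -> R) (E : set (Om * measurableTypeR R)) : continuous h ->
  measurable_fun E (fun u => h (q u.1 u.2)).
Proof.
move=> ch; apply: measurable_funTS; apply: measurableT_comp; last exact: (measurable_sqdist2 hW).
exact: continuous_measurable_fun.
Qed.

Lemma Rintegral_occ_set_continuous (h : R -> R) : continuous h ->
  \int[PL]_(u in occ_set W x s) h (q u.1 u.2) = radial_potential d (enorm x) s h.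
Proof.
move=> ch; apply/eqP; rewrite -subr_eq0; apply/eqP.
have xs2 : sqn x < s ^+ 2 by rewrite -enorm_ltE// ltW.
(* The norm of the defect [Delta]: total occupation mass plus the bound of [radial_potential_le]. *)
pose C := fine (PL (occ_set W x s)) + 2 * s ^+ 2.
have C0 : 0 <= C by rewrite addr_ge0 ?fine_ge0 ?measure_ge0// mulr_ge0// sqr_ge0.
pose Delta f := \int[PL]_(u in occ_set W x s) f (q u.1 u.2) - radial_potential d (enorm x) s f.
have If f : continuous f -> PL.-integrable (occ_set W x s) (EFin \o (fun u => f (q u.1 u.2))).
  move=> cf; have [M HM] := (continuous_radial_class cf).2 (s ^+ 2).
  apply: (bounded_integrable mE Efin (C := M)); first exact: measurable_sqdist_comp.
  by move=> u /qs; exact: HM.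
apply: (@exponential_determinacy R d (s ^+ 2) C Delta d0 (sqr_ge0 _) C0 _ _ _ h ch).
- move=> a b f g cf cg; rewrite /Delta radial_potentialD//; last 2 first.
  + exact: continuous_radial_class.
  + exact: continuous_radial_class.
  rewrite RintegralD//; last 2 first.
  + exact: (integrableZl _ a (If _ cf)).
  + exact: (integrableZl _ b (If _ cg)).
  by rewrite !RintegralZl//; [ring|exact: If|exact: If].
- move=> f M cf HM; rewrite /Delta (le_trans (ler_normB _ _))// mulrDl lerD//.
    rewrite mulrC; apply: normr_Rintegral_le => //; first exact: measurable_sqdist_comp.
    by move=> u /qs; exact: HM.
  apply: radial_potential_le => //; [exact: continuous_radial_class|exact: ltW].
- move=> lam l0; rewrite /Delta (occupation_gauss hW)// radial_potential_gauss_gen// ?ltW//.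
  by rewrite enorm_sqr subrr.
Qed.

(** Bounded convergence on both sides along [radial_approx], which removes the continuity at 0. *)
Lemma Rintegral_occ_set (h : R -> R) : radial_class h ->
  \int[PL]_(u in occ_set W x s) h (q u.1 u.2) = radial_potential d (enorm x) s h.
Proof.
move=> hh; have [M HM] := hh.2 (s ^+ 2).
have ca k := continuous_radial_approx (k := k) hh.
have aM k z : 0 <= z <= s ^+ 2 -> `|radial_approx h k z| <= M.
  by move=> zs; apply: radial_approx_le; rewrite HM// lexx sqr_ge0.
have H1 : \int[PL]_(u in occ_set W x s) radial_approx h k (q u.1 u.2) @[k --> \oo] -->
    \int[PL]_(u in occ_set W x s) h (q u.1 u.2).
  apply: (cvg_bounded_Rintegral mE Efin (C := M)).
  - by move=> k; exact: measurable_sqdist_comp.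
  - by move=> k u /qs; exact: aM.
  - by move=> u /qs/andP[q0 _]; exact: cvg_radial_approx.
have H2 : radial_potential d (enorm x) s (radial_approx h k) @[k --> \oo] -->
    radial_potential d (enorm x) s h.
  apply: (@cvg_radial_potential _ _ d0 _ _ _ _ M) => //; last 1 first.
  - by move=> z z0; exact: cvg_radial_approx.
  - by move=> k; exact: continuous_radial_class.
  - exact: ltW.
apply: (cvg_unique _ H1) => //=.
rewrite (_ : (fun k => _) = (fun k => radial_potential d (enorm x) s (radial_approx h k)))//.
by apply/funext => k; rewrite Rintegral_occ_set_continuous.
Qed.

End occupation_potential.

(** * The branching mechanism psi *)

Section branching_kernel.
Context {R : realType}.
Implicit Types a b l x : R.

Definition branching_kernel l x : R := expR (- (l * x)) - 1 + l * x.

(** Monotonicity in the parameter, with a Lipschitz bound whose weight is the function that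
    [bp_moment] makes integrable. *)
Lemma branching_kernel_diff a b x : 0 <= a -> a <= b -> 0 <= x ->
  0 <= branching_kernel b x - branching_kernel a x <= (b - a) * (1 + b) * Num.min x (x ^+ 2).
Proof.
move=> a0 ab x0; rewrite /branching_kernel.
have b0 := le_trans a0 ab.
have E : expR (- (a * x)) = expR (- (b * x)) * expR ((b - a) * x).
  by rewrite -expRD; congr expR; ring.
have E' : expR (- (b * x)) = expR (- (a * x)) * expR (- ((b - a) * x)).
  by rewrite -expRD; congr expR; ring.
have h1 := expR_ge1Dx ((b - a) * x); have h2 := expR_ge1Dx (- ((b - a) * x)).
have h3 := expR_ge1Dx (- (b * x)).
have eb := expR_ge0 (- (b * x)); have ea := expR_ge0 (- (a * x)).
have ea1 : expR (- (a * x)) <= 1 by rewrite -expR0 ler_expR oppr_le0 mulr_ge0.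
have ba0 : 0 <= (b - a) * x by rewrite mulr_ge0// subr_ge0.
have m1 : expR (- (a * x)) * (1 - (b - a) * x) <= expR (- (b * x)).
  by rewrite E' ler_wpM2l.
have m2 : expR (- (b * x)) * (1 + (b - a) * x) <= expR (- (a * x)).
  by rewrite E ler_wpM2l.
apply/andP; split; first by nra.
have m3 : expR (- (b * x)) - expR (- (a * x)) <= - ((b - a) * x) * expR (- (b * x)) by nra.
have mx : (1 - expR (- (b * x))) * x <= (1 + b) * Num.min x (x ^+ 2).
  rewrite minEle; case: ifPn => hx.
    have : (1 - expR (- (b * x))) * x <= 1 * x by rewrite ler_wpM2r// gerBl.
    have : 0 <= b * x by rewrite mulr_ge0.
    nra.
  have : (1 - expR (- (b * x))) * x <= b * x * x by rewrite ler_wpM2r//; lra.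
  have := sqr_ge0 x; rewrite !expr2; nra.
have ba : 0 <= b - a by rewrite subr_ge0.
rewrite -mulrA; have := ler_wpM2l ba mx; lra.
Qed.

Lemma branching_kernel0 x : branching_kernel 0 x = 0.
Proof. by rewrite /branching_kernel mul0r oppr0 expR0 subrr addr0. Qed.

Lemma branching_kernel_ge0 l x : 0 <= branching_kernel l x.
Proof. by rewrite /branching_kernel; have := expR_ge1Dx (- (l * x)); lra. Qed.

(** The kernel is convex in [l] and vanishes at 0, so its quotient by [l] is nondecreasing;
    cross-multiplication allows [a = 0]. *)
Lemma branching_kernel_star a b x : 0 <= a -> a <= b ->
  branching_kernel a x * b <= branching_kernel b x * a.
Proof.
move=> a0 ab; rewrite /branching_kernel.
have E' : expR (- (b * x)) = expR (- (a * x)) * expR (- ((b - a) * x)).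
  by rewrite -expRD; congr expR; ring.
have E1 : 1 = expR (- (a * x)) * expR (a * x) by rewrite -expRD addNr expR0.
have ea := expR_ge0 (- (a * x)).
have m1 : expR (- (a * x)) * (1 - (b - a) * x) <= expR (- (b * x)).
  by rewrite E' ler_wpM2l// expR_ge1Dx.
have m2 : expR (- (a * x)) * (1 + a * x) <= 1.
  by rewrite [leRHS]E1 ler_wpM2l// expR_ge1Dx.
have m3 := ler_wpM2l a0 m1.
have ba : 0 <= b - a by rewrite subr_ge0.
have m4 := ler_wpM2l ba m2.
nra.
Qed.

End branching_kernel.

Section branching_facts.
Context {R : realType} (alpha beta : R) (Pi : {measure set R -> \bar R}).
Hypothesis hpsi : branching_parameters alpha beta Pi.
Notation psi := (branching_mechanism alpha beta Pi).
Notation D := (`]0%R, +oo[%classic : set R).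

Lemma measurable_min_sqr : measurable_fun D (fun x : R => Num.min x (x ^+ 2) : R).
Proof.
apply: measurable_funTS; apply: continuous_measurable_fun => x.
by apply: (@continuous_min R R (fun x => x) (fun x => x ^+ 2)); [exact: cvg_id|exact: exprn_continuous].
Qed.

Lemma min_sqr_integrable : Pi.-integrable D (fun x => (Num.min x (x ^+ 2))%:E).
Proof.
apply/integrableP; split; first by apply/measurable_EFinP; exact: measurable_min_sqr.
apply: le_lt_trans (bp_moment hpsi).
rewrite le_eqVlt; apply/orP; left; apply/eqP; apply: eq_integral => x.
rewrite inE/= in_itv/= andbT => x0; rewrite ger0_norm//.
by rewrite le_min ltW//= sqr_ge0.
Qed.

Lemma branching_kernel_integrable l : 0 <= l -> Pi.-integrable D (EFin \o branching_kernel l).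
Proof.
move=> l0; apply: (@le_integrable _ _ _ Pi _ _ _ (fun x => ((l * (1 + l))%:E * (Num.min x (x ^+ 2))%:E)%E)).
- exact: measurable_itv.
- apply/measurable_EFinP; apply: measurable_funTS; apply: continuous_measurable_fun => x.
  apply: cvgD; last by apply: cvgM; [exact: cvg_cst|exact: cvg_id].
  apply: cvgB; last exact: cvg_cst.
  apply: (@continuous_comp R R R (fun x => - (l * x)) (@expR R)); last exact: continuous_expR.
  by apply: cvgN; apply: cvgM; [exact: cvg_cst|exact: cvg_id].
- move=> x /=; rewrite in_itv/= andbT => x0.
  have := @branching_kernel_diff _ 0 l x (lexx _) l0 (ltW x0).
  rewrite branching_kernel0 !subr0 => /andP[h1 h2].
  rewrite lee_fin !ger0_norm ?branching_kernel_ge0//.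
  exact: le_trans h2.
- by apply: integrableZl; [exact: measurable_itv|exact: min_sqr_integrable].
Qed.

Let Ik l := \int[Pi]_(x in D) branching_kernel l x.

Lemma branching_mechanismE l : psi l = - alpha * l + beta * l ^+ 2 + Ik l.
Proof. by []. Qed.

Lemma branching_mechanism0 : psi 0 = 0.
Proof.
rewrite branching_mechanismE /Ik mulr0 expr0n mulr0 !add0r.
under eq_Rintegral do rewrite branching_kernel0.
by rewrite Rintegral_cst// mul0r.
Qed.

Lemma branching_mechanism_star a b : 0 <= a -> a <= b -> psi a * b <= psi b * a.
Proof.
move=> a0 ab; have b0 := le_trans a0 ab.
have Ia := branching_kernel_integrable a0; have Ib := branching_kernel_integrable b0.
have : b * Ik a <= a * Ik b.
  rewrite /Ik -!RintegralZl//; apply: le_Rintegral => //.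
  - exact: (integrableZl _ b Ia).
  - exact: (integrableZl _ a Ib).
  - by move=> x _; rewrite mulrC [leRHS]mulrC branching_kernel_star.
have : 0 <= beta * (a * b * (b - a)).
  by rewrite mulr_ge0 ?(bp_beta_ge0 hpsi)// !mulr_ge0// subr_ge0.
rewrite !branching_mechanismE; nra.
Qed.

Lemma branching_mechanism_lipschitz (M : R) : 0 <= M ->
  exists2 K, 0 <= K & forall a b, 0 <= a <= M -> 0 <= b <= M -> `|psi a - psi b| <= K * `|a - b|.
Proof.
move=> M0.
pose I1 := \int[Pi]_(x in D) (Num.min x (x ^+ 2) : R).
have I10 : 0 <= I1.
  apply: Rintegral_ge0 => x /=; rewrite in_itv/= andbT => x0.
  by rewrite le_min ltW//= sqr_ge0.
pose K := `|alpha| + beta * (2 * M) + (1 + M) * I1.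
have b0 := bp_beta_ge0 hpsi.
have K0 : 0 <= K by rewrite !addr_ge0 ?normr_ge0// !mulr_ge0// addr_ge0.
exists K => //.
suff H a b : 0 <= a -> a <= b -> b <= M -> `|psi a - psi b| <= K * (b - a).
  move=> a b /andP[a0 aM] /andP[b0' bM].
  have [ab|ba] := leP a b.
    by rewrite [X in _ <= K * X]distrC [X in _ <= K * X]ger0_norm ?subr_ge0//; apply: H.
  by rewrite distrC [X in _ <= K * X]ger0_norm ?subr_ge0 ?(ltW ba)//; apply: H => //; exact: ltW.
move=> a0 ab bM; have b0' := le_trans a0 ab.
have Ia := branching_kernel_integrable a0; have Ib := branching_kernel_integrable b0'.
have Im := min_sqr_integrable.
have IB : Pi.-integrable D (EFin \o (fun x => branching_kernel b x - branching_kernel a x)).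
  by apply: eq_integrable (integrableB _ Ib Ia) => // x _.
have E : Ik b - Ik a = \int[Pi]_(x in D) (branching_kernel b x - branching_kernel a x).
  by rewrite RintegralB.
have E0 : 0 <= Ik b - Ik a.
  rewrite E; apply: Rintegral_ge0 => x /=; rewrite in_itv/= andbT => x0.
  by have /andP[] := branching_kernel_diff a0 ab (ltW x0).
have E1 : Ik b - Ik a <= (b - a) * (1 + b) * I1.
  rewrite E /I1 -RintegralZl//; apply: le_Rintegral => //.
    by apply: (integrableZl _ ((b - a) * (1 + b)) Im).
  move=> x /=; rewrite in_itv/= andbT => x0.
  by have /andP[] := branching_kernel_diff a0 ab (ltW x0).
have ba : 0 <= b - a by rewrite subr_ge0.
have E2 : (b - a) * (1 + b) * I1 <= (b - a) * ((1 + M) * I1).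
  by rewrite -mulrA ler_wpM2l// ler_wpM2r// lerD2l.
have E3 : beta * ((b - a) * (a + b)) <= beta * ((b - a) * (2 * M)).
  by rewrite ler_wpM2l// ler_wpM2l//; lra.
have E4 : 0 <= beta * ((b - a) * (a + b)) by rewrite !mulr_ge0// addr_ge0.
have E5 : - (`|alpha| * (b - a)) <= alpha * (b - a) <= `|alpha| * (b - a).
  by rewrite -ler_norml normrM (ger0_norm ba).
rewrite ler_norml !branching_mechanismE /K; move/andP: E5 => [E5 E6]; apply/andP; split; nra.
Qed.

(** The Lipschitz bound covers nonnegative arguments only; clamping gives continuity on the whole
    line. *)
Lemma continuous_branching_mechanism : continuous (fun l : R => psi (Num.max l 0)).
Proof.
move=> l; pose M := Num.max l 0 + 1.
have M0 : 0 <= M by rewrite addr_ge0// le_max lexx orbT.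
have [K K0 HK] := branching_mechanism_lipschitz M0.
have cm : {for l, continuous (fun l : R => Num.max l 0)}.
  by apply: continuous_max; [exact: cvg_id|exact: cvg_cst].
apply/cvgrPdist_le => e e0.
have e1 : 0 < Num.min 1 (e / (K + 1)) by rewrite lt_min ltr01 divr_gt0// ltr_wpDl.
move/cvgrPdist_le : cm => /(_ _ e1); apply: filterS => y.
rewrite le_min => /andP[h1 h2].
have m0 z : 0 <= Num.max z 0 :> R by rewrite le_max lexx orbT.
rewrite (le_trans (HK _ _ _ _))//.
- by rewrite m0 /M lerDl ler01.
- by rewrite m0 /M; move: h1; rewrite ler_norml => /andP[? ?]; lra.
move: h2; rewrite ler_pdivlMr ?ltr_wpDl// => h2.
have := normr_ge0 (Num.max l 0 - Num.max y 0); nra.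
Qed.

Lemma branching_ratio_lbound :
  has_lbound ((fun h => (psi h - psi 0) / h) @` `]0, 1[).
Proof.
have [K K0 HK] := branching_mechanism_lipschitz ler01.
exists (- K); move=> t [h /=]; rewrite in_itv/= => /andP[h0 h1] <-.
rewrite ler_pdivlMr//.
have := HK h 0; rewrite !lexx ler01 (ltW h0) (ltW h1) => /(_ isT isT).
by rewrite subr0 [X in _ <= _ * X -> _]gtr0_norm// ler_norml => /andP[]; rewrite mulNr.
Qed.

(** The quotient is nondecreasing by [branching_mechanism_star] and bounded below by the Lipschitz
    property. This shows that the [lim] defining [deriv_at_0plus] is a genuine limit and an
    infimum. *)
Lemma cvg_branching_ratio :
  (psi h - psi 0) / h @[h --> 0^'+] --> inf ((fun h => (psi h - psi 0) / h) @` `]0, 1[).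
Proof.
apply: (@nondecreasing_at_right_cvgr R (fun h => (psi h - psi 0) / h) 0 (BLeft 1)).
- by rewrite bnd_simp.
- move=> a b; rewrite !in_itv/= => /andP[a0 _] /andP[b0 _] ab.
  rewrite branching_mechanism0 !subr0 ler_pdivrMr// mulrAC ler_pdivlMr//.
  by rewrite branching_mechanism_star// ltW.
- exact: branching_ratio_lbound.
Qed.

(** The derivative at 0 is a lower bound of all quotients on []0, 1[], so [psi] is nonnegative
    there. *)
Lemma subcritical_ge0 : subcritical psi -> forall l, 0 <= l -> 0 <= psi l.
Proof.
rewrite /subcritical /deriv_at_0plus (cvg_lim _ cvg_branching_ratio)// => L0.
have H h : 0 < h -> h < 1 -> 0 <= psi h.
  move=> h0 h1; have : 0 <= psi h / h.
    rewrite (le_trans L0)//; apply: ge_inf; first exact: branching_ratio_lbound.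
    by exists h; rewrite /= ?in_itv/= ?h0// branching_mechanism0 subr0.
  by rewrite pmulr_lge0 ?invr_gt0.
move=> l; rewrite le_eqVlt => /predU1P[<-|l0]; first by rewrite branching_mechanism0.
have [l1|l1] := ltP l 1; first exact: H.
(* Beyond 1, the star property carries the sign over from the point 1/2. *)
have h12 : 0 <= psi (1/2) by apply: H; lra.
have h12l : 1/2 <= l by lra.
have := @branching_mechanism_star (1/2) l ltac:(lra) h12l.
have := mulr_ge0 h12 (ltW l0); lra.
Qed.

(** By the star property [psi] cannot be positive before a point [h] where it is negative, nor
    negative after a point where it is positive; continuity gives the zero at the boundary. The
    condition [bp_infty] ensures that the infimum is over a nonempty set. *)
Lemma supercritical_critical : supercritical psi ->
  let L := lambda_star psi in
  [/\ 0 < L, psi L = 0, (forall l, 0 <= l <= L -> psi l <= 0) & (forall l, L <= l -> 0 <= psi l)].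
Proof.
move=> + L; rewrite /supercritical /deriv_at_0plus (cvg_lim _ cvg_branching_ratio)// => I0.
have [h h0 ph] : exists2 h, 0 < h & psi h < 0.
  near (0 : R)^'+ => h; exists h; first by near: h; exact: nbhs_right_gt.
  have : (psi h - psi 0) / h < 0 by near: h; apply: (cvgr_lt _ cvg_branching_ratio).
  rewrite branching_mechanism0 subr0 pmulr_llt0// invr_gt0.
  by near: h; exact: nbhs_right_gt.
pose A := [set l : R | 0 <= l /\ 0 < psi l].
have Ah l : A l -> h < l.
  move=> [l0 pl]; rewrite ltNge; apply/negP => lh.
  have := branching_mechanism_star l0 lh.
  have := mulr_gt0 pl h0; have := mulr_le0_ge0 (ltW ph) l0; lra.
have A0 : A !=set0.
  have := bp_infty hpsi => /cvgryPgt/(_ 0) H.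
  near (pinfty_nbhs R) => l; exists l; split; first by near: l; exact: nbhs_pinfty_ge.
  by near: l.
have Alb : has_lbound A by exists h => l /Ah /ltW.
have L0 : 0 < L by rewrite (lt_le_trans h0)//; apply: lb_le_inf => // l /Ah /ltW.
have ltL l : 0 <= l < L -> psi l <= 0.
  move=> /andP[l0 lL]; rewrite leNgt; apply/negP => pl.
  by have := @ge_inf _ A Alb l (conj l0 pl); rewrite leNgt lL.
have gtL l : L < l -> 0 <= psi l.
  move=> Ll; have [a Aa al] := inf_lt A0 Ll.
  have [a0 pa] := Aa; have l0 : 0 < l := lt_trans L0 Ll.
  have := branching_mechanism_star a0 (ltW al).
  have := mulr_gt0 pa l0 => h1 h2.
  have a1 : 0 < a := lt_trans h0 (Ah _ Aa).
  by rewrite -(pmulr_lge0 _ a1) (le_trans (ltW h1)).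
have psiE l : 0 <= l -> psi (Num.max l 0) = psi l by move=> ?; rewrite max_l.
have cL : psi (Num.max l 0) @[l --> L] --> psi L.
  by rewrite -[X in _ --> X](psiE L (ltW L0)); exact: continuous_branching_mechanism.
have psiL : psi L = 0.
  apply/eqP; rewrite eq_le; apply/andP; split.
    apply: (cvgr_to_le (cvg_at_left_filter cL)).
    near=> l; rewrite psiE; last by near: l; exact: nbhs_left_ge.
    apply: ltL; apply/andP; split; first by near: l; exact: nbhs_left_ge.
    by near: l; exact: nbhs_left_lt.
  apply: (cvgr_to_ge (cvg_at_right_filter cL)).
  near=> l; have Ll : L < l by near: l; exact: nbhs_right_gt.
  by rewrite psiE ?gtL// ltW// (lt_trans L0).
split => //.
- move=> l /andP[l0]; rewrite le_eqVlt => /predU1P[->|lL]; first by rewrite psiL.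
  by apply: ltL; rewrite l0.
- by move=> l; rewrite le_eqVlt => /predU1P[<-|/gtL//]; rewrite psiL.
Unshelve. all: by end_near. Qed.

End branching_facts.

(** * The exponent of the total mass *)

Section spheres.
Context {R : realType} {d : nat}.

Lemma measurable_enorm : measurable_fun setT (@enorm R d).
Proof.
apply: (measurableT_comp (f := @Num.sqrt R) (g := @sqn R d)); last exact: measurable_sqn.
by apply: continuous_measurable_fun; exact: sqrt_continuous.
Qed.

Lemma measurable_esphere (s : R) : measurable (esphere d s).
Proof.
rewrite (_ : esphere d s = setT `&` (@enorm R d) @^-1` [set s]); last by rewrite setTI.
by apply: measurable_enorm => //; exact: measurable_set1.
Qed.

Lemma enorm_surj (r : R) : (0 < d)%N -> 0 <= r -> exists x : 'rV[R]_d, enorm x = r.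
Proof.
move=> d0 r0; exists (\row_i (if i == Ordinal d0 then r else 0)).
rewrite /enorm (bigD1 (Ordinal d0))//= big1 ?addr0.
  by rewrite mxE eqxx sqrtr_sqr ger0_norm.
by move=> i i0; rewrite mxE (negbTE i0) expr0n.
Qed.

End spheres.

Section exit_mass.
Context {R : realType} {d : nat}.
Hypothesis d0 : (0 < d)%N.
Context {dispX : measure_display} {OmX : measurableType dispX}.
Variables (v : ('rV[R]_d -> R) -> R -> 'rV[R]_d -> R)
  (X : R -> R.-ker OmX ~> 'rV[R]_d)
  (PX : R -> {finite_measure set 'rV[R]_d -> \bar R} -> probability OmX R)
  (u : R -> R -> R -> R).
Hypothesis hX : exit_measure_family v X PX.
Hypothesis hu : mass_exponent X PX u.
Hypothesis mv : forall theta s, 0 < theta -> 0 < s -> measurable_fun (ecball d s) (v (cst theta) s).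

Lemma pos_bdd_continuous_on_cst (A : set 'rV[R]_d) (theta : R) : 0 < theta ->
  pos_bdd_continuous_on A (cst theta).
Proof.
by move=> t0; split => //; [exact: cst_continuous|exists theta].
Qed.

(** A unit mass at one point of the sphere is enough to read off [u]. *)
Let delta (x : 'rV[R]_d) : {finite_measure set 'rV[R]_d -> \bar R} := \d_x.

Let delta_sphere x : delta x (~` esphere d (enorm x)) = 0%E.
Proof. by rewrite /delta /= diracE memNset// => /(_ erefl). Qed.

Let delta1 x : delta x setT = 1%:E.
Proof. by rewrite /delta /= diracE mem_set. Qed.

(** For [theta > 0] the two conventions at infinite mass agree: the exponent is [-oo], sent to 0 by
    [expeR]. *)
Lemma exp_massE (theta s : R) (w : OmX) : 0 < theta -> 0 < s ->
  expeR (- \int[X s w]_(x in esphere d s) (cst theta x)%:E)%E = exp_mass theta (total_mass X s w).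
Proof.
move=> t0 s0; rewrite (integral_cst _ (measurable_esphere s) theta%:E).
have -> : X s w (esphere d s) = total_mass X s w.
  rewrite /total_mass -(setUv (esphere d s)) measureU//; last 3 first.
  - exact: measurable_esphere.
  - by apply: measurableC; exact: measurable_esphere.
  - by rewrite setICr.
  by rewrite [X in (_ + X)%E](em_support hX w s0) adde0.
have : (0 <= total_mass X s w)%E := measure_ge0 (X s w) setT.
case: (total_mass X s w) => [m|_|]//=.
by rewrite gt0_muley ?lte_fin.
Qed.

Lemma exp_mass_integrable (x : 'rV[R]_d) (theta s : R) : 0 < theta -> 0 < enorm x ->
  enorm x <= s ->
  (PX (enorm x) (delta x)).-integrable setT (fun w => exp_mass theta (total_mass X s w)).
Proof.
move=> t0 x0 xs; have s0 := lt_le_trans x0 xs.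
have [Y _ _ _] := em_markov hX x0 (delta_sphere x) (lexx _) xs
  (pos_bdd_continuous_on_cst (esphere d s) t0).
by apply: eq_integrable Y => // w _; rewrite exp_massE.
Qed.

(** The Markov property at the starting radius, integrated over the whole space: by [em_start] the
    measure there is almost surely the Dirac mass at [x], so the conditional expectation is
    constant. *)
Lemma exit_solution_cst (x : 'rV[R]_d) (theta s : R) : 0 < theta -> 0 < enorm x ->
  enorm x <= s -> v (cst theta) s x = u (enorm x) s theta.
Proof.
move=> t0 x0 xs; have s0 := lt_le_trans x0 xs.
have [IY IW _ /(_ setT)] := em_markov hX x0 (delta_sphere x) (lexx _) xs
  (pos_bdd_continuous_on_cst (esphere d s) t0).
have GT : exit_filtration X (enorm x) (enorm x) setT.
  by move=> B [[B0 BC _] _]; rewrite -setC0 -setTD; exact: BC.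
move=> /(_ GT).
under eq_integral do rewrite exp_massE//.
rewrite (hu x0 xs (ltW t0) ltr01 (delta_sphere x) (delta1 x)).
set W := (X in _ = (\int[_]_w X w)%E -> _).
rewrite (@ae_eq_integral _ _ _ _ _ (cst (expR (- v (cst theta) s x))%:E) W) //.
- rewrite integral_cst// [X in (_ * X)%E]probability_setT mule1 => -[] /expR_inj/oppr_inj.
  by rewrite mulr1.
- by case/integrableP : IW.
- have := em_start hX x0 (delta_sphere x); apply: filterS => w Hw _.
  rewrite /W (@eq_measure_integral _ _ _ _ (delta x)); last by move=> A mA _; exact: Hw.
  rewrite integral_dirac//=.
  + by rewrite indicE mem_set// mul1r.
  + exact: measurable_esphere.
  + apply/measurable_EFinP; apply: (measurable_funS _ _ (mv t0 s0)).
      rewrite (_ : ecball d s = setT `&` (@enorm R d) @^-1` `]-oo, s]).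
        by apply: measurable_enorm => //; exact: measurable_itv.
      by rewrite setTI; apply/seteqP; split => y /=; rewrite in_itv.
    by move=> y; rewrite /esphere/ecball/= => ->.
Qed.

Lemma mass_exponent_mono (r s theta eta : R) : 0 < r -> r <= s -> 0 < theta -> theta <= eta ->
  u r s theta <= u r s eta.
Proof.
move=> r0 rs t0 te; have [x xr] := enorm_surj d0 (ltW r0).
have e0 := lt_le_trans t0 te.
have xs : enorm x <= s by rewrite xr.
rewrite -xr in r0; have s0 := lt_le_trans r0 xs.
have := hu r0 xs (ltW t0) ltr01 (delta_sphere x) (delta1 x).
have := hu r0 xs (ltW e0) ltr01 (delta_sphere x) (delta1 x).
rewrite !mulr1 xr => E1 E2.
have : ((expR (- u r s eta))%:E <= (expR (- u r s theta))%:E)%E.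
  rewrite -E1 -E2 -xr; apply: le_integral => //; [exact: exp_mass_integrable..|].
  move=> w _; rewrite /exp_mass; case: total_mass (measure_ge0 (X s w) setT : (0 <= total_mass X s w)%E) => [m| |]//.
  rewrite !lee_fin => m0; rewrite ler_expR lerN2 ler_wpM2r//.
by rewrite lee_fin ler_expR lerN2.
Qed.

End exit_mass.

(** For a function that is only bounded below, whose positive part may have infinite integral. This
    is all that is available before the exponent is known to be bounded. *)
Lemma ge_integral_xsection {R : realType} {dd1 dd2 : measure_display}
    {T1 : measurableType dd1} {T2 : measurableType dd2}
    (m1 : {sigma_finite_measure set T1 -> \bar R})
    (m2 : {sigma_finite_measure set T2 -> \bar R})
    (E : set (T1 * T2)) (f : T1 * T2 -> R) (K : R) :
  measurable E -> ((m1 \x m2) E < +oo)%E -> measurable_fun E f -> 0 <= K ->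
  (forall u, E u -> - K <= f u) ->
  (- (K%:E * (m1 \x m2) E) <= \int[m1]_w \int[m2]_(z in xsection E w) (f (w, z))%:E)%E.
Proof.
move=> mE Efin mf K0 fK.
have mfe : measurable_fun E (EFin \o f) by exact/measurable_EFinP.
pose Ip w := (\int[m2]_(z in xsection E w) ((EFin \o f)^\+ (w, z)))%E.
pose In w := (\int[m2]_(z in xsection E w) ((EFin \o f)^\- (w, z)))%E.
have mIp : measurable_fun setT Ip.
  by apply: (measurable_ge0_integral_xsection m2 mE); [exact: measurable_funepos|].
have mIn : measurable_fun setT In.
  by apply: (measurable_ge0_integral_xsection m2 mE); [exact: measurable_funeneg|].
have IE w : (\int[m2]_(z in xsection E w) (f (w, z))%:E = Ip w - In w)%E.
  by rewrite integralE; congr (_ - _)%E; apply: eq_integral => z _; rewrite ?funeposE ?funenegE.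
under eq_integral do rewrite IE.
have mI : measurable_fun setT (fun w => Ip w - In w)%E by exact: emeasurable_funB.
have Ip0 w : (0 <= Ip w)%E by apply: integral_ge0 => z _; exact: funepos_ge0.
have In0 w : (0 <= In w)%E by apply: integral_ge0 => z _; exact: funeneg_ge0.
have InE : (\int[m1]_w In w <= K%:E * (m1 \x m2) E)%E.
  rewrite ge0_integral_xsection//; last exact: measurable_funeneg.
  rewrite -integral_cst//; apply: ge0_le_integral => //.
  - exact: measurable_funeneg.
  - by move=> u /fK fu; rewrite funenegE ge_max -EFinN !lee_fin K0 andbT lerNl.
rewrite integralE.
rewrite -[leLHS]add0e leeD//; first by apply: integral_ge0 => w _; exact: funepos_ge0.
rewrite leeN2; apply: le_trans InE; apply: ge0_le_integral => //.
- exact: measurable_funeneg.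
- move=> w _; rewrite funenegE ge_max In0 andbT.
  have := Ip0 w; have := In0 w.
  case: (In w) => [a| |]//; case: (Ip w) => [b| |]//=; rewrite ?lee_fin ?leNye//.
  by move=> a0 b0; rewrite opprB gerBl.
Qed.

Lemma within_continuous_comp {R : realType} (f g : R -> R) (A : set R) (r : R) :
  {within A, continuous f} -> {for r, continuous g} -> (\forall z \near r, A (g z)) ->
  {for r, continuous (f \o g)}.
Proof.
move=> /subspace_continuousP cf cg Ag.
have := cf _ (nbhs_singleton Ag); apply: cvg_comp => B; rewrite /within/= => HB.
have := cg _ HB; rewrite /= => H.
by near=> z; have : A (g z) -> B (g z); [near: z|apply; near: z].
Unshelve. all: by end_near. Qed.

Lemma is_derive_diff_quotient {R : realType} (G : R -> R) (s dG : R) : is_derive s 1 G dG ->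
  (G y - G s) / (y - s) @[y --> s^'] --> dG.
Proof.
case=> dv dE; have : h^-1 *: (G (h *: 1 + s) - G s) @[h --> 0^'] --> dG.
  by rewrite -dE; exact: dv.
move=> /cvgrPdist_le H; apply/cvgrPdist_le => e e0; have := H e e0.
move=> /nbhs_ballP[del /= del0 Hdel].
apply/nbhs_ballP; exists del => //= y ys yns.
have := Hdel (y - s); rewrite /ball/= sub0r opprB => /(_ ys).
rewrite subr_eq0 => /(_ yns).
by rewrite /GRing.scale/= mulr1 subrK mulrC.
Qed.

(** * The exponent as a radial potential *)

Section mass_profile.
Context {R : realType} {d : nat}.
Hypothesis d0 : (0 < d)%N.
Context (alpha beta : R) (Pi : {measure set R -> \bar R}).
Hypothesis hpsi : branching_parameters alpha beta Pi.
Notation psi := (branching_mechanism alpha beta Pi).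
Context {dispW : measure_display} {OmW : measurableType dispW}
  (PW : probability OmW R) (W : R -> OmW -> 'rV[R]_d).
Hypothesis hW : brownian_motion PW W.
Notation leb := (@lebesgue_measure R).
Notation PL := (PW \x leb)%E.
Variables (s theta : R) (v : 'rV[R]_d -> R) (U : R -> R) (K : R).
Hypotheses (s0 : 0 < s) (K0 : 0 <= K).
Hypothesis psiK : forall l, 0 <= l -> - K <= psi l.
Hypothesis vsol : nonneg_exit_solution PW W psi (cst theta) s v.
Hypothesis vU : forall x, 0 < enorm x -> enorm x <= s -> v x = U (enorm x).
Hypothesis Uc : forall a, 0 < a -> {within `[a, s], continuous U}.
Hypothesis Us : U s = theta.

(** [psi] along the exponent, in the variable q = r^2. The radius is clamped at [s] and the argument
    of [psi] at 0, which makes the function continuous on all positive [q], also beyond the ball;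
    the centre takes the value of the exit solution. *)
Definition mass_potential (q : R) : R :=
  psi (Num.max (if 0 < q then U (Num.min (Num.sqrt q) s) else v 0) 0).

Let h := mass_potential.

Lemma mass_profile_ge0 (r : R) : 0 < r -> r <= s -> 0 <= U r.
Proof.
move=> r0 rs; have [x xr] := @enorm_surj R d r d0 (ltW r0).
by rewrite -xr -vU ?xr//; have [_ v0 _] := vsol; apply: v0; rewrite xr.
Qed.

Lemma mass_potentialE (r : R) : 0 < r -> r <= s -> h (r ^+ 2) = psi (U r).
Proof.
move=> r0 rs; rewrite /h /mass_potential exprn_gt0// sqrtr_sqr gtr0_norm//.
by rewrite min_l// max_l// mass_profile_ge0.
Qed.

Lemma mass_potential_exit (x : 'rV[R]_d) : enorm x <= s -> psi (v x) = h (sqn x).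
Proof.
move=> xs; have [_ v0 _] := vsol.
have [x0|x0] := eqVneq (enorm x) 0; last first.
  have x1 : 0 < enorm x by rewrite lt_neqAle eq_sym x0 enorm_ge0.
  by rewrite -enorm_sqr mass_potentialE// vU.
have x00 : x = 0.
  apply/rowP => i; rewrite mxE; have := enorm_sqr x; rewrite x0 expr0n/= => /esym/eqP.
  rewrite psumr_eq0 => [/allP/(_ i)|? _]; last exact: sqr_ge0.
  by rewrite mem_index_enum sqrf_eq0 => /(_ isT)/eqP.
rewrite -enorm_sqr x0 expr0n/= /h /mass_potential ltxx max_l ?x00//.
by apply: v0; rewrite -x00.
Qed.

Lemma mass_potential_ge (q : R) : - K <= h q.
Proof. by apply: psiK; rewrite le_max lexx orbT. Qed.

Lemma continuous_mass_profile (r : R) : 0 < r ->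
  {for r, continuous (fun r : R => U (Num.min r s))}.
Proof.
move=> r0; apply: (@within_continuous_comp _ U (fun r : R => Num.min r s) `[Num.min (r / 2) s, s]).
- by apply: Uc; rewrite lt_min s0 divr_gt0.
- by apply: (@continuous_min R R (fun r => r) (cst s)); [exact: cvg_id|exact: cst_continuous].
- near=> z; rewrite /= in_itv/=; apply/andP; split; last by rewrite ge_min lexx orbT.
  have rz : r / 2 <= z by apply: ltW; near: z; apply: lt_nbhsr; rewrite ltr_pdivrMr// ltr_pMr// ltr1n.
  by rewrite le_min !ge_min rz lexx !orbT.
Unshelve. all: by end_near. Qed.

Lemma continuous_mass_potential (q : R) : 0 < q -> {for q, continuous h}.
Proof.
move=> q0; have H : \forall y \near q, psi (Num.max (U (Num.min (Num.sqrt y) s)) 0) = h y.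
  near=> y; have y0 : 0 < y by near: y; exact: lt_nbhsr.
  by rewrite /h /mass_potential y0.
rewrite /prop_for /continuous_at -(nbhs_singleton H).
apply: cvg_trans; first exact: (near_eq_cvg H).
apply: (@continuous_comp R R R (fun y => U (Num.min (Num.sqrt y) s)) (fun l => psi (Num.max l 0)));
  last exact: continuous_branching_mechanism.
apply: (@continuous_comp R R R Num.sqrt (fun r => U (Num.min r s))); first exact: sqrt_continuous.
by apply: continuous_mass_profile; rewrite sqrtr_gt0.
Unshelve. all: by end_near. Qed.

Let mE x := measurable_occ_set hW x s0.
Let Efin x := PL_occ_set_lty hW x s0 d0.

Let qs x u : occ_set W x s u -> 0 <= sqdist W x u.1 u.2 < s ^+ 2.
Proof. by move=> uo; exact: (occ_set_sqdist hW s0 uo). Qed.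

(** [h] is not yet known to be bounded near 0, hence a double approximation: truncation at [k], then
    [radial_approx]. *)
Lemma measurable_mass_potential x :
  measurable_fun (occ_set W x s) (fun u => h (sqdist W x u.1 u.2)).
Proof.
apply: (measurable_fun_cvg (h := fun (k : nat) (u : OmW * measurableTypeR R) =>
  Num.min (h (sqdist W x u.1 u.2)) k%:R : measurableTypeR R)).
  move=> k; have hk : radial_class (fun q => Num.min (h q) k%:R).
    split.
      move=> q q0; apply: (@continuous_min R R h (cst k%:R)); last exact: cst_continuous.
      exact: continuous_mass_potential.
    move=> y; exists (K + k%:R) => q _; rewrite ler_norml; have := mass_potential_ge q.
    have k0 : 0 <= k%:R :> R by [].
    rewrite le_min ge_min => hq; apply/andP; split; last by rewrite lerDr K0 orbT.
    by rewrite (le_trans _ hq) ?lerN2 ?lerDl//= (le_trans _ k0)// oppr_le0 addr_ge0.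
  apply: (measurable_fun_cvg (h := fun (n : nat) (u : OmW * measurableTypeR R) =>
    radial_approx (fun q => Num.min (h q) k%:R) n (sqdist W x u.1 u.2) : measurableTypeR R)).
    by move=> n; apply: (measurable_sqdist_comp hW); exact: continuous_radial_approx.
  by move=> u /qs/andP[q0 _]; exact: cvg_radial_approx.
move=> u _; apply: cvg_near_cst; near=> k; apply/min_idPl.
by near: k; exact: nbhs_infty_ger.
Unshelve. all: by end_near. Qed.

Let exit_eq x : enorm x <= s ->
  (\int[PW]_w \int[leb]_(z in xsection (occ_set W x s) w) (h (sqdist W x w z))%:E =
   theta%:E - (v x)%:E)%E.
Proof.
move=> xs; have [_ _ /(_ x xs)] := vsol; rewrite /= integral_cst//.
rewrite [X in (_ * X)%E]probability_setT mule1.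
set I := (X in (_ = _ - X)%E -> _); set J := (X in _ -> X = _).
have -> : I = J.
  apply: eq_integral => w _; rewrite xsection_occ_set.
  apply: eq_integral => z /set_mem[z0 zT].
  have zo : occ_set W x s (w, z) by [].
  have /andP[_ qz] := qs zo.
  rewrite sqdistE//= mass_potential_exit//.
  by rewrite ltW// enorm_ltE// -?(sqdistE _ _ _ z0)// ltW.
(* The left side of the exit equation is finite, which forces [J] to be finite and allows it to
   change sides. *)
by case: J => [j| |]//= [->]; rewrite -EFinD; congr (_%:E); ring.
Qed.

(** Since [h] is at least [- K], the exit equation gives [theta - U r >= - K] times the expected
    exit time, which is the potential of the constant 1 and at most [2 * s ^+ 2]. *)
Lemma mass_profile_bound (r : R) : 0 < r -> r <= s -> U r <= theta + K * (2 * s ^+ 2).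
Proof.
move=> r0; rewrite le_eqVlt => /predU1P[->|rs].
  by rewrite Us lerDl mulr_ge0// mulr_ge0// sqr_ge0.
have [x xr] := @enorm_surj R d r d0 (ltW r0).
have xs : enorm x < s by rewrite xr.
have x0 : 0 < enorm x by rewrite xr.
have : (- (K%:E * PL (occ_set W x s)) <= theta%:E - (U r)%:E)%E.
  rewrite -xr -(vU x0 (ltW xs)) -(exit_eq (ltW xs)).
  exact: (ge_integral_xsection (mE x) (Efin x) (@measurable_mass_potential x) K0
    (fun u _ => mass_potential_ge (sqdist W x u.1 u.2))).
have M1 : fine (PL (occ_set W x s)) <= 2 * s ^+ 2.
  have c1 : radial_class (cst (1 : R)) by apply: continuous_radial_class; exact: cst_continuous.
  have := Rintegral_occ_set hW s0 d0 x0 xs c1; rewrite /= Rintegral_cst// mul1r => ->.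
  rewrite -[leRHS]mulr1 (le_trans (ler_norm _))//; apply: radial_potential_le => //; first exact: ltW.
  by move=> q _; rewrite normr1.
have fm : PL (occ_set W x s) \is a fin_num by rewrite ge0_fin_numE// Efin.
rewrite -(fineK fm).
rewrite -EFinM -EFinN -EFinB lee_fin => H.
have := ler_wpM2l K0 M1; lra.
Qed.

(** The a priori bound confines the argument of [psi] to a compact interval, so [h] is bounded; from
    here on Fubini is available. *)
Lemma mass_potential_class : radial_class h.
Proof.
split; first exact: continuous_mass_potential.
pose B := Num.max (theta + K * (2 * s ^+ 2)) (Num.max (v 0) 0).
have B0 : 0 <= B by rewrite !le_max lexx !orbT.
have [C C0 HC] := branching_mechanism_lipschitz hpsi B0.
move=> y; exists (C * B) => q _; rewrite /h /mass_potential.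
set l := Num.max _ 0.
have l0 : 0 <= l by rewrite le_max lexx orbT.
have lB : l <= B.
  rewrite ge_max B0 andbT; case: ifPn => q0; last by rewrite !le_max lexx orbT.
  rewrite le_max mass_profile_bound// ?ge_min ?lexx ?orbT//.
  by rewrite lt_min sqrtr_gt0 q0.
have := HC l 0; rewrite l0 lB lexx B0 branching_mechanism0 !subr0 => /(_ isT isT); rewrite (ger0_norm l0).
by move=> /le_trans; apply; rewrite ler_wpM2l.
Qed.

Lemma mass_profileE (r : R) : 0 < r -> r <= s -> U r = theta - radial_potential d r s h.
Proof.
move=> r0; rewrite le_eqVlt => /predU1P[->|rs].
  by rewrite /radial_potential set_itv1 Rintegral_set1 subr0 Us.
have [x xr] := @enorm_surj R d r d0 (ltW r0).
have xs : enorm x < s by rewrite xr.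
have x0 : 0 < enorm x by rewrite xr.
have hc := mass_potential_class.
have := exit_eq (ltW xs); rewrite (@integral_xsection _ _ _ _ _ _ _ _ (mE x)
  (fun u => (h (sqdist W x u.1 u.2))%:E)); last first.
  have [M HM] := hc.2 (s ^+ 2).
  apply: (bounded_integrable (mE x) (Efin x) (C := M)); first exact: measurable_mass_potential.
  by move=> u /qs/andP[q0 /ltW q1]; apply: HM; rewrite q0.
move=> /(congr1 fine); rewrite -[LHS]/(\int[PL]_(u in occ_set W x s) h (sqdist W x u.1 u.2)).
by rewrite (Rintegral_occ_set hW)// (vU x0 (ltW xs)) xr => ->/=; ring.
Qed.

(** Agrees with [U] on [[a, s]] but is differentiable beyond [s] as well; the left derivative of [U]
    at [s] is thus an ordinary derivative of [G]. *)
Let G (a r : R) : R := theta - radial_potential d a s h + radial_potential d a r h.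

Let dG (a r : R) : 0 < a -> a < r -> is_derive r 1 (G a) (radial_flux d h r).
Proof.
move=> a0 ar; have r0 := lt_trans a0 ar; have hc := mass_potential_class.
have [||||d1 d2] := @continuous_FTC1_closed R (radial_flux d h) a r (r + 1).
- by rewrite ltrDl.
- exact: integrable_radial_flux.
- by [].
- exact: continuous_radial_flux.
- have h1 : is_derive r 1 (fun r => radial_potential d a r h) (radial_flux d h r).
    by rewrite -d2 derive1E; exact/derivableP.
  have h2 := is_derive_cst (theta - radial_potential d a s h) r 1.
  by have := is_deriveD h2 h1; rewrite add0r.
Qed.

Let UG (a r : R) : 0 < a -> a <= r -> r <= s -> U r = G a r.
Proof.
move=> a0 ar rs; have r0 := lt_le_trans a0 ar; have hc := mass_potential_class.
have E : radial_potential d a s h - radial_potential d a r h = radial_potential d r s h.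
  rewrite /radial_potential Rintegral_itvB//; last exact: integrable_radial_flux.
  rewrite Rintegral_itv_obnd_cbnd//; apply: (@integrableS _ _ _ leb `[r, s]) => //; last exact: integrable_radial_flux.
  exact: subset_itv_oc_cc.
by rewrite mass_profileE// /G -E; ring.
Qed.

Lemma is_derive_mass_profile (r : R) : 0 < r -> r < s -> is_derive r 1 U (radial_flux d h r).
Proof.
move=> r0 rs; have r20 : 0 < r / 2 by rewrite divr_gt0.
have rr : r / 2 < r by rewrite ltr_pdivrMr// ltr_pMr// ltr1n.
apply: near_eq_is_derive (dG r20 rr); near=> y; apply/esym; apply: UG => //.
- by apply: ltW; near: y; exact: lt_nbhsr.
- by apply: ltW; near: y; exact: lt_nbhsl.
Unshelve. all: by end_near. Qed.

Lemma mass_profile_left_derivative :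
  (U r - U s) / (r - s) @[r --> s^'-] --> radial_flux d h s.
Proof.
have s20 : 0 < s / 2 by rewrite divr_gt0.
have ss : s / 2 < s by rewrite ltr_pdivrMr// ltr_pMr// ltr1n.
have := cvg_dnbhs_at_left (is_derive_diff_quotient (dG s20 ss)).
apply: cvg_trans; apply: near_eq_cvg; near=> y.
rewrite (@UG (s / 2) y) ?(@UG (s / 2) s) ?(ltW ss)//.
- by near: y; apply: nbhs_left_ge.
Unshelve. all: by end_near. Qed.

End mass_profile.

(** * Comparison of two radial profiles *)

Section real_lemmas.
Context {R : realType}.
Implicit Types (f df D g : R -> R) (a b r : R).

Lemma is_derive_continuous f a dfa : is_derive a 1 f dfa -> {for a, continuous f}.
Proof. by move=> ?; apply/differentiable_continuous/derivable1_diffP. Qed.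

Lemma derive_ge0_nondecreasing f a b : a <= b -> {within `[a, b], continuous f} ->
  (forall x, a < x < b -> exists2 dfx : R, 0 <= dfx & is_derive x 1 f dfx) -> f a <= f b.
Proof.
rewrite le_eqVlt => /predU1P[-> //|ab cf dF].
have [x|c ci E] := @MVT R f ('D_1 f) a b ab _ cf.
  by rewrite in_itv/= => /dF[dfx _ ?]; exact/derivableP.
move: ci; rewrite in_itv/= => /dF[dfc c0 ?].
by rewrite -subr_ge0 E derive_val mulr_ge0// subr_ge0 ltW.
Qed.

(* The first zero of D to the left of r would be crossed upwards, against the
   sign of D'. *)
Lemma positive_leftwards D g r : 0 < r -> D r = 0 ->
  (forall a, 0 < a -> {within `[a, r], continuous D}) ->
  (forall x, 0 < x < r -> is_derive x 1 D (g x)) ->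
  {for r, continuous g} -> g r < 0 ->
  (forall x, 0 < x < r -> D x = 0 -> (forall t, x < t < r -> 0 < D t) -> g x < 0) ->
  forall x, 0 < x < r -> 0 < D x.
Proof.
move=> r0 Dr cD dD cg gr gneg x /andP[x0 xr].
have [del del0 Hdel] : exists2 del, 0 < del & forall t, r - del < t -> t < r -> g t < 0.
  have : \forall t \near r, g t < 0 by exact: (cvgr_lt (g r) cg).
  move=> /nbhs_ballP[del /= del0 H]; exists del => // t t1 t2; apply: H.
  by rewrite /ball/= ger0_norm; lra.
pose b := Num.max (r - del / 2) ((x + r) / 2).
have br : b < r by rewrite /b gt_max; apply/andP; split; lra.
have xb : x < b by rewrite /b lt_max; apply/orP; right; lra.
have bd : r - del < b by rewrite /b lt_max; apply/orP; left; lra.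
have Dnear t : b <= t -> t < r -> 0 < D t.
  move=> bt tr; have t0 : 0 < t by rewrite (lt_trans x0)// (lt_le_trans xb).
  have [||c] := @MVT R D g t r tr.
  - move=> y; rewrite in_itv/= => /andP[ty yr]; apply: dD; rewrite yr andbT; exact: lt_trans ty.
  - exact: cD.
  - rewrite in_itv/= Dr sub0r => /andP[tc cr] /eqP; rewrite eqr_oppLR => /eqP ->.
    rewrite -mulNr pmulr_lgt0 ?subr_gt0// oppr_gt0; apply: Hdel => //.
    by rewrite (lt_le_trans bd)// (le_trans bt)// ltW.
rewrite ltNge; apply/negP => Dx.
have cDt t : 0 < t < r -> {for t, continuous D} by move=> /dD/is_derive_continuous.
pose S := [set t | x <= t <= b /\ D t <= 0].
have Sx : S x by split => //; rewrite lexx ltW.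
have Sub : has_ubound S by exists b => t [/andP[]].
pose p := sup S.
have xp : x <= p by apply: ub_le_sup.
have pb : p <= b by apply: ge_sup; [exists x|move=> t [/andP[]]].
have p0 : 0 < p := lt_le_trans x0 xp.
have pr : p < r := le_lt_trans pb br.
have cp : {for p, continuous D} by apply: cDt; rewrite p0.
have Dp : D p <= 0.
  rewrite leNgt; apply/negP => Dp.
  have : \forall t \near p, 0 < D t by apply: (cvgr_gt (D p) cp).
  move=> /nbhs_ballP[e /= e0 He].
  have [t St pt] := @sup_adherent _ S e e0 (conj (ex_intro _ x Sx) Sub).
  have tp : t <= p by apply: ub_le_sup.
  have : 0 < D t by apply: He; rewrite /ball/= ger0_norm; rewrite -/p in pt; lra.
  by case: St => _; rewrite leNgt => /negP.
have Dpt t : p < t -> t < r -> 0 < D t.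
  move=> pt tr; have [bt|tb] := leP b t; first exact: Dnear.
  rewrite ltNge; apply/negP => Dt.
  have : S t by split => //; rewrite (le_trans xp (ltW pt)) ltW.
  by move=> /(ub_le_sup Sub); rewrite leNgt -/p pt.
have Dp0 : D p = 0.
  apply/eqP; rewrite eq_le Dp; apply: (cvgr_to_ge (cvg_at_right_filter cp)).
  near=> t; apply: ltW; apply: Dpt; first by near: t; exact: nbhs_right_gt.
  by near: t; exact: nbhs_right_lt.
have gp : g p < 0 by apply: gneg => //; [rewrite p0|move=> t /andP[]; exact: Dpt].
have := is_derive_diff_quotient (dD p _); rewrite p0 pr => /(_ isT) /cvg_dnbhs_at_right H.
have : 0 <= g p.
  apply: (cvgr_to_ge H); near=> t.
  have pt : p < t by near: t; exact: nbhs_right_gt.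
  have tr : t < r by near: t; exact: nbhs_right_lt.
  rewrite divr_ge0 ?subr_ge0 ?(ltW pt)// (le_trans Dp)// ltW//; exact: Dpt.
by rewrite leNgt gp.
Unshelve. all: by end_near. Qed.

(** The contradiction that closes both comparisons: the bounds obtained there vanish like x^d at the
    centre. *)
Lemma pos_not_le_exprn (d : nat) (C e r : R) : (0 < d)%N -> 0 <= C -> 0 < e -> 0 < r ->
  ~ (forall x, 0 < x < r -> e <= C * x ^+ d).
Proof.
move=> d0 C0 e0 r0 H.
pose x := Num.min (r / 2) (Num.min 1 (e / (C + 1) / 2)).
have C1 : 0 < C + 1 by rewrite ltr_wpDl.
have x0 : 0 < x by rewrite !lt_min !divr_gt0// ltr01.
have xr : x < r.
  by rewrite (@le_lt_trans _ _ (r / 2)) ?ge_min ?lexx// ltr_pdivrMr// ltr_pMr// ltr1n.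
have x1 : x <= 1 by rewrite !ge_min lexx !orbT.
have xe : x <= e / (C + 1) / 2 by rewrite !ge_min lexx !orbT.
have := H x; rewrite x0 xr => /(_ isT).
have xd : x ^+ d <= x by rewrite -[leRHS]expr1 ler_wiXn2l ?(ltW x0).
have := ler_wpM2l C0 xd.
move: xe; rewrite -mulrA -invfM ler_pdivlMr ?mulr_gt0// => xe.
nra.
Qed.

End real_lemmas.

Lemma radial_mass_ge0 {R : realType} (d : nat) (h : R -> R) (y : R) : radial_class h ->
  (forall z, 0 < z -> z <= y -> 0 <= h (z ^+ 2)) -> 0 <= radial_mass d h y.
Proof.
move=> hh h0; rewrite /radial_mass -Rintegral_itv_obnd_cbnd.
  apply: Rintegral_ge0 => z /=; rewrite in_itv/= => /andP[z0 zy].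
  by rewrite mulr_ge0 ?exprn_ge0 ?h0// ltW.
apply: (@integrableS _ _ _ lebesgue_measure `[0, y]) => //; last exact: radial_integrable.
exact: subset_itv_oc_cc.
Qed.

Lemma radial_massN {R : realType} (d : nat) (h : R -> R) (y : R) : radial_class h ->
  radial_mass d (fun q => - h q) y = - radial_mass d h y.
Proof.
move=> hh; have := @radial_massD R d 0 (-1) h h y hh hh.
rewrite mul0r add0r mulN1r => <-; congr radial_mass.
by apply/funext => q; rewrite mul0r add0r mulN1r.
Qed.

Section comparison.
Context {R : realType} (d : nat).
Hypothesis d0 : (0 < d)%N.
Variables (psi hV hw V w : R -> R) (r c : R).
Hypotheses (r0 : 0 < r) (c0 : 0 < c) (Vw : V r = w r).
Hypotheses (kV : radial_class hV) (kw : radial_class hw).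
Hypothesis cV : forall a, 0 < a -> {within `[a, r], continuous V}.
Hypothesis cw : forall a, 0 < a -> {within `[a, r], continuous w}.
Hypothesis dV : forall x, 0 < x < r -> is_derive x 1 V (radial_flux d hV x).
Hypothesis dw : forall x, 0 < x < r -> is_derive x 1 w (radial_flux d hw (x + c)).
Hypothesis hVE : forall x, 0 < x -> x < r -> hV (x ^+ 2) = psi (V x).
Hypothesis hwE : forall x, 0 < x -> x < r -> hw ((x + c) ^+ 2) = psi (w x).

Let n := d.-1.
(** The price of the shift: [w] has the weight of radius [x + c], while the comparison uses that of
    radius [x]. *)
Let k (x : R) : R := (x / (x + c)) ^+ n.

(* [x^n w'(x) / 2] and [x^n V'(x) / 2] *)
Let F (x : R) : R := k x * radial_mass d hw (x + c).
Let H (x : R) : R := radial_mass d hV x.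

Let dk (x : R) : 0 < x -> exists2 dkx : R, 0 <= dkx & is_derive x 1 k dkx.
Proof.
move=> x0; have xc : x + c != 0 by rewrite gt_eqF// addr_gt0.
have h1 : is_derive x 1 (@id R + cst c) 1.
  by have := is_deriveD (is_derive_id x 1) (is_derive_cst c x 1); rewrite addr0.
have h2 := @is_deriveV R (@id R + cst c) x 1 1 xc h1.
have h3 := is_deriveM (is_derive_id x 1) h2.
have h4 := @is_deriveX R _ _ n x 1 _ h3.
have -> : k = (@id R * (fun y => ((@id R + cst c) y)^-1)) ^+ n.
  by apply/funext => y; rewrite /k !fctE.
eexists; last exact: h4.
rewrite /GRing.scale/= !fctE !mulr1.
have -> : x * - (x + c) ^- 2 + (x + c)^-1 = c / (x + c) ^+ 2 by field.
have x1 : 0 <= x / (x + c) by rewrite divr_ge0// ?addr_ge0// ltW.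
by rewrite mulr_ge0 ?divr_ge0 ?sqr_ge0 ?(ltW c0)// mulr_ge0// exprn_ge0.
Qed.

Let dH (x : R) : 0 < x -> is_derive x 1 H (x ^+ n * hV (x ^+ 2)).
Proof. by move=> x0; exact: is_derive_radial_mass. Qed.

Let fluxV (x : R) : 0 < x -> x ^+ n * radial_flux d hV x = 2 * H x.
Proof.
move=> x0; rewrite /radial_flux /H -/n; have : x ^+ n != 0 by rewrite expf_eq0 gt_eqF// andbF.
by move: (x ^+ n) => y y0; field.
Qed.

Let fluxw (x : R) : 0 < x -> x ^+ n * radial_flux d hw (x + c) = 2 * F x.
Proof.
move=> x0; rewrite /radial_flux /F /k -/n expr_div_n.
have : (x + c) ^+ n != 0 by rewrite expf_eq0 gt_eqF ?addr_gt0// andbF.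
by move: (x ^+ n) ((x + c) ^+ n) => y z z0; field.
Qed.

(** Besides the expected term, the derivative of [F] contains [dkx] times a mass; [dkx] is
    nonnegative, so the sign of [hw] decides the sign of this extra term. *)
Let dF (x : R) : 0 < x -> exists2 dkx : R, 0 <= dkx &
  is_derive x 1 F (x ^+ n * hw ((x + c) ^+ 2) + dkx * radial_mass d hw (x + c)).
Proof.
move=> x0; have [dkx dkx0 hk] := dk x0; exists dkx => //.
have xc : 0 < x + c by rewrite addr_gt0.
have h1 : is_derive x 1 (@id R + cst c) 1.
  by have := is_deriveD (is_derive_id x 1) (is_derive_cst c x 1); rewrite addr0.
have h2 := is_derive1_comp (is_derive_radial_mass d kw xc : is_derive ((@id R + cst c) x) 1 _ _) h1.
apply: (is_derive_eq (is_deriveM hk h2)); rewrite /GRing.scale/= !fctE.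
rewrite /k expr_div_n -/n mulr1.
have : (x + c) ^+ n != 0 by rewrite expf_eq0 gt_eqF// andbF.
by move: ((x + c) ^+ n) => z z0; field.
Qed.

Let cflux : {for r, continuous (fun x => radial_flux d hw (x + c))}.
Proof.
apply: (@continuous_comp R R R (fun x => x + c) (radial_flux d hw)).
  by apply: cvgD; [exact: cvg_id|exact: cvg_cst].
by apply: continuous_radial_flux => //; rewrite addr_gt0.
Qed.

Let H_le : exists2 M, 0 <= M & forall x, 0 < x < r -> `|H x| <= M * x ^+ d.
Proof.
have [M HM] := kV.2 (r ^+ 2); exists M.
  by rewrite (le_trans _ (HM 0 _))// lexx sqr_ge0.
move=> x /andP[x0 xr]; apply: radial_mass_le => //; first exact: ltW.
by move=> q /andP[q0 qx]; apply: HM; rewrite q0 (le_trans qx)// lerXn2r ?nnegrE ?ltW.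
Qed.

(** Here the extra term in the derivative of [F] is nonnegative, which keeps [F - H] nondecreasing
    as long as [w] stays above [V]. Near 0, [F] is nonnegative and [H] of order x^d, so [F - H]
    cannot remain below a negative constant. *)
Lemma radial_comparison_supersolution :
  (forall x, 0 < x -> x <= r + c -> 0 <= hw (x ^+ 2)) ->
  (forall x, 0 < x < r -> V x <= w x -> psi (V x) <= psi (w x)) ->
  radial_flux d hV r <= radial_flux d hw (r + c).
Proof.
move=> hw0 psiVw; rewrite leNgt; apply/negP => gr.
pose D x := w x - V x.
pose g x := radial_flux d hw (x + c) - radial_flux d hV x.
have FHr : F r - H r < 0.
  have : r ^+ n * g r < 0 by rewrite pmulr_rlt0 ?exprn_gt0// subr_lt0.
  by rewrite mulrBr fluxV// fluxw//; lra.
have mono x : 0 < x < r -> (forall t, x < t < r -> 0 < D t) -> F x - H x <= F r - H r.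
  move=> /andP[x0 xr] Dpos; apply: (@derive_ge0_nondecreasing _ (fun x => F x - H x)).
  - exact: ltW.
  - apply: continuous_in_subspaceT => t; rewrite inE/= in_itv/= => /andP[xt _].
    have t0 : 0 < t := lt_le_trans x0 xt.
    have [? _ dFt] := dF t0.
    by apply: cvgB; [exact: (is_derive_continuous dFt)|exact: (is_derive_continuous (dH t0))].
  - move=> t /andP[xt tr]; have t0 : 0 < t := lt_trans x0 xt.
    have [dkt dkt0 dFt] := dF t0.
    eexists; last exact: (is_deriveB dFt (dH t0)).
    rewrite hVE// hwE// addrAC -mulrBr addr_ge0//.
      apply: mulr_ge0; first by rewrite exprn_ge0// ltW.
      rewrite subr_ge0.
      by apply: psiVw; rewrite ?t0// -subr_ge0 ltW// Dpos// xt.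
    rewrite mulr_ge0// radial_mass_ge0// => z z0 zt; apply: hw0 => //.
    by rewrite (le_trans zt)// lerD2r ltW.
have Dpos : forall x, 0 < x < r -> 0 < D x.
  apply: (@positive_leftwards R D g r r0).
  - by rewrite /D Vw subrr.
  - by move=> a a0 x; apply: cvgB; [exact: cw|exact: cV].
  - by move=> x xr; exact: (is_deriveB (dw xr) (dV xr)).
  - by apply: cvgB; [exact: cflux|exact: continuous_radial_flux].
  - by rewrite /g subr_lt0.
  - move=> x xr _ Dx; have := mono x xr Dx; case/andP: xr => x0 xr.
    rewrite -(pmulr_rlt0 _ (exprn_gt0 n x0)) mulrBr fluxV// fluxw//; lra.
have [M M0 HM] := H_le.
apply: (@pos_not_le_exprn R d M (H r - F r) r d0 M0) => //; first by rewrite subr_gt0 -subr_lt0.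
move=> x xr; have xr' := xr; case/andP: xr' => x0 xr'.
have h1 : F x - H x <= F r - H r.
  by apply: mono => // t /andP[xt tr]; apply: Dpos; rewrite tr (lt_trans x0 xt).
have h2 : 0 <= F x.
  apply: mulr_ge0; first by rewrite exprn_ge0// divr_ge0 ?addr_ge0// ltW.
  by apply: radial_mass_ge0 => // z z0 zx; apply: hw0 => //; rewrite (le_trans zx)// lerD2r ltW.
have h3 : H x <= M * x ^+ d by rewrite (le_trans (ler_norm _))// HM.
lra.
Qed.

(** Now the extra term has the wrong sign for the difference of fluxes but the right one for the
    Wronskian [Q]. Near 0 the part [F * V] is at most 0 and [- H * w] at most [M * B * x ^+ d], so
    [Q] cannot stay above [Q r > 0]. *)
Lemma radial_comparison_subsolution (B : R) :
  (forall x, 0 < x -> x <= r + c -> hw (x ^+ 2) <= 0) ->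
  (forall x, 0 < x < r -> w x <= V x -> psi (w x) * V x <= psi (V x) * w x) ->
  0 < V r ->
  (forall x, 0 < x < r -> 0 <= V x /\ 0 <= w x <= B) ->
  radial_flux d hw (r + c) <= radial_flux d hV r.
Proof.
move=> hw0 psiVw Vr VwB; rewrite leNgt; apply/negP => gr.
pose D x := V x - w x.
pose g x := radial_flux d hV x - radial_flux d hw (x + c).
pose Q x := F x * V x - H x * w x.
have mw x : 0 < x -> x <= r -> radial_mass d hw (x + c) <= 0.
  move=> x0 xr; rewrite -oppr_ge0 -radial_massN//; apply: radial_mass_ge0.
    have := radial_classD 0 (-1) kw kw.
    by congr radial_class; apply/funext => q; rewrite mul0r add0r mulN1r.
  by move=> z z0 zt; rewrite oppr_ge0; apply: hw0 => //; rewrite (le_trans zt)// lerD2r.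
have Qr : 0 < Q r.
  rewrite /Q -Vw -mulrBl mulr_gt0//.
  have : r ^+ n * g r < 0 by rewrite pmulr_rlt0 ?exprn_gt0// subr_lt0.
  by rewrite mulrBr fluxV// fluxw//; lra.
have mono x : 0 < x < r -> (forall t, x < t < r -> 0 < D t) -> Q r <= Q x.
  move=> /andP[x0 xr] Dpos; rewrite -lerN2.
  apply: (@derive_ge0_nondecreasing _ (fun x => - Q x)).
  - exact: ltW.
  - have cFH (f : R -> R) : (forall t, 0 < t -> {for t, continuous f}) -> {within `[x, r], continuous f}.
      move=> cf; apply: continuous_in_subspaceT => t; rewrite inE/= in_itv/= => /andP[xt _].
      by apply: cf; exact: lt_le_trans xt.
    have cF : {within `[x, r], continuous F}.
      by apply: cFH => t t0; have [? _ dFt] := dF t0; exact: (is_derive_continuous dFt).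
    have cH : {within `[x, r], continuous H}.
      by apply: cFH => t t0; exact: (is_derive_continuous (dH t0)).
    move=> t; apply: cvgN; apply: cvgB; apply: cvgM.
    + exact: cF.
    + exact: cV.
    + exact: cH.
    + exact: cw.
  - move=> t /andP[xt tr]; have t0 : 0 < t := lt_trans x0 xt.
    have t0r : 0 < t < r by rewrite t0 tr.
    have [dkt dkt0 dFt] := dF t0.
    have [V0 /andP[w0 _]] := VwB t t0r.
    eexists; last exact: (is_deriveN (is_deriveB (is_deriveM dFt (dV t0r)) (is_deriveM (dH t0) (dw t0r)))).
    rewrite /GRing.scale/= hVE// hwE//.
    (* Both sides are t^n times the product of the two derivatives, up to the factor 2: the
       first-order terms of the Wronskian cancel. *)
    have E : F t * radial_flux d hV t = H t * radial_flux d hw (t + c).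
      have tn : t ^+ n != 0 by rewrite gt_eqF// exprn_gt0.
      apply: (mulfI tn); rewrite mulrCA fluxV// [RHS]mulrCA fluxw//; ring.
    rewrite E.
    have h1 : dkt * radial_mass d hw (t + c) <= 0 by rewrite mulr_ge0_le0// mw// ltW.
    have h2 := mulr_le0_ge0 h1 V0.
    have h3 := psiVw t t0r; have := Dpos t; rewrite xt tr => /(_ isT); rewrite subr_gt0 => /ltW/h3 h4.
    have h5 : 0 <= t ^+ n by rewrite exprn_ge0// ltW.
    have := ler_wpM2l h5 h4; nra.
have Dpos : forall x, 0 < x < r -> 0 < D x.
  apply: (@positive_leftwards R D g r r0).
  - by rewrite /D Vw subrr.
  - by move=> a a0 x; apply: cvgB; [exact: cV|exact: cw].
  - by move=> x xr; exact: (is_deriveB (dV xr) (dw xr)).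
  - by apply: cvgB; [exact: continuous_radial_flux|exact: cflux].
  - by rewrite /g subr_lt0.
  - move=> x xr Dx0 Dx; have := mono x xr Dx; have [V0 _] := VwB x xr; case/andP: xr => x0 xr.
    (* At a zero of [D] the Wronskian is [(F - H) * V]; its positivity gives the sign of [g]. *)
    have E : w x = V x by move/eqP : Dx0; rewrite subr_eq0 => /eqP.
    rewrite -(pmulr_rlt0 _ (exprn_gt0 n x0)) mulrBr fluxV// fluxw// /Q E -mulrBl => h.
    have := lt_le_trans Qr h => h1.
    have : 0 < F x - H x by rewrite ltNge; apply/negP => h2; have := mulr_le0_ge0 h2 V0; rewrite leNgt h1.
    lra.
have [M M0 HM] := H_le.
have B0 : 0 <= B.
  have [|_ /andP[/le_trans h /h]//] := VwB (r / 2).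
  by rewrite divr_gt0//= ltr_pdivrMr// ltr_pMr// ltr1n.
apply: (@pos_not_le_exprn R d (M * B) (Q r) r d0 (mulr_ge0 M0 B0)) => //.
move=> x xr; have xr' := xr; case/andP: xr' => x0 xr'.
have h1 : Q r <= Q x.
  by apply: mono => // t /andP[xt tr]; apply: Dpos; rewrite tr (lt_trans x0 xt).
have [V0 /andP[w0 wB]] := VwB x xr.
have h2 : F x <= 0.
  apply: mulr_ge0_le0; first by rewrite exprn_ge0// divr_ge0 ?addr_ge0// ltW.
  by rewrite mw// ltW.
have h4 := mulr_le0_ge0 h2 V0.
have := HM x xr; rewrite ler_norml => /andP[h3 _].
have h5 : - H x * w x <= M * x ^+ d * B.
  rewrite (@le_trans _ _ (M * x ^+ d * w x))//.
    by rewrite ler_wpM2r// lerNl.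
  by rewrite ler_wpM2l// mulr_ge0// exprn_ge0// ltW.
rewrite (le_trans h1)// /Q; lra.
Qed.

End comparison.

(** Dominated convergence along theta = 1 / k.+1; the limit is [- q], also the value at 0. *)
Lemma levy_khintchine_cvg0 {R : realType} (F : R -> R) : levy_khintchine F ->
  F k.+1%:R^-1 @[k --> \oo] --> F 0.
Proof.
move=> [q [a [b [Lam [q0 b0 L0 Lfin FE]]]]].
pose D : set R := `]0, +oo[%classic.
pose f (th x : R) : R := expR (- (th * x)) - 1 + th * x * \1_[set y | y < 1] x.
pose e (k : nat) : R := k.+1%:R^-1.
have e0 k : 0 < e k by rewrite invr_gt0 ltr0n.
have e1 k : e k <= 1 by rewrite invf_le1 ?ltr0n// ler1n.
have ce : e k @[k --> \oo] --> 0 by exact: cvg_harmonic.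
have mf th : measurable_fun D (f th).
  apply: measurable_funTS; apply: measurable_funD.
    apply: continuous_measurable_fun => x; apply: cvgB; last exact: cvg_cst.
    apply: (@continuous_comp R R R (fun x => - (th * x)) (@expR R)); last exact: continuous_expR.
    by apply: cvgN; apply: cvgM; [exact: cvg_cst|exact: cvg_id].
  apply: measurable_funM; first exact: measurable_funM.
  apply: measurable_indic; rewrite -[X in measurable X]setTI.
  by rewrite (_ : [set y : R | y < 1] = `]-oo, 1[%classic) ?setTI//;
    apply/seteqP; split => y /=; rewrite in_itv.
have mg : measurable_fun D (fun x : R => Num.min 1 (x ^+ 2) : R).
  apply: measurable_funTS; apply: continuous_measurable_fun => x.
  by apply: (@continuous_min R R (cst 1) (fun x => x ^+ 2)); [exact: cst_continuous|exact: exprn_continuous].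
have ig : Lam.-integrable D (fun x => (Num.min 1 (x ^+ 2))%:E).
  apply/integrableP; split; first exact/measurable_EFinP.
  apply: le_lt_trans Lfin; rewrite le_eqVlt; apply/orP; left; apply/eqP.
  by apply: eq_integral => x _ /=; rewrite ger0_norm// le_min ler01 sqr_ge0.
(* Below 1 the integrand is the compensated kernel, of order x^2; from 1 on it is bounded by 1. The
   condition [th <= 1] makes the factor 2 sufficient. *)
have fg th x : 0 < th -> th <= 1 -> D x -> `|f th x| <= 2 * Num.min 1 (x ^+ 2).
  move=> th0 th1; rewrite /D /= in_itv/= andbT => x0.
  have [x1|x1] := ltP x 1.
    rewrite /f indicE mem_set// mulr1.
    have := @branching_kernel_diff R 0 th x (lexx _) (ltW th0) (ltW x0).
    rewrite branching_kernel0 !subr0 => /andP[h1 h2].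
    rewrite -/(branching_kernel th x) ger0_norm// (le_trans h2)//.
    have -> : Num.min x (x ^+ 2) = x ^+ 2 by apply/min_idPr; rewrite expr2 ler_piMr// ltW.
    have -> : Num.min 1 (x ^+ 2) = x ^+ 2.
      by apply/min_idPr; rewrite expr2 mulr_ile1// ltW.
    rewrite ler_wpM2r ?sqr_ge0//; nra.
  rewrite /f indicE memNset/=; last by rewrite ltNge x1.
  rewrite mulr0 addr0 (_ : Num.min 1 (x ^+ 2) = 1); last first.
    by apply/min_idPl; rewrite expr2 mulr_ege1.
  have := expR_ge0 (- (th * x)).
  have : expR (- (th * x)) <= 1 by rewrite -expR0 ler_expR oppr_le0 mulr_ge0// ltW.
  by rewrite ler_norml => ? ?; apply/andP; split; lra.
have ig2 : Lam.-integrable D (fun x => (2%:E * (Num.min 1 (x ^+ 2))%:E)%E).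
  by apply: integrableZl; [exact: measurable_itv|exact: ig].
have cf x : D x -> f (e k) x @[k --> \oo] --> f 0 x.
  move=> _; apply: cvgD.
    apply: cvgB; last exact: cvg_cst.
    apply: (@cvg_comp _ _ _ (fun k => - (e k * x)) (@expR R) _ (nbhs (- (0 * x)))); last exact: continuous_expR.
    by apply: cvgN; apply: cvgM; [exact: ce|exact: cvg_cst].
  by apply: cvgM; [apply: cvgM; [exact: ce|exact: cvg_cst]|exact: cvg_cst].
have cI : \int[Lam]_(x in D) f (e k) x @[k --> \oo] --> \int[Lam]_(x in D) f 0 x.
  have f0 x : f 0 x = 0 by rewrite /f !mul0r oppr0 expR0 subrr addr0.
  apply: fine_cvg; rewrite fineK; last first.
    by rewrite (_ : (fun x => _) = cst 0%E) ?integral0//; apply/funext => x; rewrite f0.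
  apply: (@dominated_cvg _ _ _ Lam D _ (fun k x => (f (e k) x)%:E) (fun x => (f 0 x)%:E)
    (fun x => (2%:E * (Num.min 1 (x ^+ 2))%:E)%E)) => //.
  - exact: measurable_itv.
  - by move=> k; apply/measurable_EFinP.
  - by move=> x Dx; apply: cvg_EFin; [near=> k|exact: cf].
  - by move=> k x Dx; rewrite /= lee_fin fg.
have FEk k : F (e k) = - q + a * e k + b * e k ^+ 2 + \int[Lam]_(x in D) f (e k) x.
  by rewrite FE// ltW.
rewrite (_ : (fun k => F _) = (fun k => - q + a * e k + b * e k ^+ 2 + \int[Lam]_(x in D) f (e k) x)).
  rewrite FE//; apply: cvgD; last exact: cI.
  apply: cvgD; last by apply: cvgM; [exact: cvg_cst|apply: cvg_comp ce (@exprn_continuous _ 2 0)].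
  by apply: cvgD; [exact: cvg_cst|apply: cvgM; [exact: cvg_cst|exact: ce]].
by apply/funext => k; rewrite -/(e k) FEk.
Unshelve. all: by end_near. Qed.

Lemma within_continuous_shift {R : realType} (f : R -> R) (a b c : R) :
  {within `[a + c, b + c], continuous f} -> {within `[a, b], continuous (fun x => f (x + c))}.
Proof.
move=> /subspace_continuousP cf; apply/subspace_continuousP => x xab.
have xabc : `[a + c, b + c]%classic (x + c).
  by move: xab; rewrite /= !in_itv/= !lerD2r.
have := cf _ xabc; apply: cvg_comp => B; rewrite /within/= => HB.
have cg : {for x, continuous (fun y : R => y + c)} by apply: cvgD; [exact: cvg_id|exact: cvg_cst].
have := cg _ HB; rewrite /= => H.
suff : \forall z \near x, `[a, b]%classic z -> B (z + c) by [].
near=> z => zab; have : `[a + c, b + c]%classic (z + c) -> B (z + c) by near: z.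
by apply; move: zab; rewrite /= !in_itv/= !lerD2r.
Unshelve. all: by end_near. Qed.

Lemma is_derive_shift {R : realType} (f : R -> R) (x c df : R) :
  is_derive (x + c) 1 f df -> is_derive x 1 (fun y => f (y + c)) df.
Proof.
move=> hf; have h1 : is_derive x 1 (@id R + cst c) 1.
  by have := is_deriveD (is_derive_id x 1) (is_derive_cst c x 1); rewrite addr0.
have hf' : is_derive ((@id R + cst c) x) 1 f df by [].
by have := is_derive1_comp hf' h1; rewrite mulr1.
Qed.

(** * Monotonicity of the mechanisms for positive theta *)

Section mechanism.
Context {R : realType} {d : nat}.
Hypothesis d0 : (0 < d)%N.
Context (alpha beta : R) (Pi : {measure set R -> \bar R}).
Hypothesis hpsi : branching_parameters alpha beta Pi.
Notation psi := (branching_mechanism alpha beta Pi).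
Context {dispW : measure_display} {OmW : measurableType dispW}
  (PW : probability OmW R) (W : R -> OmW -> 'rV[R]_d).
Hypothesis hW : brownian_motion PW W.
Variable v : ('rV[R]_d -> R) -> R -> 'rV[R]_d -> R.
Hypothesis hv : forall f s, 0 < s -> pos_bdd_continuous_on (esphere d s) f ->
  unique_nonneg_exit_solution PW W psi f s (v f s).
Context {dispX : measure_display} {OmX : measurableType dispX}
  (X : R -> R.-ker OmX ~> 'rV[R]_d)
  (PX : R -> {finite_measure set 'rV[R]_d -> \bar R} -> probability OmX R).
Hypothesis hX : exit_measure_family v X PX.
Variable u : R -> R -> R -> R.
Hypothesis hu : mass_exponent X PX u.
Variable Psi : R -> R -> R.
Hypothesis hPsi : mass_mechanism u Psi.

Let vsol theta s : 0 < theta -> 0 < s -> nonneg_exit_solution PW W psi (cst theta) s (v (cst theta) s).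
Proof. by move=> t0 s0; have [] := hv s0 (pos_bdd_continuous_on_cst (esphere d s) t0). Qed.

Let vu theta s x : 0 < theta -> 0 < s -> 0 < enorm x -> enorm x <= s ->
  v (cst theta) s x = u (enorm x) s theta.
Proof.
move=> t0 s0 x0 xs; apply: (exit_solution_cst hX hu) => //.
by move=> th s' th0 s'0; have [] := vsol th0 s'0.
Qed.

Lemma mass_exponent_diag s theta : 0 < s -> 0 <= theta -> u s s theta = theta.
Proof.
by move=> s0 t0; rewrite (mm_integral hPsi s0 (lexx _) t0) set_itv1 Rintegral_set1 subr0.
Qed.

(** On [[a, s]] the exponent is a constant plus an indefinite integral of one fixed integrable
    function. *)
Lemma continuous_mass_exponent a s theta : 0 < a -> 0 <= theta ->
  {within `[a, s], continuous (fun r => u r s theta)}.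
Proof.
move=> a0 t0; have [as'|sa] := leP a s; last first.
  by rewrite set_itv_ge ?bnd_simp -?ltNge//; exact: continuous_subspace0.
have ig := mm_integrable hPsi a0 as' t0.
pose g z := Psi z (u z s theta).
have E r : `[a, s]%classic r -> theta - \int[lebesgue_measure]_(z in `[a, s]) g z +
    parameterized_integral lebesgue_measure a r g = u r s theta.
  rewrite /= in_itv/= => /andP[ar rs]; have r0 := lt_le_trans a0 ar.
  rewrite (mm_integral hPsi r0 rs t0) -addrA; congr (_ + _); rewrite /parameterized_integral.
  rewrite -(Rintegral_itv_obnd_cbnd (r := r)); last first.
    apply: (@integrableS _ _ _ lebesgue_measure `[r, s]) => //; first exact: subset_itv_oc_cc.
    exact: (mm_integrable hPsi r0 rs t0).
  by rewrite -(Rintegral_itvB (a := BLeft a) (x := r) ig)// ?bnd_simp// opprB addrC.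
apply/subspace_continuousP => r ras.
suff : u y s theta @[y --> within `[a, s]%classic (nbhs r)] --> u r s theta by [].
rewrite -(E r ras); apply: cvg_trans (_ : (theta - \int[lebesgue_measure]_(z in `[a, s]) g z +
    parameterized_integral lebesgue_measure a y g) @[y --> within `[a, s]%classic (nbhs r)] --> _).
  by apply: near_eq_cvg; rewrite near_withinE; near=> y => yas; rewrite E.
apply: cvgD; first exact: cvg_cst.
have /subspace_continuousP := parameterized_integral_continuous as' ig; exact.
Unshelve. all: by end_near. Qed.

(** Covers both regimes: [L] is 0 in the (sub)critical case and [lambda_star psi] in the
    supercritical one. *)
Variable L : R.
Hypotheses (L0 : 0 <= L) (psiL : psi L = 0)
  (psi_le0 : forall l, 0 <= l <= L -> psi l <= 0)
  (psi_ge0 : forall l, L <= l -> 0 <= psi l).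

Lemma branching_mechanism_lower_bound : exists2 K, 0 <= K & forall l, 0 <= l -> - K <= psi l.
Proof.
have [K K0 HK] := branching_mechanism_lipschitz hpsi L0.
exists (K * L) => [|l l0]; first exact: mulr_ge0.
have [lL|Ll] := leP l L; last first.
  by rewrite (le_trans _ (psi_ge0 (ltW Ll)))// oppr_le0 mulr_ge0.
have := HK l 0; rewrite l0 lL lexx L0 branching_mechanism0 !subr0 (ger0_norm l0) => /(_ isT isT).
rewrite ler_norml => /andP[h _]; rewrite (le_trans _ h)// lerN2 ler_wpM2l//.
Qed.

(** [psi a * b <= psi b * a <= psi b * b], the second step by nonnegativity beyond [L]. *)
Lemma branching_mechanism_mono a b : L <= a -> a <= b -> psi a <= psi b.
Proof.
move=> La ab; have a0 := le_trans L0 La; have b0 := le_trans a0 ab.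
have [->|bn] := eqVneq a b; first by [].
have b1 : 0 < b by rewrite (le_lt_trans a0)// lt_neqAle bn.
have h := branching_mechanism_star hpsi a0 ab.
have pb := psi_ge0 (le_trans La ab).
by rewrite -(ler_pM2r b1); apply: le_trans h _; exact: ler_wpM2l.
Qed.

(** As [psi L = 0], the constant [L] solves the exit equation, and uniqueness identifies it. With
    monotonicity in theta this barrier keeps every exponent on its side of [L]. *)
Lemma mass_exponent_critical r s : 0 < L -> 0 < r -> r <= s -> u r s L = L.
Proof.
move=> L1 r0 rs; have [x xr] := @enorm_surj R d r d0 (ltW r0).
have s0 := lt_le_trans r0 rs.
rewrite -[in LHS]xr -vu ?xr//.
have [_ huniq] := hv s0 (pos_bdd_continuous_on_cst (esphere d s) L1).
rewrite -(huniq (cst L)) ?xr//; split => //.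
move=> y ys /=; rewrite integral_cst// [X in (_ * X)%E]probability_setT mule1.
rewrite psiL; under eq_integral do rewrite integral0.
by rewrite integral0 sube0.
Qed.

Let mono r s theta eta : 0 < r -> r <= s -> 0 < theta -> theta <= eta -> u r s theta <= u r s eta.
Proof.
move=> r0 rs; apply: (mass_exponent_mono d0 hX hu) => //.
Qed.

Lemma mass_exponent_ge0 r s theta : 0 < r -> r <= s -> 0 < theta -> 0 <= u r s theta.
Proof.
move=> r0 rs t0; have [x xr] := @enorm_surj R d r d0 (ltW r0).
have s0 := lt_le_trans r0 rs.
by rewrite -[in X in u X]xr -vu ?xr//; have [_ v0 _] := vsol t0 s0; apply: v0; rewrite xr.
Qed.

Lemma mass_exponent_ge r s theta : 0 < r -> r <= s -> 0 < theta -> L <= theta -> L <= u r s theta.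
Proof.
move=> r0 rs t0 Lt; have [L00|L1] := eqVneq L 0; first by rewrite L00 mass_exponent_ge0.
have L2 : 0 < L by rewrite lt_neqAle eq_sym L1.
by rewrite -[leLHS](mass_exponent_critical L2 r0 rs); exact: mono.
Qed.

Lemma mass_exponent_le r s theta : 0 < r -> r <= s -> 0 < theta -> theta <= L -> u r s theta <= L.
Proof.
move=> r0 rs t0 tL; have L2 := lt_le_trans t0 tL.
by rewrite -[leRHS](mass_exponent_critical L2 r0 rs); exact: mono.
Qed.

Lemma mass_profile s theta : 0 < s -> 0 < theta -> exists h, [/\ radial_class h,
  (forall r, 0 < r -> r <= s -> h (r ^+ 2) = psi (u r s theta)),
  (forall r, 0 < r < s -> is_derive r 1 (fun r => u r s theta) (radial_flux d h r)) &
  Psi s theta = radial_flux d h s].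
Proof.
move=> s0 t0; have [K K0 psiK] := branching_mechanism_lower_bound.
have vU x : 0 < enorm x -> enorm x <= s -> v (cst theta) s x = u (enorm x) s theta.
  exact: vu.
have Uc a (a0 : 0 < a) := @continuous_mass_exponent a s theta a0 (ltW t0).
have Us := mass_exponent_diag s0 (ltW t0).
have vs := vsol t0 s0.
exists (mass_potential alpha beta Pi s (v (cst theta) s) (fun r => u r s theta)); split.
- exact: (mass_potential_class d0 hpsi hW s0 K0 psiK vs vU Uc Us).
- by move=> r r0 rs; rewrite (mass_potentialE d0 vs vU).
- move=> r /andP[r0 rs].
  exact: (is_derive_mass_profile d0 hpsi hW s0 K0 psiK vs vU Uc Us).
- have := mm_derivative hPsi s0 (ltW t0) => h1.
  have h2 := mass_profile_left_derivative d0 hpsi hW s0 K0 psiK vs vU Uc Us.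
  exact: (cvg_unique _ h1 h2).
Qed.

Lemma mechanism_mono r s theta : 0 < r -> r <= s -> 0 < theta ->
  (L <= theta -> Psi r theta <= Psi s theta) /\ (theta <= L -> Psi s theta <= Psi r theta).
Proof.
move=> r0; rewrite le_eqVlt => /predU1P[->//|rs] t0; have s0 := lt_trans r0 rs.
have [hV [kV EV dV ->]] := mass_profile r0 t0.
have [hw [kw Ew dw ->]] := mass_profile s0 t0.
(* The shift aligns the two boundary spheres at [r], where both profiles equal [theta]. *)
pose c := s - r; have c0 : 0 < c by rewrite subr_gt0.
have rc : r + c = s by rewrite addrC subrK.
have xcs x : x < r -> x + c < s by move=> xr; rewrite -rc ltrD2r.
pose V x := u x r theta; pose w x := u (x + c) s theta.
have Vw : V r = w r by rewrite /V /w rc !mass_exponent_diag// ltW.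
have cV a : 0 < a -> {within `[a, r], continuous V}.
  by move=> a0; exact: continuous_mass_exponent (ltW t0).
have cw a : 0 < a -> {within `[a, r], continuous w}.
  move=> a0; apply: (@within_continuous_shift R (fun y => u y s theta)); rewrite rc.
  by apply: continuous_mass_exponent (ltW t0); rewrite addr_gt0.
have dwc x : 0 < x < r -> is_derive x 1 w (radial_flux d hw (x + c)).
  move=> /andP[x0 xr]; apply: (@is_derive_shift R (fun y => u y s theta)).
  by apply: dw; rewrite addr_gt0//= xcs.
have EVx x : 0 < x -> x < r -> hV (x ^+ 2) = psi (V x).
  by move=> x0 xr; rewrite EV// ltW.
have Ewx x : 0 < x -> x < r -> hw ((x + c) ^+ 2) = psi (w x).
  by move=> x0 xr; apply: Ew; [exact: addr_gt0|exact: ltW (xcs _ xr)].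
have w0 x : 0 < x -> x < r -> 0 <= w x.
  by move=> x0 xr; apply: mass_exponent_ge0 => //; [exact: addr_gt0|exact: ltW (xcs _ xr)].
rewrite -[in radial_flux d hw s]rc; split => [Lt|tL].
- apply: (@radial_comparison_supersolution R d d0 psi hV hw V w) => //.
  + by move=> x x0; rewrite rc => xs; rewrite Ew//; apply: psi_ge0; exact: mass_exponent_ge.
  + move=> x /andP[x0 xr] ?; apply: branching_mechanism_mono => //.
    by apply: mass_exponent_ge => //; exact: ltW.
(* The bound [B] on [w] is the barrier [L]. *)
- apply: (@radial_comparison_subsolution R d d0 psi hV hw V w r c r0 c0 Vw kV kw _ _ _ _ _ _ L) => //.
  + move=> x x0; rewrite rc => xs; rewrite Ew//; apply: psi_le0.
    by rewrite mass_exponent_ge0//= mass_exponent_le.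
  + by move=> x /andP[x0 xr] ?; apply: branching_mechanism_star => //; exact: w0.
  + by rewrite /V mass_exponent_diag// ltW.
  + move=> x /andP[x0 xr]; rewrite mass_exponent_ge0 ?(ltW xr)// w0//=; split => //.
    by apply: mass_exponent_le => //; [exact: addr_gt0|exact: ltW (xcs _ xr)].
Qed.

Lemma mechanism_cvg0 r : 0 < r -> Psi r k.+1%:R^-1 @[k --> \oo] --> Psi r 0.
Proof. by move=> r0; apply: levy_khintchine_cvg0; exact: (mm_levy_khintchine hPsi). Qed.

End mechanism.

Unset Implicit Arguments.
Set Strict Implicit.

Theorem proposition2
  (R : realType) (d : nat) (hd : (1 <= d)%N)
  (* branching mechanism *)
  (alpha beta : R) (Pi : {measure set R -> \bar R})
  (hpsi : branching_parameters alpha beta Pi)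
  (* Brownian motion in R^d and the functions v_f *)
  (dispW : measure_display) (OmW : measurableType dispW)
  (PW : probability OmW R) (W : R -> OmW -> 'rV[R]_d)
  (hW : brownian_motion PW W)
  (v : ('rV[R]_d -> R) -> R -> 'rV[R]_d -> R)
  (hv : forall f s, 0 < s -> pos_bdd_continuous_on (esphere d s) f ->
     unique_nonneg_exit_solution PW W (branching_mechanism alpha beta Pi)
       f s (v f s))
  (* exit measures, total mass process and its branching mechanisms *)
  (dispX : measure_display) (OmX : measurableType dispX)
  (X : R -> R.-ker OmX ~> 'rV[R]_d)
  (PX : R -> {finite_measure set 'rV[R]_d -> \bar R} -> probability OmX R)
  (hX : exit_measure_family v X PX)
  (u : R -> R -> R -> R) (hu : mass_exponent X PX u)
  (Psi : R -> R -> R) (hPsi : mass_mechanism u Psi) :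
  (subcritical (branching_mechanism alpha beta Pi) ->
   forall r s : R, 0 < r -> r <= s ->
   forall theta : R, 0 <= theta -> Psi r theta <= Psi s theta)
  /\
  (supercritical (branching_mechanism alpha beta Pi) ->
   forall r s : R, 0 < r -> r <= s ->
   (forall theta : R,
      0 <= theta <= lambda_star (branching_mechanism alpha beta Pi) ->
      Psi s theta <= Psi r theta) /\
   (forall theta : R,
      lambda_star (branching_mechanism alpha beta Pi) <= theta ->
      Psi r theta <= Psi s theta)).
Proof.
(* Only positive theta are covered so far; the inequality at 0 is the limit of those at 1 / k.+1,
   which are eventually below [L]. *)
have zero_le (a b L : R) : 0 < a -> 0 < b -> 0 < L ->
    (forall theta, 0 < theta -> theta <= L -> Psi a theta <= Psi b theta) ->
    Psi a 0 <= Psi b 0.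
  move=> a0 b0 L0 H.
  have ca := mechanism_cvg0 hPsi a0; have cb := mechanism_cvg0 hPsi b0.
  apply: (ler_cvg_to ca cb); near=> k; apply: H; first by rewrite invr_gt0 ltr0n.
  apply: ltW; near: k; apply: (cvgr_lt (0 : R)) => //; exact: cvg_harmonic.
split.
- move=> /(subcritical_ge0 hpsi) psi0 r s r0 rs.
  have psi0_le0 l : 0 <= l <= 0 -> branching_mechanism alpha beta Pi l <= 0.
    by move=> /le_anti <-; rewrite branching_mechanism0.
  have H theta : 0 < theta -> Psi r theta <= Psi s theta.
    move=> t0; apply: (proj1 (mechanism_mono hd hpsi hW hv hX hu hPsi (lexx 0)
      (branching_mechanism0 alpha beta Pi) psi0_le0 psi0 r0 rs t0)).
    exact: ltW.
  move=> theta; rewrite le_eqVlt => /predU1P[<-|]; last exact: H.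
  (* Any positive upper end would do, since the inequality holds for all positive theta. *)
  apply: (zero_le _ _ 1) => //; first exact: lt_le_trans rs.
  by move=> th th0 _; exact: H.
- move=> /(supercritical_critical hpsi)[L0 psiL psi_le0 psi_ge0] r s r0 rs.
  have H theta (t0 : 0 < theta) := mechanism_mono hd hpsi hW hv hX hu hPsi (ltW L0) psiL
    psi_le0 psi_ge0 r0 rs t0.
  split=> theta; last by move=> Lt; apply: (proj1 (H theta _)) => //; exact: lt_le_trans Lt.
  move=> /andP[]; rewrite le_eqVlt => /predU1P[<- _|t0]; last exact: (proj2 (H _ t0)).
  apply: (zero_le _ _ _ _ _ L0) => //; first exact: lt_le_trans rs.
  by move=> th th0; exact: (proj2 (H _ th0)).
Unshelve. all: by end_near. Qed.
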